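(* Let $\gamma\in C^2(S^1;\Omega)$ be an embedded curve, $b\neq0$ a Burgers vector and $\mu=b\otimes\tau\,\mathcal H^1|_\gamma$ the Nye dislocation measure. Then there exists a constant $E\in\mathbb{R}$ such that $$\lim_{\varepsilon\to0}\left(\mathcal E^{\mathrm{eff}}_\varepsilon(\mu)-\frac{|b|^2\,\mathcal H^1(\gamma)}{4\pi}\,|\log\varepsilon|\right)=E .$$
   Context: $\Omega\subset\mathbb{R}^3$ is a bounded, simply connected Lipschitz domain; embedded curves are closed and regular; $\gamma$ also denotes the image and $\tau$ the unit tangent. $B_\varepsilon(\gamma)=\{x:\operatorname{dist}(x,\gamma)<\varepsilon\}$, $\Omega_\varepsilon(\gamma)=\Omega\setminus B_\varepsilon(\gamma)$, $\nu$ is the exterior unit normal to $\Omega$ on $\partial\Omega$, $\wedge$ is the cross product, $(b\otimes v)_{ij}=b_iv_j$. The singular strain is $\mathcal S(x)=b\otimes\int_\gamma k(x-y)\wedge\tau_y\,d\mathcal H^1_y$ for $x\in\mathbb{R}^3\setminus\gamma$, with $k(x)=-\dfrac{x}{4\pi|x|^3}$. Put $I(v)=\frac12\int_\Omega|\nabla v|^2dx+\int_{\partial\Omega}v\cdot\mathcal S\nu\,d\mathcal H^2$ for $v\in H^1(\Omega;\mathbb{R}^3)$ and let $u$ be the unique zero-mean minimizer of $I$. The effective energy is $$\mathcal E^{\mathrm{eff}}_\varepsilon(\mu)=\frac12\int_{\Omega_\varepsilon(\gamma)}|\mathcal S|^2dx+I(u).$$ *)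

(* Defs.v *)
From HB Require Import structures.
From mathcomp Require Import all_boot all_order all_algebra.
From mathcomp Require Import all_classical all_reals all_analysis.
Import Order.TTheory GRing.Theory Num.Theory.
Import numFieldNormedType.Exports.

Set Implicit Arguments.
Unset Strict Implicit.
Unset Printing Implicit Defensive.

Local Open Scope classical_set_scope.
Local Open Scope ring_scope.

Section Euclidean.
Context {R : realType}.
Implicit Types (x y v w : 'rV[R]_3) (A : set 'rV[R]_3).

(* The library norm on ['rV[R]_3] is the sup norm; it is used only through the
   topology it induces. Lengths and distances are Euclidean. *)
Definition dot v w : R := \sum_i v 0 i * w 0 i.
Definition enorm v : R := Num.sqrt (dot v v).
Definition frob_sqr (M : 'M[R]_3) : R := \sum_i \sum_j M i j ^+ 2.

Definition cross v w : 'rV[R]_3 :=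
  let c := fun i => v 0 (inord i) in let d := fun i => w 0 (inord i) in
  \row_(j < 3) [:: c 1%N * d 2%N - c 2%N * d 1%N;
                   c 2%N * d 0%N - c 0%N * d 2%N;
                   c 0%N * d 1%N - c 1%N * d 0%N]`_j.

Definition tensor v w : 'M[R]_3 := v^T *m w.
Definition mxapply (M : 'M[R]_3) v : 'rV[R]_3 := v *m M^T.

Definition edist_set x A : R := inf [set enorm (x - y) | y in A].
Definition tube A (e : R) : set 'rV[R]_3 := [set x | edist_set x A < e].

Definition boundary A : set 'rV[R]_3 := closure A `\` A°.

End Euclidean.

Section Hausdorff.
Context {R : realType}.
Implicit Types (s : nat) (A : set 'rV[R]_3) (delta : R).
Local Open Scope ereal_scope.

(* Volume of the unit ball of R^s. *)
Fixpoint unit_ball_vol s : R :=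
  match s with
  | 0%N => 1
  | 1%N => 2
  | (s'.+2)%N => (2 * pi / s%:R * unit_ball_vol s')%R
  end.

Definition ediam A : \bar R :=
  ereal_sup [set (enorm (p.1 - p.2))%:E | p in A `*` A].

(* Normalized so that [hausdorff s] agrees with the s-dimensional area of
   s-dimensional surfaces. *)
Definition hausdorff_gauge s A : \bar R :=
  if A == set0 then 0 else (unit_ball_vol s / 2 ^+ s)%:E * ediam A ^+ s.

Definition delta_cover delta A : set ((set 'rV[R]_3)^nat) :=
  [set F | A `<=` \bigcup_k F k /\ forall k, ediam (F k) <= delta%:E].

Definition hausdorff_delta s delta A : \bar R :=
  ereal_inf [set \sum_(k <oo) hausdorff_gauge s (F k) | F in delta_cover delta A].

Definition hausdorff s A : \bar R :=
  ereal_sup [set hausdorff_delta s delta A | delta in [set delta | (0 < delta)%R]].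

Lemma unit_ball_vol_ge0 s : (0 <= unit_ball_vol s)%R.
Proof.
suff : (0 <= unit_ball_vol s)%R /\ (0 <= unit_ball_vol s.+1)%R by case.
elim: s => [|s [h1 h2]] /=; first by split; rewrite ?ler01 ?ler0n.
split => //; apply: mulr_ge0 => //; apply: divr_ge0; rewrite ?ler0n//.
by rewrite mulr_ge0 ?pi_ge0.
Qed.

Lemma hausdorff_gauge_ge0 s A : 0 <= hausdorff_gauge s A.
Proof.
rewrite /hausdorff_gauge; case: eqP => // /eqP/set0P[x Ax].
apply: mule_ge0.
  by rewrite lee_fin divr_ge0 ?unit_ball_vol_ge0 ?exprn_ge0.
apply: expe_ge0; apply: ereal_sup_ubound; exists (x, x) => //=.
by rewrite subrr /enorm /dot big1 ?sqrtr0// => i _; rewrite mxE mul0r.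
Qed.

Lemma hausdorff_gauge0 s : hausdorff_gauge s set0 = 0.
Proof. by rewrite /hausdorff_gauge eqxx. Qed.

Lemma hausdorff_delta_ge0 s delta A : 0 <= hausdorff_delta s delta A.
Proof.
by apply: le_ereal_inf_tmp => _ [F _ <-]; apply: nneseries_ge0 => *;
  exact: hausdorff_gauge_ge0.
Qed.

Lemma le_hausdorff_delta s delta :
  {homo hausdorff_delta s delta : A B / A `<=` B >-> A <= B}.
Proof.
move=> A B AB; apply: ereal_inf_le_tmp => _ [F [BF Fd] <-].
by exists F => //; split => //; exact: subset_trans BF.
Qed.

Lemma hausdorff_delta_sigma_subadditive s delta :
  sigma_subadditive (hausdorff_delta s delta).
Proof.
move=> A; have [[i ioo]|] :=
    pselect (exists i, hausdorff_delta s delta (A i) = +oo).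
  rewrite (eseries_pinfty _ _ ioo) ?leey// => n _.
  by rewrite -ltNye (lt_le_trans _ (hausdorff_delta_ge0 _ _ _)).
rewrite -forallNE => Aoo.
suff add2e (e : {posnum R}) : hausdorff_delta s delta (\bigcup_n A n) <=
    \sum_(i <oo) hausdorff_delta s delta (A i) + e%:num%:E.
  by apply/lee_addgt0Pr => _/posnumP[].
rewrite (le_trans _ (epsilon_trick _ _ _))//; last first.
  by move=> n; exact: hausdorff_delta_ge0.
pose P n (B : (set 'rV[R]_3)^nat) := delta_cover delta (A n) B /\
  \sum_(k <oo) hausdorff_gauge s (B k) <=
    hausdorff_delta s delta (A n) + (e%:num / (2 ^ n.+1)%:R)%:E.
have [G PG] : {G : ((set 'rV[R]_3)^nat)^nat & forall n, P n (G n)}.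
  apply: (@choice _ _ P) => n; rewrite /P /hausdorff_delta.
  set S := (X in ereal_inf X); move infS : (ereal_inf S) => iS.
  case: iS infS => [r Sr|Soo|Soo].
  - have en1 : (0 < e%:num / (2 ^ n.+1)%:R)%R by [].
    have /(lb_ereal_inf_adherent en1) : ereal_inf S \is a fin_num by rewrite Sr.
    move=> [x [B AnB muBx] xS].
    by exists B; split => //; rewrite muBx -Sr; exact/ltW.
  - by have := Aoo n; rewrite /hausdorff_delta Soo.
  - suff : lbound S 0 by move/le_ereal_inf_tmp; rewrite Soo.
    by move=> /= _ [B AnB <-]; apply: nneseries_ge0 => *;
      exact: hausdorff_gauge_ge0.
have /card_esym/ppcard_eqP[f] := card_nat2.
apply: (@le_trans _ _ (\sum_(i <oo) \sum_(j <oo) hausdorff_gauge s (G i j))).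
  apply: ereal_inf_lbound; exists (fun k => G (f k).1 (f k).2).
    split => [t [i _] /(PG i).1.1[j _ Gt]|k]; last exact: (PG (f k).1).1.2.
    by exists (f^-1%FUN (i, j)) => //=; rewrite invK ?inE.
  pose g (x : nat * nat) := hausdorff_gauge s (G x.1 x.2).
  have g0 x : 0 <= g x by exact: hausdorff_gauge_ge0.
  rewrite nneseries_esum => [|*]; last exact: g0.
  rewrite nneseries_esum => [|*]; last first.
    by apply: nneseries_ge0 => *; exact: (g0 (_, _)).
  under [RHS]eq_esum => i _.
    rewrite nneseries_esum; last by move=> *; exact: (g0 (_, _)).
    over.
  rewrite /= (@esum_esum _ _ _ _ (fun=> _) (fun i j => g (i, j))) => [|*];
    last exact: g0.
  rewrite (_ : _ `*`` _ = [set: nat * nat]); last by apply/seteqP; split.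
  rewrite (_ : [set _ | true] = [set: nat]); last by apply/seteqP; split.
  by rewrite (reindex_esum [set: nat] [set: nat * nat] f).
apply: lee_nneseries => n *; last exact: (PG n).2.
by apply: nneseries_ge0 => *; exact: hausdorff_gauge_ge0.
Qed.

Lemma hausdorff0 s : hausdorff s set0 = 0.
Proof.
apply/eqP; rewrite eq_le; apply/andP; split; last first.
  apply: (le_trans (hausdorff_delta_ge0 s 1 set0)).
  by apply: ereal_sup_ubound; exists 1%R => //=.
apply: ge_ereal_sup => _ [delta d0 <-].
apply: ereal_inf_lbound; exists (fun=> set0).
  split => // k; rewrite /ediam setX0 image_set0 ereal_sup0 leNye //.
by apply: eseries0 => *; exact: hausdorff_gauge0.
Qed.

Lemma hausdorff_ge0 s A : 0 <= hausdorff s A.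
Proof.
apply: (le_trans (hausdorff_delta_ge0 s 1 A)).
by apply: ereal_sup_ubound; exists 1%R => //=.
Qed.

Lemma le_hausdorff s : {homo hausdorff s : A B / A `<=` B >-> A <= B}.
Proof.
move=> A B AB; apply: ge_ereal_sup => _ [delta d0 <-].
apply: (le_trans (le_hausdorff_delta s delta AB)).
by apply: ereal_sup_ubound; exists delta.
Qed.

Lemma hausdorff_sigma_subadditive s : sigma_subadditive (hausdorff s).
Proof.
move=> F; apply: ge_ereal_sup => _ [delta d0 <-].
apply: (le_trans (hausdorff_delta_sigma_subadditive _ _ _)).
apply: lee_nneseries => [*|n *]; first exact: hausdorff_delta_ge0.
by apply: ereal_sup_ubound; exists delta.
Qed.

HB.instance Definition _ s := isOuterMeasure.Build R 'rV[R]_3 (hausdorff s)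
  (hausdorff0 s) (hausdorff_ge0 s) (@le_hausdorff s)
  (@hausdorff_sigma_subadditive s).

Definition hausdorff_outer_measure s :
  {outer_measure set 'rV[R]_3 -> \bar R} := hausdorff s.

(* The Hausdorff measure on its Caratheodory sigma-algebra. *)
Definition hausdorff_measure s :
    {measure set (caratheodory_type (hausdorff_outer_measure s)) -> \bar R} :=
  (hausdorff_outer_measure s :
     set (caratheodory_type (hausdorff_outer_measure s)) -> \bar R).

End Hausdorff.

Section Integrals.
Context {R : realType}.
Implicit Types (A : set 'rV[R]_3) (f : 'rV[R]_3 -> R).

(* Volume integrals are taken in coordinates, with respect to the product
   Lebesgue measure on R * R * R. *)
Definition row3 (p : R * R * R) : 'rV[R]_3 :=
  \row_(j < 3) [:: p.1.1; p.1.2; p.2]`_j.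

Definition lebesgue3 :=
  (@lebesgue_measure R \x @lebesgue_measure R \x @lebesgue_measure R)%E.

Definition vol_integral A f : R :=
  Rintegral lebesgue3 (row3 @^-1` A) (f \o row3).

(* Integral over [A] against the [s]-dimensional Hausdorff measure. *)
Definition area_integral (s : nat) A f : R :=
  Rintegral (@hausdorff_measure R s) A f.

Definition square_integrable d (T : measurableType d)
    (mu : {measure set T -> \bar R}) (D : set T) (f : T -> R) :=
  measurable_fun D f /\ mu.-integrable D (fun x => (f x ^+ 2)%:E).

Definition L2_vol A f := square_integrable lebesgue3 (row3 @^-1` A) (f \o row3).

Definition L2_area (s : nat) A f :=
  square_integrable (@hausdorff_measure R s) A f.

End Integrals.

Section Domains.
Context {R : realType}.
Implicit Types (Omega : set 'rV[R]_3) (x n : 'rV[R]_3).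

Definition domain Omega := [/\ Omega !=set0, open Omega & connected Omega].

Definition simply_connected Omega :=
  forall c : R -> 'rV[R]_3,
    {within `[0, 1], continuous c} -> c @` `[0, 1] `<=` Omega -> c 0 = c 1 ->
  exists H : R * R -> 'rV[R]_3,
    [/\ {within `[0, 1] `*` `[0, 1], continuous H},
        H @` (`[0, 1] `*` `[0, 1]) `<=` Omega,
        (forall t, t \in `[0, 1] -> H (t, 0) = c t /\ H (t, 1) = c 0) &
        (forall r, r \in `[0, 1] -> H (0, r) = c 0 /\ H (1, r) = c 0)].

(* Near each boundary point, and in suitable orthonormal coordinates (the rows
   of [Q]), [Omega] is the region above the graph of a Lipschitz function. *)
Definition Lipschitz_boundary Omega :=
  forall p, boundary Omega p ->
  exists (Q : 'M[R]_3) (r : R) (g : 'rV[R]_2 -> R),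
    [/\ Q *m Q^T = 1%:M, 0 < r, lipschitz g &
      forall x, enorm (x - p) < r ->
        let y := mxapply Q x in
        Omega x <-> g (\row_(j < 2) y 0 (inord j)) < y 0 (inord 2)].

(* [n] is the exterior unit normal at [x] when [Omega] has, at [x], the tangent
   half-space with exterior normal [n]: each cone around [-n] (resp. [n]) with
   vertex [x] and opening less than pi lies, near [x], inside (resp. outside)
   [Omega]. In a graph chart this holds exactly at the points where the graph
   function is differentiable, hence almost everywhere on the boundary. *)
Definition is_exterior_normal Omega x n :=
  enorm n = 1 /\
  forall eta : R, 0 < eta -> exists2 r : R, 0 < r &
    forall y, enorm (y - x) < r ->
      (dot (y - x) n < - (eta * enorm (y - x)) -> Omega y) /\
      (eta * enorm (y - x) < dot (y - x) n -> ~ Omega y).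

Definition exterior_normal Omega x : 'rV[R]_3 :=
  xget 0 [set n | is_exterior_normal Omega x n].

End Domains.

Section Sobolev.
Context {R : realType}.
Implicit Types (Omega : set 'rV[R]_3) (v w : 'rV[R]_3 -> 'rV[R]_3)
  (f phi : 'rV[R]_3 -> R) (G : 'rV[R]_3 -> 'M[R]_3).

Definition partial (j : 'I_3) f : 'rV[R]_3 -> R :=
  fun x => 'D_(delta_mx 0 j : 'rV[R]_3) f x.

Fixpoint Ck (k : nat) f : Prop :=
  continuous f /\
  if k is k'.+1 then
    forall j : 'I_3, (forall x, derivable f x (delta_mx 0 j)) /\
      Ck k' (partial j f)
  else True.

Definition smooth f := forall k, Ck k f.

Definition test_function Omega phi :=
  smooth phi /\
  exists2 K, compact K /\ K `<=` Omega & forall x, ~ K x -> phi x = 0.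

(* Convention: [(grad v)_ij] is the derivative of the i-th component of [v] in
   the j-th direction. *)
Definition is_weak_grad Omega v G :=
  forall i j,
    L2_vol Omega (fun x => G x i j) /\
    forall phi, test_function Omega phi ->
      vol_integral Omega (fun x => v x 0 i * partial j phi x) =
      - vol_integral Omega (fun x => G x i j * phi x).

Definition H1 Omega v :=
  (forall i, L2_vol Omega (fun x => v x 0 i)) /\ exists G, is_weak_grad Omega v G.

Definition weak_grad Omega v : 'rV[R]_3 -> 'M[R]_3 :=
  xget (fun=> 0) [set G | is_weak_grad Omega v G].

Definition classical_grad v : 'rV[R]_3 -> 'M[R]_3 :=
  fun x => \matrix_(i, j) partial j (fun y => v y 0 i) x.

(* The trace operator on [H1 Omega] is the closure of the restriction of smooth
   fields to the boundary. *)
Definition is_trace Omega v w :=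
  (forall i, L2_area 2 (boundary Omega) (fun x => w x 0 i)) /\
  exists Phi : nat -> 'rV[R]_3 -> 'rV[R]_3,
    [/\ forall m i, smooth (fun x => Phi m x 0 i),
        vol_integral Omega (fun x => enorm (Phi m x - v x) ^+ 2)
          @[m --> \oo] --> 0,
        vol_integral Omega
          (fun x => frob_sqr (classical_grad (Phi m) x - weak_grad Omega v x))
          @[m --> \oo] --> 0 &
        area_integral 2 (boundary Omega) (fun x => enorm (Phi m x - w x) ^+ 2)
          @[m --> \oo] --> 0].

Definition trace Omega v : 'rV[R]_3 -> 'rV[R]_3 :=
  xget (fun=> 0) [set w | is_trace Omega v w].

End Sobolev.

Section Dislocations.
Context {R : realType}.
Implicit Types (Omega : set 'rV[R]_3) (gamma : R -> 'rV[R]_3)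
  (b x y : 'rV[R]_3) (u v : 'rV[R]_3 -> 'rV[R]_3).

Definition C2_curve gamma :=
  [/\ forall t, derivable gamma t 1, forall t, derivable (derive1 gamma) t 1 &
      continuous (derive1 (derive1 gamma))].

(* Closed curves are parametrized by S^1 = R / Z, that is, by 1-periodic maps. *)
Definition embedded_closed_curve gamma :=
  [/\ forall t, gamma (t + 1) = gamma t,
      {in `[0, 1[ &, injective gamma} &
      forall t, derive1 gamma t != 0].

(* Unit tangent, as a vector field on the image of [gamma]. *)
Definition tangent gamma y : 'rV[R]_3 :=
  let t := xget 0 [set t | gamma t = y] in
  (enorm (derive1 gamma t))^-1 *: derive1 gamma t.

Definition strain_kernel x : 'rV[R]_3 := - (4 * pi * enorm x ^+ 3)^-1 *: x.

(* The Nye measure [tensor b tau * H^1] on [gamma] is represented by the pair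
   [(b, gamma)]; the singular strain it generates depends on nothing else. *)
Definition singular_strain b gamma x : 'M[R]_3 :=
  tensor b (\row_(j < 3) area_integral 1 (range gamma)
    (fun y => cross (strain_kernel (x - y)) (tangent gamma y) 0 j)).

Definition elastic_functional Omega b gamma v : R :=
  1 / 2 * vol_integral Omega (fun x => frob_sqr (weak_grad Omega v x)) +
  area_integral 2 (boundary Omega) (fun x =>
    dot (trace Omega v x)
        (mxapply (singular_strain b gamma x) (exterior_normal Omega x))).

Definition zero_mean_minimizer Omega b gamma u :=
  [/\ H1 Omega u, forall i, vol_integral Omega (fun x => u x 0 i) = 0 &
      forall v, H1 Omega v ->
        elastic_functional Omega b gamma u <= elastic_functional Omega b gamma v].

Definition effective_energy Omega b gamma u (e : R) : R :=
  1 / 2 * vol_integral (Omega `\` tube (range gamma) e)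
            (fun x => frob_sqr (singular_strain b gamma x)) +
  elastic_functional Omega b gamma u.

End Dislocations.

(* Main.v *)
From HB Require Import structures.
Require Import Defs.
From mathcomp Require Import all_boot all_order all_algebra.
From mathcomp Require Import all_classical all_reals all_analysis.
From mathcomp Require Import measurable_realfun.
From mathcomp Require Import zify ring lra.
Import Order.TTheory GRing.Theory Num.Theory.
Import numFieldNormedType.Exports.

(** The elastic functional at the minimizer does not depend on [e], so the
    theorem is about the integral of the squared strain off the tube of radius
    [e]. At distance [d] from the loop the strain is, to leading order, that of a
    straight line: its square is [|b|^2 / (4 pi^2 d^2)] up to an error of order
    [d^(-3/2)] ([field_sqr_asymptotics], [strain_density_asymptotics]). The tube of
    radius [r] has volume [pi L r^2] up to an error of order [r^(9/4)]
    ([loop_tube_volume]), where [L] is the length of the loop. By the layer-cake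
    formula, the shell of points at distance between [e] and [e'] from the loop
    therefore contributes [2 pi L ln (e' / e)] to the integral of [d^-2], up to an
    error of order [e'^(1/4)] when [e' <= 2 e] ([inverse_square_shell]); after
    multiplication by [|b|^2 / (8 pi^2)] this is the increment of the logarithm in
    the statement. The errors form a geometric series over dyadic radii, so the
    renormalized energy is Cauchy as [e] tends to [0] ([dyadic_cvg],
    [logarithmic_divergence]).

    The volume of the tubes is obtained without tubular coordinates. The kernel
    [sqrt (r^2 - |x - y|^2)], extended by [0], is integrated over [y] in the loop
    and over [x] in space. The integral over space is computed slice by slice and
    is a constant times [r^4] ([integral_half_ball], [integral_tube_mass]). The
    integral over the loop is close to [pi / 2 (r^2 - d^2)], the area of a
    half-disc of radius [sqrt (r^2 - d^2)] ([tube_kernel_asymptotics]). So the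
    integral of [r^2 - d^2] over the tube is known to leading order, and since the
    volume is monotone in [r] this relation can be differentiated, as in Tauberian
    theorems ([tubular_measure]).

    Both asymptotic expansions compare the loop with its tangent line at the foot
    of [x] ([local_expansion]); the comparison is uniform in [x] by the chord-arc
    inequality ([chord_arc]). Integrals against the one-dimensional Hausdorff
    measure are turned into integrals over a period by an area formula
    ([arc_integralE]): both sides are additive over subarcs and agree to first
    order on short ones. *)

Set Implicit Arguments.
Unset Strict Implicit.
Unset Printing Implicit Defensive.

Local Open Scope classical_set_scope.
Local Open Scope ring_scope.

(** * Euclidean geometry in coordinates *)

Section Euclid.
Context {R : realType}.
Implicit Types v w : 'rV[R]_3.

Lemma ord3P (P : 'I_3 -> Prop) :
  P (inord 0) -> P (inord 1) -> P (inord 2) -> forall i, P i.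
Proof.
move=> p0 p1 p2 [[|[|[|//]]] lti]; [have := p0|have := p1|have := p2];
  by congr P; apply: val_inj; rewrite /= inordK.
Qed.

Lemma sum3E (F : 'I_3 -> R) : \sum_i F i = F (inord 0) + F (inord 1) + F (inord 2).
Proof.
rewrite !big_ord_recl big_ord0 addr0 addrA.
by congr (F _ + F _ + F _); apply: val_inj; rewrite /= inordK.
Qed.

Lemma dotE v w : dot v w = v 0 (inord 0) * w 0 (inord 0)
  + v 0 (inord 1) * w 0 (inord 1) + v 0 (inord 2) * w 0 (inord 2).
Proof. by rewrite /dot sum3E. Qed.

Lemma crossE v w : [/\ cross v w 0 (inord 0) =
    v 0 (inord 1) * w 0 (inord 2) - v 0 (inord 2) * w 0 (inord 1),
  cross v w 0 (inord 1) =
    v 0 (inord 2) * w 0 (inord 0) - v 0 (inord 0) * w 0 (inord 2) &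
  cross v w 0 (inord 2) =
    v 0 (inord 0) * w 0 (inord 1) - v 0 (inord 1) * w 0 (inord 0)].
Proof. by split; rewrite mxE inordK. Qed.

Lemma dotC v w : dot v w = dot w v.
Proof. by rewrite !dotE; ring. Qed.

Lemma dotDl u v w : dot (u + v) w = dot u w + dot v w.
Proof. by rewrite !dotE !mxE; ring. Qed.

Lemma dotZl a v w : dot (a *: v) w = a * dot v w.
Proof. by rewrite !dotE !mxE; ring. Qed.

Lemma dotNl v w : dot (- v) w = - dot v w.
Proof. by rewrite !dotE !mxE; ring. Qed.

Lemma dotDr u v w : dot u (v + w) = dot u v + dot u w.
Proof. by rewrite dotC dotDl ![dot _ u]dotC. Qed.

Lemma dotZr a v w : dot v (a *: w) = a * dot v w.
Proof. by rewrite dotC dotZl dotC. Qed.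

Lemma dotNr v w : dot v (- w) = - dot v w.
Proof. by rewrite dotC dotNl dotC. Qed.

Lemma dot_sub3 (a : R) u v w :
  dot (u - a *: v - w) (u - a *: v - w) =
  dot u u - 2 * a * dot u v + a ^+ 2 * dot v v + dot w w - 2 * dot u w + 2 * a * dot v w.
Proof. by rewrite !dotE !mxE; ring. Qed.

Lemma dot_ge0 v : 0 <= dot v v.
Proof. by apply: sumr_ge0 => i _; rewrite -expr2 sqr_ge0. Qed.

Lemma enorm_ge0 v : 0 <= enorm v.
Proof. exact: sqrtr_ge0. Qed.

Lemma enorm_sqr v : enorm v ^+ 2 = dot v v.
Proof. by rewrite sqr_sqrtr// dot_ge0. Qed.

Lemma enormN v : enorm (- v) = enorm v.
Proof. by rewrite /enorm dotNl dotNr opprK. Qed.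

Lemma enormB v w : enorm (v - w) = enorm (w - v).
Proof. by rewrite -enormN opprB. Qed.

Lemma enorm0 : enorm (0 : 'rV[R]_3) = 0.
Proof. by rewrite /enorm dotE !mxE mul0r !addr0 sqrtr0. Qed.

Lemma enormZ a v : enorm (a *: v) = `|a| * enorm v.
Proof.
by rewrite /enorm dotZl dotZr mulrA -expr2 sqrtrM ?sqr_ge0// sqrtr_sqr.
Qed.

Lemma enorm_coord v i : `|v 0 i| <= enorm v.
Proof.
rewrite -sqrtr_sqr ler_sqrt ?dot_ge0// /dot (bigD1 i)//= -expr2 lerDl.
by apply: sumr_ge0 => j _; rewrite -expr2 sqr_ge0.
Qed.

Lemma enorm_eq0 v : (enorm v == 0) = (v == 0).
Proof.
apply/eqP/eqP => [v0|->]; last exact: enorm0.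
apply/rowP => i; rewrite mxE; apply/normr0_eq0/le_anti.
by rewrite normr_ge0 -v0 enorm_coord.
Qed.

Lemma enorm_gt0 v : (0 < enorm v) = (v != 0).
Proof. by rewrite lt_def enorm_eq0 enorm_ge0 andbT. Qed.

(** Lagrange's identity; it yields both the Cauchy-Schwarz inequality and the
    bound on the cross product. *)
Lemma enorm_cross_sqr v w :
  enorm (cross v w) ^+ 2 = (enorm v * enorm w) ^+ 2 - dot v w ^+ 2.
Proof.
have [c0 c1 c2] := crossE v w.
by rewrite exprMn !enorm_sqr !dotE c0 c1 c2; ring.
Qed.

Lemma Cauchy_Schwarz v w : `|dot v w| <= enorm v * enorm w.
Proof.
rewrite -(@ler_pXn2r _ 2)// ?nnegrE ?mulr_ge0 ?enorm_ge0//.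
by rewrite real_normK ?num_real// -subr_ge0 -enorm_cross_sqr sqr_ge0.
Qed.

Lemma enorm_cross v w : enorm (cross v w) <= enorm v * enorm w.
Proof.
rewrite -(@ler_pXn2r _ 2)// ?nnegrE ?mulr_ge0 ?enorm_ge0//.
by rewrite enorm_cross_sqr gerBl sqr_ge0.
Qed.

Lemma enormD v w : enorm (v + w) <= enorm v + enorm w.
Proof.
rewrite -(@ler_pXn2r _ 2)// ?nnegrE ?addr_ge0 ?enorm_ge0//.
rewrite sqrrD !enorm_sqr dotDl !dotDr (dotC w v).
have := le_trans (ler_norm _) (Cauchy_Schwarz v w); lra.
Qed.

Lemma enormD3 u v w : enorm (u - w) <= enorm (u - v) + enorm (v - w).
Proof. by apply: le_trans (enormD _ _); rewrite addrA subrK. Qed.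

Lemma enorm_le_sum v : enorm v <= \sum_i `|v 0 i|.
Proof.
rewrite -(@ler_pXn2r _ 2)// ?nnegrE ?enorm_ge0 ?sumr_ge0//.
rewrite enorm_sqr dotE sum3E -!expr2.
rewrite -(real_normK (num_real (v 0 (inord 0)))) -(real_normK (num_real (v 0 (inord 1))))
  -(real_normK (num_real (v 0 (inord 2)))).
have := normr_ge0 (v 0 (inord 0)); have := normr_ge0 (v 0 (inord 1)).
have := normr_ge0 (v 0 (inord 2)); nra.
Qed.

Lemma mx_norm_coord v i : `|v 0 i| <= `|v|.
Proof.
rewrite /Num.norm/= mx_normrE.
exact: (@le_bigmax _ _ _ 0 (fun ij : 'I_1 * 'I_3 => `|v ij.1 ij.2|) (0, i)).
Qed.

(** With [mx_norm_le_enorm]: neighborhoods for the sup norm are the Euclidean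
    ones. *)
Lemma le_enorm_mx_norm v : enorm v <= 3 * `|v|.
Proof.
apply: (le_trans (enorm_le_sum v)); rewrite sum3E.
have := mx_norm_coord v (inord 0); have := mx_norm_coord v (inord 1).
have := mx_norm_coord v (inord 2); lra.
Qed.

Lemma mx_norm_le_enorm v : `|v| <= enorm v.
Proof.
rewrite /Num.norm/= mx_normrE; apply/bigmax_leP; split; first exact: enorm_ge0.
by case=> [i j] _ /=; rewrite ord1 enorm_coord.
Qed.

Lemma enorm_lip v w : `|enorm v - enorm w| <= enorm (v - w).
Proof.
have := enormD3 v w 0; have := enormD3 w v 0; rewrite !subr0 (enormB w v).
by rewrite ler_norml; move=> *; apply/andP; split; lra.
Qed.

Lemma continuous_enorm : continuous (@enorm R).
Proof.
move=> v; apply/(@cvgrPdist_lt _ _ _ (nbhs v) (nbhs_filter v)) => e e0.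
have e3 : 0 < e / 3 by rewrite divr_gt0.
apply/nbhs_ballP; exists (e / 3) => //= w; rewrite -ball_normE/= => vw.
apply: (le_lt_trans (enorm_lip _ _)).
apply: (le_lt_trans (le_enorm_mx_norm _)).
by rewrite mulrC -ltr_pdivlMr.
Qed.

Lemma continuous_dot w : continuous (fun v => dot v w).
Proof.
rewrite (_ : (fun v => _) = (fun v : 'rV[R]_3 => v 0 (inord 0) * w 0 (inord 0)
  + v 0 (inord 1) * w 0 (inord 1) + v 0 (inord 2) * w 0 (inord 2))).
  have c i : continuous (fun v : 'rV[R]_3 => v 0 i * w 0 i).
    by move=> v; apply: (cvgM (@coord_continuous R 1 3 0 i v) (cvg_cst _)).
  move=> v.
  exact: (cvgD (cvgD (c _ v) (c _ v)) (c _ v)).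
by apply/funext => v; rewrite dotE.
Qed.

End Euclid.

(** * Closed sets are measurable for Hausdorff measures *)

Section Hausdorff.
Context {R : realType} (s : nat).
Implicit Types (A B C X : set 'rV[R]_3).
Local Open Scope ereal_scope.

Lemma le_ediam A B : A `<=` B -> ediam A <= ediam B.
Proof.
move=> AB; apply: ge_ereal_sup => _ [[x y] [/= Ax Ay] <-].
by apply: ereal_sup_ubound; exists (x, y) => //; split => /=; exact: AB.
Qed.

Lemma ediam_ub A x y : A x -> A y -> (enorm (x - y))%:E <= ediam A.
Proof. by move=> Ax Ay; apply: ereal_sup_ubound; exists (x, y). Qed.

Lemma ediam_ge0 A : A !=set0 -> 0 <= ediam A.
Proof.
by case=> x Ax; have := ediam_ub Ax Ax; rewrite subrr enorm0.
Qed.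

Lemma le_hausdorff_gauge A B : A `<=` B ->
  hausdorff_gauge s A <= hausdorff_gauge s B.
Proof.
move=> AB; have [->|/set0P A0] := eqVneq A set0.
  by rewrite hausdorff_gauge0 hausdorff_gauge_ge0.
have B0 : B !=set0 by case: A0 => x /AB; exists x.
rewrite /hausdorff_gauge; case: ifPn => [/eqP A0'|_].
  by case: A0 => x; rewrite A0'.
case: ifPn => [/eqP B0'|_]; first by case: B0 => x; rewrite B0'.
apply: lee_wpmul2l.
  by rewrite lee_fin divr_ge0 ?unit_ball_vol_ge0 ?exprn_ge0.
elim: s => [|n IH]; first by rewrite !expe0.
rewrite !expeS; apply: lee_pmul => //; last exact: le_ediam.
  exact: ediam_ge0.
by rewrite expe_ge0// ediam_ge0.
Qed.

Lemma hausdorff_delta_anti (d e : R) A : (d <= e)%R ->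
  hausdorff_delta s e A <= hausdorff_delta s d A.
Proof.
move=> de; apply: ereal_inf_le_tmp => _ [F [AF Fd] <-].
by exists F => //; split => // k; apply: (le_trans (Fd k)); rewrite lee_fin.
Qed.

(** A covering by sets of diameter less than [eta] cannot link [A] to [B], so
    it splits into a covering of [A] and one of [B]. *)
Lemma hausdorff_separated (eta : R) A B : (0 < eta)%R ->
  (forall x y, A x -> B y -> (eta <= enorm (x - y))%R) ->
  hausdorff s A + hausdorff s B <= hausdorff s (A `|` B).
Proof.
move=> eta0 AB.
have add_delta (d : R) : (0 < d)%R -> (d < eta)%R ->
    hausdorff_delta s d A + hausdorff_delta s d B <= hausdorff s (A `|` B).
  move=> d0 deta; apply: (@le_trans _ _ (hausdorff_delta s d (A `|` B))); last first.
    by apply: ereal_sup_ubound; exists d.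
  apply: le_ereal_inf_tmp => _ [F [ABF Fd] <-].
  have FA C : delta_cover d C (fun k => F k `&` C) \/ ~ (C `<=` A `|` B).
    have [CAB|] := pselect (C `<=` A `|` B); [left|by right].
    split => [x Cx|k]; first by have [k _ Fkx] := ABF _ (CAB _ Cx); exists k.
    by apply: le_trans (Fd k); apply: le_ediam => x [].
  have [|/(_ (@subsetUl _ A B))//] := FA A.
  have [|/(_ (@subsetUr _ A B))//] := FA B => dB dA.
  apply: (@le_trans _ _ (\sum_(k <oo) hausdorff_gauge s (F k `&` A) +
      \sum_(k <oo) hausdorff_gauge s (F k `&` B))).
    by apply: leeD; apply: ereal_inf_lbound;
      [exists (fun k => F k `&` A)|exists (fun k => F k `&` B)].
  rewrite -nneseriesD; [|by move=> *; exact: hausdorff_gauge_ge0..].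
  apply: lee_nneseries => [k _ _|k _].
    by rewrite adde_ge0 ?hausdorff_gauge_ge0.
  have [FA0|/set0P[x [Fx Ax]]] := eqVneq (F k `&` A) set0.
    by rewrite FA0 hausdorff_gauge0 add0e le_hausdorff_gauge.
  rewrite (_ : F k `&` B = set0) ?hausdorff_gauge0 ?adde0.
    by rewrite le_hausdorff_gauge.
  rewrite -subset0 => y [Fy By].
  have := le_trans (ediam_ub Fx Fy) (Fd k); rewrite lee_fin => xyd.
  by have := le_lt_trans (le_trans (AB _ _ Ax By) xyd) deta; rewrite ltxx.
have HAB (d e : R) : (0 < d)%R -> (0 < e)%R ->
    hausdorff_delta s d A + hausdorff_delta s e B <= hausdorff s (A `|` B).
  move=> d0 e0; pose m := Num.min (Num.min d e) (eta / 2)%R.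
  have m0 : (0 < m)%R by rewrite !lt_min d0 e0 divr_gt0.
  apply: le_trans (add_delta m m0 _); last first.
    by rewrite /m gt_min; apply/orP; right; rewrite ltr_pdivrMr// ltr_pMr// ltr1n.
  by apply: leeD; apply: hausdorff_delta_anti; rewrite /m !ge_min lexx ?orbT.
have [HBoo|HB] := eqVneq (hausdorff s (A `|` B)) +oo; first by rewrite HBoo leey.
have fin C : C `<=` A `|` B -> hausdorff s C \is a fin_num.
  move=> CAB; rewrite ge0_fin_numE ?hausdorff_ge0//.
  by rewrite (le_lt_trans (le_hausdorff s CAB))// ltey.
have fA := fin A (@subsetUl _ A B); have fB := fin B (@subsetUr _ A B).
rewrite -leeBrDr//; apply: ge_ereal_sup => _ [d /= d0 <-].
have fdA : hausdorff_delta s d A \is a fin_num.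
  rewrite ge0_fin_numE ?hausdorff_delta_ge0//.
  apply: (@le_lt_trans _ _ (hausdorff s A)); last by rewrite -ge0_fin_numE ?hausdorff_ge0.
  by apply: ereal_sup_ubound; exists d.
rewrite leeBrDr// addeC -leeBrDr//; apply: ge_ereal_sup => _ [e /= e0 <-].
by rewrite leeBrDr// addeC HAB.
Qed.

(** Caratheodory's criterion. The part of [X] off [C] is exhausted by the sets
    [X_ n] at distance [1 / (n + 1)] from [C]; the shells between [X_ n.+1] and
    [X_ n.+2] are separated from [X_ n], so their measures have a finite sum and
    [X_ n] misses little of [X `\` C]. *)
Lemma caratheodory_closed C :
  (forall x, ~ C x -> exists2 eta : R, (0 < eta)%R &
     forall y, C y -> (eta <= enorm (x - y))%R) ->
  (@hausdorff_outer_measure R s).-caratheodory C.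
Proof.
move=> clC; apply: le_caratheodory_measurable => X.
rewrite /hausdorff_outer_measure/=.
have [->|Xfin] := eqVneq (hausdorff s X) +oo; first by rewrite leey.
have HX : hausdorff s X < +oo by rewrite ltey.
pose X_ n := [set x | [/\ X x, ~ C x & forall y, C y -> (n.+1%:R^-1 <= enorm (x - y))%R]].
have X_X n : X_ n `<=` X by move=> x [].
have X_nd n : X_ n `<=` X_ n.+1.
  move=> x [Xx nCx xC]; split => // y Cy; apply: le_trans (xC _ Cy).
  by rewrite lef_pV2 ?posrE// ler_nat.
pose D n := X_ n.+2 `\` X_ n.+1.
have stepD n : hausdorff s (X_ n) + hausdorff s (D n) <= hausdorff s (X_ n.+2).
  apply: (@le_trans _ _ (hausdorff s (X_ n `|` D n))); last first.
    by apply: le_hausdorff => x [/X_nd/X_nd//|[]].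
  apply: (@hausdorff_separated (n.+1%:R^-1 - n.+2%:R^-1)%R).
    by rewrite subr_gt0 ltf_pV2 ?posrE// ltr_nat.
  move=> x z [_ _ xC] [[Xz nCz _] nXz].
  have [y Cy zy] : exists2 y, C y & (enorm (z - y) < n.+2%:R^-1)%R.
    apply: contra_notP nXz => nzy; split => // y Cy.
    by rewrite leNgt; apply/negP => zy; apply: nzy; exists y.
  rewrite lerBlDr; apply: (le_trans (xC _ Cy)); apply: (le_trans (enormD3 x z y)).
  by rewrite lerD2l ltW.
have sumD n : \sum_(0 <= k < n) hausdorff s (D k) <=
    hausdorff s (X_ n) + hausdorff s (X_ n.+1).
  elim: n => [|n IH]; first by rewrite big_nil adde_ge0 ?hausdorff_ge0.
  rewrite big_nat_recr//=; apply: (le_trans (leeD2r _ IH)).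
  by rewrite addeAC addeC leeD2l// stepD.
have D_fin : \sum_(k <oo) hausdorff s (D k) < +oo.
  apply: (@le_lt_trans _ _ (hausdorff s X + hausdorff s X)); last first.
    by rewrite lte_add_pinfty.
  apply: lime_le.
    by apply: is_cvg_nneseries => *; exact: hausdorff_ge0.
  near=> n; apply: (le_trans (sumD n)).
  by apply: leeD; apply: le_hausdorff; exact: X_X.
have tail := nneseries_tail_cvg D_fin (fun k _ => hausdorff_ge0 s (D k)).
have XC n : X `&` ~` C `<=` X_ n.+1 `|` \bigcup_(k in ~` `I_n) D k.
  move=> x [Xx nCx]; have [xn|xn] := pselect (X_ n.+1 x); [by left|right].
  have [eta eta0 xeta] := clC x nCx.
  have [m xm] : exists m, X_ m.+1 x.
    have /ltr_add_invr[m] := eta0; rewrite add0r => meta.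
    exists m; split => // y Cy; apply: le_trans (xeta _ Cy).
    by apply: le_trans (ltW meta); rewrite lef_pV2 ?posrE// ler_nat.
  have nm : (n < m)%N.
    rewrite ltnNge; apply/negP => mn; apply: xn.
    rewrite -(subnK mn); elim: (n - m)%N => [//|k IH]; rewrite addSn; exact: X_nd.
  have := subnK nm; move: (m - n.+1)%N => k km; subst m.
  elim: k xm {nm} => [|k IH] xm.
    by exists n => //=; rewrite ltnn.
  have [xk|xk] := pselect (X_ (k + n.+1).+1 x); first exact: IH.
  exists (k + n.+1)%N; last by rewrite addSn in xm.
  by move=> /= /(leq_ltn_trans (leq_addl k n.+1)); rewrite ltnNge leqnSn.
have split_le n : hausdorff s (X `&` C) + hausdorff s (X `&` ~` C) <=
    hausdorff s X + \sum_(n <= k <oo) hausdorff s (D k).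
  apply: (@le_trans _ _ (hausdorff s (X `&` C) + (hausdorff s (X_ n.+1) +
      \sum_(n <= k <oo) hausdorff s (D k)))).
    apply: leeD2l; apply: (le_trans (le_hausdorff s (XC n))).
    apply: (le_trans (outer_measureU2 (hausdorff_outer_measure s) _ _)).
    apply: leeD2l.
    exact: (outer_measure_sigma_subadditive_tail (hausdorff_outer_measure s)).
  rewrite addeA leeD2r//.
  apply: (@le_trans _ _ (hausdorff s ((X `&` C) `|` X_ n.+1))); last first.
    by apply: le_hausdorff => x [[]|/X_X].
  apply: (@hausdorff_separated (n.+2%:R^-1)%R).
    by rewrite invr_gt0.
  by move=> y x [_ Cy] [_ _ xC]; rewrite enormB xC.
apply/lee_addgt0Pr => e e0.
have /fine_cvgP[fin_tail] := tail.
move/cvgrPdist_lt => /(_ e e0) near_e.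
near \oo => n.
apply: (le_trans (split_le n)); apply: leeD2l.
have fn : \sum_(n <= k <oo) hausdorff s (D k) \is a fin_num by near: n.
rewrite -[leLHS]fineK// lee_fin.
have : (`|0 - fine (\sum_(n <= k <oo) hausdorff s (D k))| < e)%R by near: n.
by rewrite sub0r normrN => /ltW; apply: le_trans; exact: ler_norm.
Unshelve. all: by end_near. Qed.

End Hausdorff.

(** * The area formula for arcs *)

Section additive.
Context {R : realType}.

(** A form of the principle of real induction: the supremum of the [s] for which
    [`|D a s| <= eta * (s - a)] can be neither less than [b] nor unattained. *)
Lemma additive_small (D : R -> R -> R) (a b : R) : a <= b ->
  (forall c d e, a <= c -> c <= d -> d <= e -> e <= b -> D c e = D c d + D d e) ->
  (forall t eta : R, a <= t <= b -> 0 < eta -> exists2 delta : R, 0 < delta &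
    forall c d, a <= c -> c <= t -> t <= d -> d <= b -> t - c <= delta -> d - t <= delta ->
      `|D c d| <= eta * (d - c)) ->
  D a b = 0.
Proof.
move=> ab addD locD; apply/normr0_eq0/le_anti; rewrite normr_ge0 andbT.
have Daa : D a a = 0.
  have := addD a a a (lexx _) (lexx _) (lexx _) ab; lra.
apply/ler_addgt0Pl => e e0.
suff : `|D a b| <= e / (b - a + 1) * (b - a).
  move=> /le_trans; apply; rewrite addr0 mulrAC ler_pdivrMr; last by lra.
  by rewrite ler_pM2l//; lra.
have eta0 : 0 < e / (b - a + 1) by rewrite divr_gt0//; lra.
move: (e / _) eta0 => eta eta0.
pose S := [set s | [/\ a <= s, s <= b & `|D a s| <= eta * (s - a)]].
have Sa : S a by split => //; rewrite Daa subrr mulr0 normr0.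
have supS : has_sup S by split; [exists a|exists b => s []].
have aS : a <= sup S by exact: ub_le_sup supS.2 _ _.
have Sb : sup S <= b by apply: ge_sup; [exists a|move=> s []].
have [|delta delta0 Ddelta] := locD (sup S) eta _ eta0; first by rewrite aS.
have [s Ss sS] := sup_adherent delta0 supS.
have sleS : s <= sup S by exact: ub_le_sup supS.2 _ _.
have [as_ sb Ds] := Ss.
pose d := Num.min b (sup S + delta / 2).
have Sd : sup S <= d by rewrite le_min Sb lerDl divr_ge0 ?ltW.
have db : d <= b by rewrite ge_min lexx.
have Sd' : S d.
  split => //; first exact: le_trans Sd.
  rewrite (addD a s d) ?(le_trans sleS)//.
  apply: (le_trans (ler_normD _ _)).
  have -> : eta * (d - a) = eta * (s - a) + eta * (d - s) by ring.
  apply: lerD => //; apply: Ddelta => //; first by lra.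
  have : d <= sup S + delta / 2 by rewrite ge_min lexx orbT.
  lra.
have dS : d <= sup S by exact: ub_le_sup supS.2 _ _.
have db' : d = b.
  move: dS; rewrite /d; case: (leP b (sup S + delta / 2)) => // _ ?; lra.
by have [_ _] := Sd'; rewrite db'.
Qed.

End additive.

Section curve.
Context {R : realType} (g : R -> 'rV[R]_3).
Hypothesis dg : forall t : R, derivable g t 1.

Lemma is_derive_coord (i : 'I_3) (t : R) :
  is_derive t 1 (fun s : R => g s 0 i : R) (derive1 g t 0 i).
Proof.
have dgi : derivable (fun s : R => g s 0 i : R) t 1.
  exact: (proj1 (derivable_mxP g t 1) (@dg t) 0 i).
by apply: DeriveDef => //; rewrite derive1E derive_mx ?mxE.
Qed.

Lemma continuous_curve : continuous g.
Proof. by move=> t; apply/differentiable_continuous/derivable1_diffP. Qed.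

Lemma mean_value_coord (i : 'I_3) (s t M k : R) :
  (forall x, Num.min s t <= x <= Num.max s t -> `|derive1 g x 0 i - k| <= M) ->
  `|g t 0 i - g s 0 i - (t - s) * k| <= M * `|t - s|.
Proof.
wlog st : s t / s <= t.
  move=> H bnd; case/orP: (le_total s t) => [st|ts]; first exact: H.
  have -> : g t 0 i - g s 0 i - (t - s) * k = - (g s 0 i - g t 0 i - (s - t) * k) by ring.
  by rewrite normrN (distrC t s); apply: (H t s) => // x; rewrite minC maxC; exact: bnd.
rewrite (min_idPl st) (max_idPr st).
have [->|snt] := eqVneq s t.
  by move=> _; rewrite !subrr mul0r subr0 normr0 mulr0.
have st' : s < t by rewrite lt_neqAle snt.
move=> bnd.
have [||x] := @MVT _ (fun s => g s 0 i) (fun x => derive1 g x 0 i) s t st'.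
  by move=> x _; exact: is_derive_coord.
  apply: continuous_subspaceT => x; apply: differentiable_continuous.
  by apply/derivable1_diffP; have [] := is_derive_coord i x.
rewrite in_itv/= => /andP[sx xt] ->.
have -> : derive1 g x 0 i * (t - s) - (t - s) * k = (derive1 g x 0 i - k) * (t - s) by ring.
by rewrite normrM ler_wpM2r ?normr_ge0// bnd// !ltW.
Qed.

Hypothesis cg' : continuous (derive1 g).

Lemma continuous_speed : continuous (fun t => enorm (derive1 g t)).
Proof. by move=> t; apply: continuous_comp; [exact: cg'|exact: continuous_enorm]. Qed.

(** Strict differentiability of a C1 curve. *)
Lemma strict_derivative (t eta : R) : 0 < eta -> exists2 delta : R, 0 < delta &
  forall s r : R, `|s - t| <= delta -> `|r - t| <= delta ->
    enorm (g r - g s - (r - s) *: derive1 g t) <= eta * `|r - s|.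
Proof.
move=> eta0; have eta3 : 0 < eta / 3 by rewrite divr_gt0.
have /cvgrPdist_le/(_ _ eta3) := @cg' t.
case/nbhs_ballP => e /= e0 He; exists (e / 2); first by rewrite divr_gt0.
move=> s r st rt; apply: (le_trans (enorm_le_sum _)); rewrite sum3E.
have H i : `|(g r - g s - (r - s) *: derive1 g t) 0 i| <= eta / 3 * `|r - s|.
  rewrite !mxE; apply: mean_value_coord => x /andP[sx xr].
  have : `|derive1 g t - derive1 g x| <= eta / 3.
    apply: He; rewrite -ball_normE /ball_/= distrC ltr_norml.
    move: sx xr st rt; rewrite !ler_norml minElt maxElt; case: ifPn => _; lra.
  apply: le_trans; rewrite distrC; apply: le_trans (mx_norm_coord _ i).
  by rewrite !mxE.
have := H (inord 0); have := H (inord 1); have := H (inord 2); lra.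
Qed.

End curve.

Section arc.
Context {R : realType} (g : R -> 'rV[R]_3).
Local Open Scope ereal_scope.

Lemma hausdorff_gauge1 (A : set 'rV[R]_3) : A !=set0 -> hausdorff_gauge 1 A = ediam A.
Proof.
move=> /set0P A0; rewrite /hausdorff_gauge (negbTE A0) /=.
by rewrite expr1 divff// mul1e.
Qed.

(** Cutting the parameter interval into [n] equal pieces covers the arc by sets
    of diameter at most [K * (d - c) / n]. *)
Lemma hausdorff1_arc_ub (c d K : R) : (c <= d)%R -> (0 <= K)%R ->
  (forall s t, (c <= s <= d)%R -> (c <= t <= d)%R -> (enorm (g s - g t) <= K * `|s - t|)%R) ->
  hausdorff 1 (g @` `[c, d]) <= (K * (d - c))%:E.
Proof.
move=> cd K0 lipg; apply: ge_ereal_sup => _ [delta /= delta0 <-].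
have [n ndelta] : exists n : nat, (K * (d - c) / n.+1%:R <= delta)%R.
  exists (Num.truncn (K * (d - c) / delta)); rewrite ler_pdivrMr//.
  by rewrite [leRHS]mulrC -ler_pdivrMr// ltW// truncnS_gt.
pose h := ((d - c) / n.+1%:R)%R.
have h0 : (0 <= h)%R by rewrite divr_ge0// subr_ge0.
pose F k := if (k < n.+1)%N then g @` `[(c + k%:R * h)%R, (c + k.+1%:R * h)%R] else set0.
have F_le k : ediam (F k) <= (K * h)%:E.
  apply: ge_ereal_sup => _ [[x y] [] /= + + <-]; rewrite /F; case: ifPn => // kn.
  move=> [s + <-] [t + <-]; rewrite /= !in_itv/= => /andP[s1 s2] /andP[t1 t2].
  have kh : (c + k.+1%:R * h <= d)%R.
    have -> : (d = c + n.+1%:R * h)%R.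
      by rewrite /h mulrC divfK ?pnatr_eq0//; ring.
    by rewrite lerD2l ler_wpM2r// ler_nat.
  have ck : (c <= c + k%:R * h)%R by rewrite lerDl mulr_ge0.
  rewrite lee_fin; apply: (le_trans (lipg s t _ _)).
  - by rewrite (le_trans ck s1) (le_trans s2 kh).
  - by rewrite (le_trans ck t1) (le_trans t2 kh).
  - apply: ler_wpM2l => //; rewrite ler_norml.
    by move: s1 s2 t1 t2; rewrite -natr1 mulrDl mul1r; lra.
have gauge_le k : hausdorff_gauge 1 (F k) <= (K * h)%:E.
  have [->|/set0P F0] := eqVneq (F k) set0.
    by rewrite hausdorff_gauge0 lee_fin mulr_ge0.
  by rewrite hausdorff_gauge1.
apply: (@le_trans _ _ (\sum_(k <oo) hausdorff_gauge 1 (F k))).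
  apply: ereal_inf_lbound; exists F => //; split; last first.
    by move=> k; apply: (le_trans (F_le k)); rewrite lee_fin /h mulrA.
  move=> _ [t + <-]; rewrite /= in_itv/= => /andP[ct td].
  have [k kn tk] : exists2 k, (k < n.+1)%N & (c + k%:R * h <= t <= c + k.+1%:R * h)%R.
    have step m : (t <= c + m.+1%:R * h)%R ->
        exists2 k, (k < m.+1)%N & (c + k%:R * h <= t <= c + k.+1%:R * h)%R.
      elim: m => [|m IH] tm.
        by exists 0%N => //; rewrite mul0r addr0 ct/=; exact: tm.
      have [/IH[k km tk]|/ltW mt] := leP t (c + m.+1%:R * h)%R.
        by exists k => //; rewrite ltnS ltnW.
      by exists m.+1 => //; rewrite mt tm.
    apply: step; rewrite /h mulrC divfK ?pnatr_eq0//; move: td; lra.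
  by exists k => //; rewrite /F kn; exists t => //=; rewrite in_itv.
rewrite (nneseries_split 0 n.+1); last by move=> *; exact: hausdorff_gauge_ge0.
rewrite add0n [X in _ + X]eseries0 ?adde0; last first.
  by move=> k nk _; rewrite /F ltnNge nk/= hausdorff_gauge0.
apply: (@le_trans _ _ (\sum_(0 <= k < n.+1) (K * h)%:E)).
  by apply: lee_sum => k _; exact: gauge_le.
rewrite sumEFin lee_fin sumr_const_nat subn0 -mulr_natr /h.
by rewrite -mulrA divfK// pnatr_eq0.
Qed.

(** Orthogonal projection onto the chord from [g c] to [g d] does not increase
    diameters and maps the arc onto the chord, by the intermediate value
    theorem; so a covering of the arc yields one of the chord. *)
Lemma hausdorff1_arc_lb (c d : R) : continuous g -> (c <= d)%R ->
  (enorm (g d - g c)%R)%:E <= hausdorff 1 (g @` `[c, d[).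
Proof.
move=> cg cd; set e := (g d - g c)%R; set l := enorm e.
have [->|/eqP] := eqVneq l 0%R; first exact: hausdorff_ge0.
move=> /eqP l_neq0; have l0 : (0 < l)%R by rewrite lt_def l_neq0 enorm_ge0.
pose phi x := dot x e.
have phi_lip x y : (phi x - phi y <= l * enorm (x - y)%R)%R.
  rewrite /phi -dotNl -dotDl mulrC; apply: le_trans (Cauchy_Schwarz _ _).
  exact: ler_norm.
have cphi : continuous (fun t => phi (g t)).
  move=> t; apply: (@continuous_comp _ _ _ g phi); first exact: cg.
  exact: continuous_dot.
apply: (@le_trans _ _ (hausdorff_delta 1 1 (g @` `[c, d[))); last first.
  by apply: ereal_sup_ubound; exists 1%R => /=.
apply: le_ereal_inf_tmp => _ [F [gF Fd] <-].
have bdF k x y : F k x -> F k y -> (phi x - phi y <= l * fine (ediam (F k)))%R.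
  move=> Fx Fy; apply: (le_trans (phi_lip x y)); apply: ler_wpM2l; first exact: ltW.
  rewrite -lee_fin fineK; first exact: ediam_ub.
  by rewrite ge0_fin_numE ?(le_lt_trans (Fd k)) ?ltry ?ediam_ge0//; exists x.
pose J k := if F k == set0 then set0 else `[inf (phi @` F k), sup (phi @` F k)]%classic.
have FJ k : phi @` F k `<=` J k.
  move=> _ [x Fx <-]; rewrite /J; case: ifPn => [/eqP F0|_]; first by rewrite F0 in Fx.
  rewrite /= in_itv/=; apply/andP; split.
    apply: ge_inf; last by exists x.
    exists (phi x - l * fine (ediam (F k)))%R => _ [y Fy <-].
    by have := bdF _ _ _ Fx Fy; lra.
  apply: ub_le_sup; last by exists x.
  exists (phi x + l * fine (ediam (F k)))%R => _ [y Fy <-].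
  by have := bdF _ _ _ Fy Fx; lra.
have J_le k : lebesgue_measure (J k) <= l%:E * hausdorff_gauge 1 (F k).
  rewrite /J; case: ifPn => [/eqP->|/set0P F0].
    by rewrite measure0 hausdorff_gauge0 mule0.
  rewrite hausdorff_gauge1//.
  have fF : ediam (F k) \is a fin_num.
    by rewrite ge0_fin_numE ?(le_lt_trans (Fd k)) ?ltry ?ediam_ge0.
  rewrite lebesgue_measure_itv/= -(fineK fF) -EFinM.
  have D0 : (0 <= l * fine (ediam (F k)))%R.
    by rewrite mulr_ge0 ?(ltW l0)// fine_ge0// ediam_ge0.
  case: ifPn => _; last by rewrite lee_fin.
  rewrite -EFinB lee_fin lerBlDr addrC.
  apply: ge_sup; first by case: F0 => x Fx; exists (phi x), x.
  move=> _ [x Fx <-]; rewrite -lerBlDr.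
  apply: lb_le_inf; first by case: F0 => z Fz; exists (phi z), z.
  by move=> _ [y Fy <-]; have := bdF _ _ _ Fx Fy; lra.
have phi_cover : `[phi (g c), phi (g d)[%classic `<=` \bigcup_k J k.
  move=> y /=; rewrite in_itv/= => /andP[cy yd].
  have [||t] := @IVT _ (fun t => phi (g t)) c d y cd.
  - exact: continuous_subspaceT.
  - by rewrite ge_min cy le_max (ltW yd) orbT.
  rewrite in_itv/= => /andP[ct td] ty.
  have {}td : (t < d)%R.
    by rewrite lt_neqAle td andbT; apply/eqP => tdE; move: yd; rewrite -ty tdE ltxx.
  have [|k _ Fk] := gF (g t); first by exists t => //=; rewrite in_itv/= ct td.
  by exists k => //; apply: FJ; exists (g t).
have mJ k : measurable (J k) by rewrite /J; case: ifPn.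
have : lebesgue_measure (`[phi (g c), phi (g d)[%classic : set R) <=
    \sum_(k <oo) lebesgue_measure (J k).
  by apply: measure_sigma_subadditive => //; exact: measurable_itv.
rewrite lebesgue_measure_itv/= lte_fin.
have phi_dc : (phi (g d) - phi (g c) = l * l)%R.
  by rewrite /phi -dotNl -dotDl -/e -enorm_sqr expr2.
rewrite -subr_gt0 phi_dc mulr_gt0// -EFinB phi_dc => H.
have {H} := le_trans H (lee_nneseries (fun k _ _ => measure_ge0 _ _) (fun k _ => J_le k)).
rewrite nneseriesZl; last by move=> *; exact: hausdorff_gauge_ge0.
by rewrite EFinM lee_pmul2l.
Qed.

Lemma caratheodory_arc_cc (c d : R) : continuous g ->
  (@hausdorff_outer_measure R 1).-caratheodory (g @` `[c, d]).
Proof.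
move=> cg; have [cd|dc] := leP c d; last first.
  rewrite set_itv_ge ?bnd_simp -?ltNge// image_set0.
  exact: caratheodory_measurable_set0.
apply: caratheodory_closed => x xg.
have [|t] := @EVT_min _ (fun t => enorm (x - g t)%R) c d cd.
  apply: continuous_subspaceT => t; apply: continuous_comp; last exact: continuous_enorm.
  by apply: cvgB; [exact: cvg_cst|exact: cg].
move=> tcd tmin; exists (enorm (x - g t)%R).
  by rewrite enorm_gt0 subr_eq0; apply/eqP => xt; apply: xg; exists t.
by move=> _ [s scd <-]; exact: tmin.
Qed.

Lemma caratheodory_arc_co (c d : R) : continuous g ->
  (@hausdorff_outer_measure R 1).-caratheodory (g @` `[c, d[).
Proof.
move=> cg.
rewrite (_ : g @` _ = \bigcup_n (g @` `[c, (d - n.+1%:R^-1)%R])); last first.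
  rewrite -image_bigcup; congr image.
  apply/seteqP; split => [t|t [n _]] /=; rewrite !in_itv/= => /andP[ct td].
    have [n tn] := ltr_add_invr td.
    by exists n => //=; rewrite in_itv/= ct/= ltW// ltrBrDr.
  by rewrite ct/= (le_lt_trans td)// ltrBlDr ltrDl invr_gt0.
by apply: caratheodory_measurable_bigcup => n; exact: caratheodory_arc_cc.
Qed.

End arc.

Section integral_bounds.
Context d (T : measurableType d) {R : realType} (mu : {measure set T -> \bar R}).

Lemma bounded_integrable (A : set T) (f : T -> R) (M : R) :
  measurable A -> (mu A < +oo)%E -> measurable_fun A f ->
  (forall x, A x -> `|f x| <= M) -> mu.-integrable A (EFin \o f).
Proof.
move=> mA muA mf fM; apply: measurable_bounded_integrable => //.
exists M; split; first exact: num_real.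
by move=> y My x /fM /le_trans; apply; exact: ltW.
Qed.

Lemma Rintegral_near_cst (A : set T) (f : T -> R) (k w : R) :
  measurable A -> (mu A < +oo)%E -> mu.-integrable A (EFin \o f) ->
  (forall x, A x -> `|f x - k| <= w) ->
  `|\int[mu]_(x in A) f x - k * fine (mu A)| <= w * fine (mu A).
Proof.
move=> mA muA intf fk.
have icst r : mu.-integrable A (EFin \o (fun=> r)).
  by apply: (@bounded_integrable _ _ `|r|) => //; exact: measurable_cst.
have up : \int[mu]_(x in A) f x <= (k + w) * fine (mu A).
  rewrite -(Rintegral_cst mu mA); apply: le_Rintegral => // x /fk.
  by rewrite ler_norml => /andP[_]; lra.
have lo : (k - w) * fine (mu A) <= \int[mu]_(x in A) f x.
  rewrite -(Rintegral_cst mu mA); apply: le_Rintegral => // x /fk.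
  by rewrite ler_norml => /andP[+ _]; lra.
by move: up lo; rewrite mulrDl mulrBl ler_norml => up lo; apply/andP; split; lra.
Qed.

End integral_bounds.

Section arc_integral.
Context {R : realType} (g : R -> 'rV[R]_3).
Hypothesis dg : forall t : R, derivable g t 1.
Hypothesis cg' : continuous (derive1 g).
Variables (a b : R).
Hypothesis ab : a <= b.
Hypothesis g_inj : {in `[a, b[ &, injective g}.

Let T := caratheodory_type (@hausdorff_outer_measure R 1).
Let mu : {measure set T -> \bar R} := hausdorff_measure 1.
Let arc c d : set T := g @` `[c, d[.
Let v t := enorm (derive1 g t).

Let cg : continuous g. Proof. exact: continuous_curve. Qed.

Let measurable_arc c d : measurable (arc c d).
Proof. exact: caratheodory_arc_co. Qed.

Let arc_ub c d K : c <= d -> 0 <= K ->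
  (forall s t, c <= s <= d -> c <= t <= d -> enorm (g s - g t) <= K * `|s - t|) ->
  (mu (arc c d) <= (K * (d - c))%:E)%E.
Proof.
move=> cd K0 gK; apply: le_trans (hausdorff1_arc_ub cd K0 gK).
apply: le_hausdorff => _ [t + <-]; rewrite /= in_itv/= => /andP[ct td].
by exists t => //=; rewrite in_itv/= ct ltW.
Qed.

Let arc_fin c d : a <= c -> d <= b -> (mu (arc c d) < +oo)%E.
Proof.
move=> ac db; have [cd|dc] := leP c d; last first.
  by rewrite /arc set_itv_ge ?bnd_simp -?leNgt ?image_set0 ?measure0// ltW.
have [|t _ vt] := @EVT_max _ v a b ab.
  by apply: continuous_subspaceT; exact: continuous_speed.
apply: (@le_lt_trans _ _ (3 * v t * (d - c))%:E); last by rewrite ltry.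
apply: arc_ub => //; first by rewrite mulr_ge0// enorm_ge0.
move=> s r /andP[cs sd] /andP[cr rd]; apply: (le_trans (enorm_le_sum _)).
have H i : `|(g s - g r) 0 i| <= v t * `|s - r|.
  rewrite !mxE -[X in `|X|]subr0 -[X in _ - X](mulr0 (s - r)).
  apply: mean_value_coord => // x /andP[rx xs]; rewrite subr0.
  apply: (le_trans (enorm_coord _ i)); apply: vt; rewrite in_itv/=.
  move: rx xs; rewrite minElt maxElt; case: ifPn => _ *; apply/andP; split; lra.
by rewrite sum3E; have := H (inord 0); have := H (inord 1); have := H (inord 2); lra.
Qed.

Let arcU c d e : c <= d -> d <= e -> arc c e = arc c d `|` arc d e.
Proof.
move=> cd de; rewrite /arc -image_setU; congr image.
apply/seteqP; split => t /=; rewrite !in_itv/=.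
  by move=> /andP[ct te]; have [td|dt] := ltP t d; [left|right]; rewrite ?ct ?te.
by case=> /andP[h1 h2]; [rewrite h1 (lt_le_trans h2)|rewrite h2 (le_trans cd)].
Qed.

Let arcI c d e : a <= c -> c <= d -> d <= e -> e <= b -> [disjoint arc c d & arc d e].
Proof.
move=> ac cd de eb; apply/disj_setPS => y [[s + <-] [t + ts]].
rewrite /= !in_itv/= => /andP[cs sd] /andP[dt te].
have : t = s.
  apply: g_inj => //; rewrite in_itv/=; apply/andP; split.
  - by rewrite (le_trans ac)// (le_trans cd).
  - exact: lt_le_trans eb.
  - exact: le_trans cs.
  - by rewrite (lt_le_trans sd)// (le_trans de).
by move=> tsE; move: sd; rewrite -tsE ltNge dt.
Qed.

(** The inverse of the parametrization is measurable, so any function that is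
    continuous along the arc is measurable on it. *)
Let measurable_fun_arc (f : 'rV[R]_3 -> R) : continuous (f \o g) ->
  measurable_fun (arc a b) (f : T -> R).
Proof.
move=> cf.
pose p (y : T) : R := xget a [set t | (a <= t < b) /\ g t = y].
have gp t : t \in `[a, b[ -> p (g t) = t.
  move=> tab; rewrite /p; case: xgetP => [s _ [sab gst]|/(_ t)/= []//].
  by apply: g_inj => //; rewrite in_itv.
have mp : measurable_fun (arc a b) p.
  apply: (measurability (@RGenCInfty.G R)) => [|/= _ [_] [r] -> <-].
    exact: RGenCInfty.measurableE.
  rewrite (_ : _ `&` _ = arc (Num.max a r) b) //.
  apply/seteqP; split => y /=.
    move=> [[t tab <-]]; rewrite gp// in_itv/= andbT => rt.
    exists t => //=; move: tab; rewrite /= !in_itv/= ge_max rt andbT => /andP[-> ->].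
    by [].
  case=> t; rewrite /= in_itv/= ge_max => /andP[/andP[at_ rt] tb] <-.
  have tab : t \in `[a, b[ by rewrite in_itv/= at_ tb.
  by split; [exists t|rewrite /= gp// in_itv/= rt].
apply: (@eq_measurable_fun _ _ _ _ _ ((f \o g) \o p)).
  by move=> y /set_mem[t tab <-] /=; rewrite gp.
exact: (measurable_comp measurableT (@subsetT _ _) (continuous_measurable_fun cf) mp).
Qed.

(** Lipschitz upper bound and chord lower bound meet to first order, because the
    curve is strictly differentiable. *)
Let arc_near (t eta : R) : 0 < eta -> exists2 delta : R, 0 < delta &
  forall c d, a <= c -> c <= t -> t <= d -> d <= b -> t - c <= delta -> d - t <= delta ->
    `|fine (mu (arc c d)) - v t * (d - c)| <= eta * (d - c).
Proof.
move=> eta0; have [delta delta0 H] := strict_derivative dg cg' t eta0.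
exists delta => // c d ac ct td db tc dt.
have cd := le_trans ct td.
have muf : mu (arc c d) \is a fin_num.
  by rewrite ge0_fin_numE ?measure_ge0// arc_fin.
have chord s r : c <= s <= d -> c <= r <= d ->
    `|enorm (g r - g s) - `|r - s| * v t| <= eta * `|r - s|.
  move=> /andP[cs sd] /andP[cr rd].
  apply: le_trans (H s r _ _); last 2 first.
  - by rewrite ler_norml; apply/andP; split; lra.
  - by rewrite ler_norml; apply/andP; split; lra.
  by rewrite -enormZ; exact: enorm_lip.
have up : fine (mu (arc c d)) <= (v t + eta) * (d - c).
  rewrite -lee_fin fineK//; apply: arc_ub => //.
    by rewrite addr_ge0 ?enorm_ge0// ltW.
  move=> s r scd rcd; have := chord r s rcd scd; rewrite ler_norml; lra.
have lo : (v t - eta) * (d - c) <= fine (mu (arc c d)).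
  have := hausdorff1_arc_lb cg cd; rewrite -[leRHS]/(mu (arc c d)) -(fineK muf) lee_fin.
  apply: le_trans.
  have := chord c d; rewrite !lexx cd => /(_ isT isT).
  rewrite (@ger0_norm _ (d - c)) ?subr_ge0// ler_norml; lra.
by rewrite ler_norml; apply/andP; split; lra.
Qed.

(** The area formula for a simple arc. Both sides are additive over
    consecutive subarcs, and they agree to first order on short ones. *)
Lemma arc_integralE (f : 'rV[R]_3 -> R) : continuous (f \o g) ->
  area_integral 1 (g @` `[a, b[) f =
  \int[lebesgue_measure]_(t in `[a, b[) (f (g t) * enorm (derive1 g t)).
Proof.
move=> cf.
have cfv : continuous (fun t => f (g t) * v t).
  by move=> t; apply: (cvgM (cf t)); exact: continuous_speed.
have [M fM] : exists M, forall t, t \in `[a, b] -> `|f (g t)| <= M.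
  have [|t _ ft] := @EVT_max _ (fun t => `|f (g t)|) a b ab.
    by apply: continuous_subspaceT => t; apply: cvg_norm; exact: cf.
  by exists `|f (g t)|.
have [M' fvM] : exists M, forall t, t \in `[a, b] -> `|f (g t) * v t| <= M.
  have [|t _ ft] := @EVT_max _ (fun t => `|f (g t) * v t|) a b ab.
    by apply: continuous_subspaceT => t; apply: cvg_norm; exact: cfv.
  by exists `|f (g t) * v t|.
have sub c d t : a <= c -> d <= b -> t \in `[c, d[ -> t \in `[a, b].
  rewrite !in_itv/= => ac db /andP[ct td].
  by rewrite (le_trans ac)// (le_trans (ltW td)).
have int1 c d : a <= c -> d <= b -> mu.-integrable (arc c d) (EFin \o (f : T -> R)).
  move=> ac db; apply: (@bounded_integrable _ _ _ _ _ _ M) => //; first exact: arc_fin.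
    apply: measurable_funS (measurable_fun_arc cf) => //.
    move=> _ [t tcd <-]; exists t => //; move: tcd; rewrite /= !in_itv/= => /andP[ct td].
    by rewrite (le_trans ac)// (lt_le_trans td).
  by move=> _ [t tcd <-]; apply: fM; exact: sub tcd.
have int2 c d : a <= c -> d <= b ->
    lebesgue_measure.-integrable `[c, d[ (EFin \o (fun t : R => f (g t) * v t)).
  move=> ac db; apply: (@bounded_integrable _ _ _ _ _ _ M') => //.
  - by rewrite /= lebesgue_measure_itv/=; case: ifP => _; rewrite ltry.
  - by apply: measurable_funTS; exact: continuous_measurable_fun.
  - by move=> t tcd; apply: fvM; exact: sub tcd.
pose D c d := \int[mu]_(y in arc c d) f y -
  \int[lebesgue_measure]_(t in `[c, d[) (f (g t) * v t).
suff : D a b = 0 by move/eqP; rewrite subr_eq0 => /eqP.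
apply: additive_small => //.
  move=> c d e ac cd de eb.
  have itvU : `[c, e[%classic = `[c, d[%classic `|` `[d, e[%classic :> set R.
    apply/seteqP; split => t /=; rewrite !in_itv/=.
      by move=> /andP[ct te]; have [td|dt] := ltP t d; [left|right]; rewrite ?ct ?te.
    by case=> /andP[h1 h2]; [rewrite h1 (lt_le_trans h2)|rewrite h2 (le_trans cd)].
  have itvI : [disjoint `[c, d[%classic & `[d, e[%classic : set R].
    apply/disj_setPS => t [] /=; rewrite !in_itv/= => /andP[_ td] /andP[dt _].
    by move: td; rewrite ltNge dt.
  have eb' := le_trans de eb; have ad := le_trans ac cd.
  rewrite /D (arcU cd de) Rintegral_setU//; last 2 first.
  - by rewrite -arcU// int1.
  - exact: arcI.
  rewrite itvU Rintegral_setU//; last by rewrite -itvU; exact: int2.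
  by ring.
move=> t eta /andP[at_ tb] eta0.
pose C := `|f (g t)| + v t + 2.
have v0 : 0 <= v t by exact: enorm_ge0.
have C0 : 0 < C by rewrite /C; have := normr_ge0 (f (g t)); lra.
pose w := Num.min 1 (eta / C).
have w0 : 0 < w by rewrite lt_min ltr01 divr_gt0.
have w1 : w <= 1 by rewrite ge_min lexx.
have wC : w * C <= eta by rewrite -ler_pdivlMr// ge_min lexx orbT.
have [d1 d10 arcw] := arc_near t w0.
have /cvgrPdist_le/(_ _ w0)/nbhs_ballP[d2 /= d20 fw] := cf t.
have /cvgrPdist_le/(_ _ w0)/nbhs_ballP[d3 /= d30 fvw] := cfv t.
exists (Num.min d1 (Num.min (d2 / 2) (d3 / 2))).
  by rewrite !lt_min d10 !divr_gt0.
move=> c d ac ct td db; rewrite !le_min => /andP[tc1 /andP[tc2 tc3]] /andP[dt1 /andP[dt2 dt3]].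
have cd := le_trans ct td.
have := arcw c d ac ct td db tc1 dt1.
set m := fine (mu (arc c d)) => mE.
have fI : `|\int[mu]_(y in arc c d) f y - f (g t) * m| <= w * m.
  apply: Rintegral_near_cst => //; [exact: arc_fin|exact: int1|].
  move=> _ [s + <-]; rewrite /= in_itv/= => /andP[cs sd].
  rewrite distrC; apply: fw; rewrite -ball_normE/= ltr_norml.
  by apply/andP; split; lra.
have fvI : `|\int[lebesgue_measure]_(t in `[c, d[) (f (g t) * v t)
     - f (g t) * v t * (d - c)| <= w * (d - c).
  have -> : d - c = fine (lebesgue_measure (`[c, d[%classic : set R)).
    rewrite lebesgue_measure_itv/= lte_fin; case: ltP => //= dc; lra.
  apply: Rintegral_near_cst => //; last 2 first.
  - exact: int2.
  - move=> s; rewrite /= in_itv/= => /andP[cs sd].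
    rewrite distrC; apply: fvw; rewrite -ball_normE/= ltr_norml.
    by apply/andP; split; lra.
  by rewrite /= lebesgue_measure_itv/=; case: ifP => _; rewrite ltry.
have wfm : `|f (g t) * m - f (g t) * v t * (d - c)| <= `|f (g t)| * (w * (d - c)).
  by rewrite -mulrA -mulrBr normrM ler_wpM2l.
have dc0 : 0 <= d - c by rewrite subr_ge0.
have m_le : m <= (v t + 1) * (d - c).
  move: mE; rewrite ler_norml => /andP[_].
  have : w * (d - c) <= 1 * (d - c) by exact: ler_wpM2r.
  by lra.
have wm : w * m <= w * ((v t + 1) * (d - c)) by rewrite ler_pM2l.
have wCdc : w * C * (d - c) <= eta * (d - c) by exact: ler_wpM2r.
rewrite /D; apply: (le_trans _ wCdc).
move: fI fvI wfm; rewrite /C.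
set I1 := \int[mu]_(y in _) _; set I2 := \int[lebesgue_measure]_(y in _) _.
set F := f (g t); rewrite !ler_norml => /andP[? ?] /andP[? ?] /andP[? ?].
by apply/andP; split; nra.
Qed.

Lemma hausdorff_arcE :
  hausdorff 1 (g @` `[a, b[) =
  (\int[lebesgue_measure]_(t in `[a, b[) enorm (derive1 g t))%:E.
Proof.
have := @arc_integralE (fun=> 1) (fun _ => cvg_cst _).
rewrite /area_integral (Rintegral_cst mu)//; last exact: measurable_arc.
rewrite mul1r => h; rewrite -[LHS]fineK; last first.
  by rewrite ge0_fin_numE ?hausdorff_ge0//; exact: arc_fin.
congr EFin; rewrite [LHS]h; apply: eq_Rintegral => t _; exact: mul1r.
Qed.

End arc_integral.

(** * Regular loops *)

Section periodic.
Context {R : realType}.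

Lemma periodic_int (T : Type) (f : R -> T) (k : int) (t : R) :
  (forall t, f (t + 1) = f t) -> f (t + k%:~R) = f t.
Proof.
move=> per; have pern (n : nat) s : f (s + n%:R) = f s.
  elim: n => [|n IH]; first by rewrite addr0.
  by rewrite -natr1 addrA per IH.
case: (intP k) => [|n|n]; first by rewrite mulr0z addr0.
  exact: pern.
by rewrite mulrNz -[in RHS](subrK n.+1%:R t) pern.
Qed.

Lemma periodic_fundamental (t : R) : exists k : int, 0 <= t - k%:~R < 1.
Proof.
exists (Num.floor t); have /andP[] := floor_itv t; rewrite intrD mulr1z => h1 h2.
by apply/andP; split; lra.
Qed.

Lemma periodic_min (f : R -> R) : continuous f -> (forall t, f (t + 1) = f t) ->
  exists t0, forall t, f t0 <= f t.
Proof.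
move=> cf per; have [|t0 _ ft0] := @EVT_min _ f 0 1 ler01.
  exact: continuous_subspaceT.
exists t0 => t; have [k /andP[k0 k1]] := periodic_fundamental t.
rewrite -(subrK k%:~R t) periodic_int//; apply: ft0.
by rewrite in_itv/= k0 ltW.
Qed.

Lemma periodic_bounded (f : R -> R) : continuous f -> (forall t, f (t + 1) = f t) ->
  exists2 M, 0 <= M & forall t, `|f t| <= M.
Proof.
move=> cf per; have [||t0 ft0] := @periodic_min (fun t => - `|f t|).
- by move=> t; exact: (cvgN (cvg_norm (cf t))).
- by move=> t; rewrite per.
- by exists `|f t0| => // t; rewrite -lerN2.
Qed.

Lemma derive1_periodic (g : R -> 'rV[R]_3) : (forall t, g (t + 1) = g t) ->
  forall t, derive1 g (t + 1) = derive1 g t.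
Proof.
move=> per t; rewrite /derive1; set F := fun h : R => _; set G := fun h : R => _.
by have -> : F = G by apply/funext => h; rewrite /F /G addrA !per.
Qed.

End periodic.

Section loop.
Context {R : realType} (g : R -> 'rV[R]_3).

Definition regular_loop : Prop := C2_curve g /\ embedded_closed_curve g.

Hypothesis H : regular_loop.

Lemma loop_derivable (t : R) : derivable g t 1.
Proof. by case: H => -[+ _ _] _; apply. Qed.

Lemma loop_derivable' (t : R) : derivable (derive1 g) t 1.
Proof. by case: H => -[_ + _] _; apply. Qed.

Lemma loop_continuous'' : continuous (derive1 (derive1 g)).
Proof. by case: H => -[]. Qed.

Lemma loop_periodic t : g (t + 1) = g t.
Proof. by case: H => _ [+ _ _]; apply. Qed.

Lemma loop_injective : {in `[0, 1[ &, injective g}.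
Proof. by case: H => _ []. Qed.

Lemma loop_regular t : derive1 g t != 0.
Proof. by case: H => _ [_ _]; apply. Qed.

Lemma loop_continuous : continuous g.
Proof. exact: (continuous_curve loop_derivable). Qed.

Lemma loop_continuous' : continuous (derive1 g).
Proof. exact: (continuous_curve loop_derivable'). Qed.

End loop.

Section geometry.
Context {R : realType} (g : R -> 'rV[R]_3).
Hypothesis H : regular_loop g.

Lemma range_fundamental (a : R) : range g = g @` `[a, (a + 1)[.
Proof.
apply/seteqP; split => [_ [t _ <-]|_ [t _ <-]]; last by exists t.
have [k /andP[k0 k1]] := periodic_fundamental (t - a).
exists (t - k%:~R).
  by rewrite /= in_itv/=; apply/andP; split; lra.
by rewrite -(periodic_int k (t - k%:~R) (loop_periodic H)) subrK.
Qed.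

Lemma injective_mod1 (s t : R) : g s = g t -> exists k : int, s = t + k%:~R.
Proof.
have [k ks] := periodic_fundamental s; have [l lt] := periodic_fundamental t.
move=> gst; exists (k - l); have st : s - k%:~R = t - l%:~R.
  apply: (loop_injective H); rewrite ?in_itv//=.
  by rewrite -(periodic_int k (s - _) (loop_periodic H)) -(periodic_int l (t - _) (loop_periodic H)) !subrK.
by rewrite intrB; lra.
Qed.

Lemma injective_fundamental (a : R) : {in `[a, (a + 1)[ &, injective g}.
Proof.
move=> s t; rewrite !in_itv/= => /andP[s1 s2] /andP[t1 t2] /injective_mod1[k sE].
suff k0 : k = 0 by rewrite sE k0 addr0.
have : k%:~R < 1 :> R by lra.
have : -1 < k%:~R :> R by lra.
rewrite -(mulrN1z 1) ltr_int -(mulr1z (1 : R)) ltr_int; lia.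
Qed.

Lemma speed_bounds : exists m M : R,
  [/\ 0 < m, m <= M & forall t, m <= enorm (derive1 g t) <= M].
Proof.
have cv := continuous_speed (loop_continuous' H).
have perv t : enorm (derive1 g (t + 1)) = enorm (derive1 g t).
  by rewrite (derive1_periodic (loop_periodic H)).
have [t0 vt0] := periodic_min cv perv.
have [M M0 vM] := periodic_bounded cv perv.
have le_vM t : enorm (derive1 g t) <= M.
  by apply: le_trans (vM t); exact: ler_norm.
exists (enorm (derive1 g t0)), M; split => //; first by rewrite enorm_gt0 (loop_regular H).
by move=> t; apply/andP; split; [exact: vt0|exact: le_vM].
Qed.

(** The second derivative is continuous and periodic, hence bounded; the mean
    value theorem is applied coordinate by coordinate. *)
Lemma curve_taylor : exists2 K : R, 0 < K & forall t s,
  enorm (derive1 g (t + s) - derive1 g t) <= K * `|s| /\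
  enorm (g (t + s) - g t - s *: derive1 g t) <= K * s ^+ 2.
Proof.
have [M M0 gM] : exists2 M : R, 0 <= M & forall i t, `|derive1 (derive1 g) t 0 i| <= M.
  have [||M M0 hM] := @periodic_bounded _ (fun t => enorm (derive1 (derive1 g) t)).
  - by move=> t; apply: continuous_comp; [exact: (loop_continuous'' H)|exact: continuous_enorm].
  - by move=> t; rewrite (derive1_periodic (derive1_periodic (loop_periodic H))).
  - exists M => // i t; apply: (le_trans (enorm_coord _ _)).
    by apply: le_trans (hM t); exact: ler_norm.
have H1 i t s : `|derive1 g (t + s) 0 i - derive1 g t 0 i| <= M * `|s|.
  have := @mean_value_coord _ _ (loop_derivable' H) i t (t + s) M 0.
  rewrite mulr0 subr0 (addrC t) addrK; apply => x _; by rewrite subr0.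
have H2 i t s : `|g (t + s) 0 i - g t 0 i - s * derive1 g t 0 i| <= M * s ^+ 2.
  have := @mean_value_coord _ _ (loop_derivable H) i t (t + s) (M * `|s|) (derive1 g t 0 i).
  rewrite (addrC t) addrK -mulrA -normrM -expr2 ger0_norm ?sqr_ge0//; apply => x.
  move=> /andP[x1 x2]; have := H1 i t (x - t); rewrite (addrC t) subrK => /le_trans; apply.
  apply: ler_wpM2l => //.
  move: x1 x2; rewrite minElt maxElt; case: ltP => st x1 x2.
    by rewrite !ger0_norm; lra.
  by rewrite !ler0_norm; lra.
exists (3 * M + 1); first by lra.
move=> t s; split; apply: (le_trans (enorm_le_sum _)); rewrite sum3E !mxE.
  have := H1 (inord 0) t s; have := H1 (inord 1) t s; have := H1 (inord 2) t s.
  by have := normr_ge0 s; lra.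
have := H2 (inord 0) t s; have := H2 (inord 1) t s; have := H2 (inord 2) t s.
by have := sqr_ge0 s; lra.
Qed.

Lemma curve_lip : exists2 M : R, 0 < M & forall s t, enorm (g t - g s) <= M * `|t - s|.
Proof.
have [m [M [m0 mM vM]]] := speed_bounds.
exists (3 * M); first by lra.
move=> s t; apply: (le_trans (enorm_le_sum _)); rewrite sum3E !mxE.
have Hi i : `|g t 0 i - g s 0 i| <= M * `|t - s|.
  have := @mean_value_coord _ _ (loop_derivable H) i s t M 0.
  rewrite mulr0 subr0; apply => x _; rewrite subr0; apply: (le_trans (enorm_coord _ _)).
  by have /andP[] := vM x.
have := Hi (inord 0); have := Hi (inord 1); have := Hi (inord 2); lra.
Qed.

(** Chord-arc inequality: from regularity for nearby points, from injectivity
    and compactness for the others. *)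
Lemma chord_arc : exists2 c : R, 0 < c & forall t s, `|s| <= 1 / 2 ->
  c * `|s| <= enorm (g (t + s) - g t).
Proof.
have [m [vM [m0 _ vm]]] := speed_bounds.
have [K K0 tayl] := curve_taylor.
have [M M0 lipM] := curve_lip.
(* Up to [d0], the remainder [K * s ^ 2] is at most half of the linear term. *)
pose d0 := Num.min (1 / 2) (m / (2 * K)).
have d00 : 0 < d0 by rewrite lt_min divr_gt0//= divr_gt0// mulr_gt0.
have near_ t s : `|s| <= d0 -> m / 2 * `|s| <= enorm (g (t + s) - g t).
  move=> sd0; have [_ Ht] := tayl t s.
  have H2 : `|s| * m <= enorm (s *: derive1 g t).
    by rewrite enormZ ler_wpM2l//; have /andP[] := vm t.
  have H3 := enormD3 (s *: derive1 g t) (g (t + s) - g t) 0.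
  rewrite !subr0 (enormB (s *: _)) in H3.
  have : K * s ^+ 2 <= m / 2 * `|s|.
    rewrite -real_normK ?num_real// expr2 mulrA; apply: ler_wpM2r => //.
    have : `|s| <= m / (2 * K) by apply: (le_trans sd0); rewrite ge_min lexx orbT.
    by rewrite ler_pdivlMr ?mulr_gt0//; lra.
  by lra.
have min_s s : {t | forall r, enorm (g (t + s) - g t) <= enorm (g (r + s) - g r)}.
  apply/cid; apply: (@periodic_min _ (fun t => enorm (g (t + s) - g t))).
    move=> t; apply: continuous_comp; last exact: continuous_enorm.
    apply: cvgB; last exact: (loop_continuous H).
    apply: (@continuous_comp _ _ _ (fun t => t + s) g); last exact: (loop_continuous H).
    by apply: cvgD; [exact: cvg_id|exact: cvg_cst].
  by move=> t; rewrite addrAC !(loop_periodic H).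
(* The shortest chord whose ends differ by [s] in the parameter. *)
pose psi s := enorm (g (projT1 (min_s s) + s) - g (projT1 (min_s s))).
have psi_le s r : psi s <= enorm (g (r + s) - g r).
  by rewrite /psi; case: (min_s s).
have psi_lip s r : psi r <= psi s + M * `|s - r|.
  rewrite {2}/psi; case: (min_s s) => t _ /=.
  apply: (le_trans (psi_le r t)).
  have := enormD3 (g (t + r)) (g (t + s)) (g t); have := lipM (t + s) (t + r).
  have -> : t + r - (t + s) = r - s by ring.
  by rewrite (distrC r); lra.
have psi_gt0 s : s \in `[d0, 1 / 2] -> 0 < psi s.
  move=> sd; rewrite /psi; case: (min_s s) => t _ /=; rewrite enorm_gt0 subr_eq0.
  apply/eqP => /injective_mod1[k] /addrI kE.
  move: sd; rewrite in_itv/= kE => /andP[k0 k1].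
  have : 0 < k%:~R :> R by exact: lt_le_trans k0.
  have : k%:~R < 1 :> R by lra.
  rewrite ltr0z -(mulr1z (1 : R)) ltr_int; lia.
clearbody psi.
have cpsi : continuous psi.
  move=> s; apply/cvgrPdist_lt => e e0.
  have eM : 0 < e / M by rewrite divr_gt0.
  apply/nbhs_ballP; exists (e / M); first exact: eM.
  move=> r /= sr; have {}sr : `|s - r| < e / M by exact: sr.
  move: sr; rewrite ltr_pdivlMr// => sr.
  have := psi_lip s r; have := psi_lip r s; rewrite (distrC r s) ltr_norml => h1 h2.
  by apply/andP; split; lra.
have d02 : d0 <= 1 / 2 by rewrite ge_min lexx.
have [|s1 s1d psi_min] := @EVT_min _ psi d0 (1 / 2) d02.
  exact: continuous_subspaceT.
have psi1 := psi_gt0 s1 s1d.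
exists (Num.min (m / 2) (psi s1)); first by rewrite lt_min psi1 divr_gt0.
move=> t s s2; have [sd0|d0s] := leP `|s| d0.
  by apply: le_trans (near_ t s sd0); rewrite ler_wpM2r// ge_min lexx.
apply: (@le_trans _ _ (psi s1)).
  apply: (@le_trans _ _ (psi s1 * 1)); last by rewrite mulr1.
  apply: ler_pM => //; first by rewrite le_min ltW ?divr_gt0// ltW.
    by rewrite ge_min lexx orbT.
  by lra.
have sI : `|s| \in `[d0, 1 / 2] by rewrite in_itv/= s2 ltW.
apply: (le_trans (psi_min _ sI)).
have [s0|s0] := leP 0 s; first by rewrite ger0_norm.
rewrite ltr0_norm// enormB -[X in g X - _](subrK s t).
by have := psi_le (- s) (t + s); rewrite addrK subrK.
Qed.

Lemma edist_range (x : 'rV[R]_3) (t0 : R) :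
  (forall t, enorm (x - g t0) <= enorm (x - g t)) ->
  edist_set x (range g) = enorm (x - g t0).
Proof.
move=> t0min; apply/le_anti/andP; split.
  apply: ge_inf; last by exists (g t0) => //; exists t0.
  by exists 0 => _ [y _ <-]; exact: enorm_ge0.
apply: lb_le_inf; first by exists (enorm (x - g t0)), (g t0) => //; exists t0.
by move=> _ [_ [t _ <-] <-].
Qed.

(** Compactness gives a nearest point. If [x - g t0] had a tangential component
    [p], moving the parameter slightly in the direction of the sign of [p] would
    decrease the distance. *)
Lemma nearest_point (x : 'rV[R]_3) : exists t0,
  [/\ forall t, enorm (x - g t0) <= enorm (x - g t),
      edist_set x (range g) = enorm (x - g t0) &
      dot (x - g t0) (derive1 g t0) = 0].
Proof.
have [||t0 t0min] := @periodic_min _ (fun t => enorm (x - g t)).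
- move=> t; apply: continuous_comp; last exact: continuous_enorm.
  by apply: cvgB; [exact: cvg_cst|exact: (loop_continuous H)].
- by move=> t; rewrite (loop_periodic H).
exists t0; split => //; first exact: edist_range.
have [K K0 tayl] := curve_taylor; have [m [M [m0 mM vM]]] := speed_bounds.
set n := x - g t0; set p := dot n _.
have key s : `|s| <= 1 -> 2 * s * p <= (M ^+ 2 + 2 * enorm n * K + 2 * M * K + K ^+ 2) * s ^+ 2.
  move=> s1.
  have [_] := tayl t0 s; set e := _ - _ => eK.
  have xE : x - g (t0 + s) = n - s *: derive1 g t0 - e.
    by rewrite /n /e; apply/rowP => i; rewrite !mxE; ring.
  have Hmin : enorm n ^+ 2 <= enorm (n - s *: derive1 g t0 - e) ^+ 2.
    by rewrite ler_pXn2r// ?nnegrE ?enorm_ge0// -xE; exact: t0min.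
  rewrite !enorm_sqr in Hmin.
  have {Hmin} : 2 * s * p <= s ^+ 2 * dot (derive1 g t0) (derive1 g t0)
      + dot e e - 2 * dot n e + 2 * s * dot (derive1 g t0) e.
    by move: Hmin; rewrite dot_sub3 -/p; lra.
  have /andP[_ vM0] := vM t0.
  have n0 := enorm_ge0 n; have e0 := enorm_ge0 e; have s20 := sqr_ge0 s.
  have B1 : s ^+ 2 * dot (derive1 g t0) (derive1 g t0) <= s ^+ 2 * M ^+ 2.
    by rewrite -enorm_sqr ler_wpM2l// ler_pXn2r// nnegrE ?enorm_ge0//; lra.
  have B2 : dot e e <= K ^+ 2 * s ^+ 2.
    rewrite -enorm_sqr; apply: (@le_trans _ _ ((K * s ^+ 2) ^+ 2)).
      by rewrite ler_pXn2r ?nnegrE ?enorm_ge0// mulr_ge0// ltW.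
    have s21 : s ^+ 2 <= 1 by rewrite -real_normK ?num_real// exprn_ile1.
    by rewrite exprMn ler_wpM2l ?sqr_ge0// [X in X <= _]expr2 ler_piMl.
  have B3 : - dot n e <= enorm n * (K * s ^+ 2).
    apply: (@le_trans _ _ (enorm n * enorm e)); last exact: ler_wpM2l.
    by rewrite -dotNl -(enormN n); apply: le_trans (ler_norm _) (Cauchy_Schwarz _ _).
  have B4 : s * dot (derive1 g t0) e <= M * (K * s ^+ 2).
    apply: (@le_trans _ _ (`|s * dot (derive1 g t0) e|)); first exact: ler_norm.
    rewrite normrM; apply: (@le_trans _ _ (1 * (M * (K * s ^+ 2)))); last by rewrite mul1r.
    apply: ler_pM => //; apply: (le_trans (Cauchy_Schwarz _ _)).
    by apply: ler_pM => //; exact: enorm_ge0.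
  by lra.
pose C := M ^+ 2 + 2 * enorm n * K + 2 * M * K + K ^+ 2.
have {}key s : `|s| <= 1 -> 2 * s * p <= C * s ^+ 2 by exact: key.
have C0 : 0 < C.
  have n0 := enorm_ge0 n; have n1 : 0 <= 2 * enorm n * K by rewrite !mulr_ge0// ltW.
  have MK : 0 < M * K by rewrite mulr_gt0//; lra.
  by have := sqr_ge0 M; have := sqr_ge0 K; rewrite /C; lra.
apply: normr0_eq0; apply/le_anti; rewrite normr_ge0 andbT leNgt; apply/negP => p0.
pose h := Num.min 1 (`|p| / C).
have h0 : 0 < h by rewrite lt_min ltr01 divr_gt0.
have h1 : `|h| <= 1 by rewrite gtr0_norm// ge_min lexx.
have hC : C * h <= `|p|.
  by rewrite mulrC -ler_pdivlMr// ge_min lexx orbT.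
have k1 := key h h1; have k2 := key (- h); rewrite normrN sqrrN in k2.
have {}k2 := k2 h1.
have : h * (2 * `|p|) <= h * (C * h).
  have [pp|pp] := leP 0 p; [rewrite ger0_norm//|rewrite ltr0_norm//]; lra.
by rewrite ler_pM2l//; lra.
Qed.

End geometry.

(** * Integrals of continuous functions on intervals *)

Section continuity.
Context {R : realType} {T : topologicalType}.
Implicit Types f h : T -> R.

Lemma continuousX f n : continuous f -> continuous (fun x => f x ^+ n).
Proof.
move=> cf x; apply: (@continuous_comp _ _ _ f (fun y : R => y ^+ n)); first exact: cf.
exact: exprn_continuous.
Qed.

Lemma continuous_sqrt f : continuous f -> continuous (fun x => Num.sqrt (f x)).
Proof.
move=> cf x; apply: (@continuous_comp _ _ _ f (@Num.sqrt R)); first exact: cf.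
exact: sqrt_continuous.
Qed.

Lemma continuous_inv f : (forall x, f x != 0) -> continuous f ->
  continuous (fun x => (f x)^-1).
Proof. by move=> f0 cf x; apply: cvgV => //; exact: cf. Qed.

Lemma continuousB f h : continuous f -> continuous h -> continuous (fun x => f x - h x).
Proof. by move=> cf ch x; exact: (cvgB (cf x) (ch x)). Qed.

Lemma continuousD f h : continuous f -> continuous h -> continuous (fun x => f x + h x).
Proof. by move=> cf ch x; exact: (cvgD (cf x) (ch x)). Qed.

Lemma continuousM f h : continuous f -> continuous h -> continuous (fun x => f x * h x).
Proof. by move=> cf ch x; exact: (cvgM (cf x) (ch x)). Qed.

Lemma continuous_const (k : R) : continuous (fun _ : T => k).
Proof. by move=> x; exact: cvg_cst. Qed.

End continuity.

Section Rintegral_continuous.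
Context {R : realType}.
Implicit Types (F G f : R -> R) (a b : R).
Local Notation leb := (@lebesgue_measure R).

Lemma continuous_integrable_cc F a b : continuous F -> leb.-integrable `[a, b] (EFin \o F).
Proof.
move=> cF; apply: continuous_compact_integrable; first exact: segment_compact.
exact: continuous_subspaceT.
Qed.

Lemma continuous_integrable F a b : continuous F -> leb.-integrable `[a, b[ (EFin \o F).
Proof.
move=> cF; apply: integrableS (continuous_integrable_cc a b cF) => //.
exact: subset_itv_co_cc.
Qed.

Lemma le_Rintegral_co F G a b : continuous F -> continuous G ->
  (forall t, a <= t < b -> F t <= G t) ->
  \int[leb]_(t in `[a, b[) F t <= \int[leb]_(t in `[a, b[) G t.
Proof.
move=> cF cG FG; apply: le_Rintegral => //; try exact: continuous_integrable.
Qed.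

Lemma normB_Rintegral_co F G B a b : continuous F -> continuous G -> continuous B ->
  (forall t, a <= t < b -> `|F t - G t| <= B t) ->
  `|\int[leb]_(t in `[a, b[) F t - \int[leb]_(t in `[a, b[) G t|
     <= \int[leb]_(t in `[a, b[) B t.
Proof.
move=> cF cG cB FG; rewrite -RintegralB//; try exact: continuous_integrable.
have cFG : continuous (fun t => F t - G t) by move=> t; exact: (cvgB (cF t) (cG t)).
apply: le_trans (le_normr_Rintegral _ _) _ => //; first exact: continuous_integrable.
apply: le_Rintegral_co => //.
by move=> t; exact: (cvg_norm (cFG t)).
Qed.

Lemma Rintegral_FTC F f a b : a < b -> continuous f ->
  (forall x, a <= x <= b -> is_derive x 1 F (f x)) ->
  \int[leb]_(t in `[a, b[) f t = F b - F a.
Proof.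
move=> ab cf dF.
rewrite Rintegral_itv_bndo_bndc; last exact: continuous_integrable.
rewrite /Rintegral (@continuous_FTC2 _ f F a b)//.
- exact: continuous_subspaceT.
- have cF x : a <= x <= b -> continuous_at x F.
    move=> xab; apply: differentiable_continuous; apply/derivable1_diffP.
    by have [] := dF x xab.
  split.
  + move=> x; rewrite in_itv/= => /andP[ax xb].
    by have [|] := dF x; rewrite ?(ltW ax) ?(ltW xb).
  + by apply: cvg_at_right_filter; apply: cF; rewrite lexx ltW.
  + by apply: cvg_at_left_filter; apply: cF; rewrite lexx ltW.
- move=> x; rewrite in_itv/= => /andP[ax xb].
  have xab : a <= x <= b by rewrite !ltW.
  by rewrite derive1E; have := dF x xab => dFx; rewrite derive_val.
Qed.

Lemma fine_lebesgue_co a b : a <= b -> fine (lebesgue_measure (`[a, b[%classic : set R)) = b - a.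
Proof.
by move=> ab; rewrite lebesgue_measure_itv/= lte_fin; case: ltP => //= ba; lra.
Qed.

Lemma Rintegral_co_cst (k : R) a b : a <= b -> \int[leb]_(t in `[a, b[) k = k * (b - a).
Proof.
by move=> ab; rewrite Rintegral_cst//; congr (_ * _); exact: fine_lebesgue_co.
Qed.

End Rintegral_continuous.

(** * Wallis integrals *)

Section power_cos.
Context {R : realType}.
Local Notation leb := (@lebesgue_measure R).

Definition cosint k : R := \int[leb]_(t in `[- (pi / 2), pi / 2[) cos t ^+ k.

Let pi2 : - (pi / 2) < pi / 2 :> R.
Proof. by have := pi_gt0 R; lra. Qed.

Let ccos k : continuous (fun t : R => cos t ^+ k).
Proof.
move=> t; apply: (@continuous_comp _ _ _ (@cos R) (fun x : R => x ^+ k)).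
  exact: continuous_cos.
exact: exprn_continuous.
Qed.

Lemma cosint2 : cosint 2 = pi / 2.
Proof.
have dF (x : R) : is_derive x 1 (fun t : R => (t + sin t * cos t) * 2^-1) (cos x ^+ 2).
  apply: is_derive_eq; rewrite /GRing.scale/=.
  by have := cos2Dsin2 x; lra.
rewrite /cosint (Rintegral_FTC pi2 (@ccos 2) (fun x _ => dF x)).
by rewrite sinN cosN sin_pihalf cos_pihalf; lra.
Qed.

Lemma cosint3 : cosint 3 = 4 / 3.
Proof.
have dF (x : R) : is_derive x 1 (fun t : R => sin t - sin t ^+ 3 * 3^-1) (cos x ^+ 3).
  apply: is_derive_eq; rewrite /GRing.scale/=.
  rewrite -[cos x ^+ 3]/(cos x * cos x ^+ 2) cos2sin2; by field.
rewrite /cosint (Rintegral_FTC pi2 (@ccos 3) (fun x _ => dF x)).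
by rewrite sinN sin_pihalf; lra.
Qed.

Lemma cosint4 : cosint 4 = 3 * pi / 8.
Proof.
have dF (x : R) : is_derive x 1 (fun t : R => 3 / 8 * t + 3 / 8 * (sin t * cos t)
   + 1 / 4 * (sin t * cos t ^+ 3)) (cos x ^+ 4).
  apply: is_derive_eq; rewrite /GRing.scale/=.
  set c := cos x; set q := sin x.
  have e1 : q ^+ 2 = 1 - c ^+ 2 by rewrite /q /c cos2sin2; ring.
  have e2 : q ^+ 2 * c ^+ 2 = (1 - c ^+ 2) * c ^+ 2 by rewrite e1.
  by lra.
rewrite /cosint (Rintegral_FTC pi2 (@ccos 4) (fun x _ => dF x)).
by rewrite sinN cosN sin_pihalf cos_pihalf; lra.
Qed.

(** By the substitution [s = a + sqrt A * sin t]; with [A <= 0] both sides vanish. *)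
Lemma integral_sqrt_power (A a : R) (k : nat) :
  (\int[leb]_s (Num.sqrt (A - (s - a) ^+ 2) ^+ k.+1)%:E =
   (Num.sqrt A ^+ k.+2 * cosint k.+2)%:E)%E.
Proof.
have [A0|A0] := leP A 0.
  rewrite ler0_sqrtr// expr0n mul0r integral0_eq// => s _.
  by rewrite ler0_sqrtr ?expr0n//; have := sqr_ge0 (s - a); lra.
set rho := Num.sqrt A; have rho0 : 0 < rho by rewrite sqrtr_gt0.
have rho2 : rho ^+ 2 = A by rewrite sqr_sqrtr// ltW.
pose G s := Num.sqrt (A - (s - a) ^+ 2) ^+ k.+1.
have cG : continuous G.
  apply: continuousX; apply: continuous_sqrt; apply: continuousB.
    exact: continuous_const.
  by apply: continuousX; apply: continuousB; [move=> s; exact: cvg_id|exact: continuous_const].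
pose F (t : R) := a + rho * sin t.
have dF (t : R) : is_derive t 1 F (rho * cos t).
  by apply: is_derive_eq; rewrite /GRing.scale/=; ring.
have F'E : derive1 F = fun t => rho * cos t.
  by apply/funext => t; rewrite derive1E; have := dF t => dFt; rewrite derive_val.
have cF' : continuous (fun t => rho * cos t).
  by apply: continuousM; [exact: continuous_const|exact: continuous_cos].
have cF : continuous F.
  move=> t; apply: differentiable_continuous; apply/derivable1_diffP.
  by have [] := dF t.
have Fl : F (- (pi / 2)) = a - rho by rewrite /F sinN sin_pihalf mulrN1.
have Fr : F (pi / 2) = a + rho by rewrite /F sin_pihalf mulr1.
rewrite (_ : (\int[leb]_s _ = \int[leb]_(s in `[F (- (pi / 2))%R, F (pi / 2)%R]) (G s)%:E)%E); last first.
  rewrite [RHS]integral_mkcond; apply: eq_integral => s _.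
  rewrite patchE; case: ifPn => // /negP sI; congr EFin.
  have s0 : A - (s - a) ^+ 2 <= 0.
    rewrite -rho2 subr_le0 -(real_normK (num_real (s - a))) ler_pXn2r ?nnegrE ?(ltW rho0)//.
    rewrite leNgt; apply/negP; rewrite ltr_norml => sr; apply: sI.
    by rewrite inE /= in_itv/= Fl Fr; lra.
  by rewrite ler0_sqrtr ?expr0n.
rewrite (@integration_by_substitution_increasing _ F G); last first.
- exact: continuous_subspaceT.
- split; first by move=> t _; have [] := dF t.
  + by apply: cvg_at_right_filter; exact: cF.
  + by apply: cvg_at_left_filter; exact: cF.
- by apply/cvg_ex; exists (rho * cos (pi / 2)); rewrite F'E; apply: cvg_at_left_filter; exact: cF'.
- by apply/cvg_ex; exists (rho * cos (- (pi / 2))); rewrite F'E; apply: cvg_at_right_filter; exact: cF'.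
- by rewrite F'E => t _; exact: cF'.
- by move=> x y xI yI xy; rewrite /F ltrD2l ltr_pM2l// ltr_sin.
- exact: ltW.
transitivity (\int[leb]_(t in `[(- (pi / 2))%R, (pi / 2)%R]) (rho ^+ k.+2 * cos t ^+ k.+2)%:E)%E.
  apply: eq_integral => t /set_mem; rewrite /= in_itv/= => tI.
  congr EFin; rewrite F'E fctE /= /G /F.
  have -> : A - (a + rho * sin t - a) ^+ 2 = (rho * cos t) ^+ 2.
    by rewrite -rho2 !exprMn cos2sin2; ring.
  have c0 := cos_ge0_pihalf tI.
  rewrite sqrtr_sqr ger0_norm ?mulr_ge0// ?ltW//.
  by rewrite -exprSr exprMn.
have cc : continuous (fun t : R => rho ^+ k.+2 * cos t ^+ k.+2).
  by apply: continuousM; [exact: continuous_const|exact: ccos].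
rewrite -[LHS]fineK; last first.
  by apply: integrable_fin_num => //; exact: (continuous_integrable_cc _ _ cc).
congr EFin; rewrite -[LHS]/(Rintegral _ _ _) -Rintegral_itv_bndo_bndc; last exact: continuous_integrable.
by rewrite RintegralZl//; exact: continuous_integrable.
Qed.

End power_cos.

(** * The loop near a foot point *)

Section expansion.
Context {R : realType} (g : R -> 'rV[R]_3).
Hypothesis H : regular_loop g.

(** Orthogonality follows from minimality by [nearest_point]; it is recorded
    because it cancels the leading error term in the expansions at a foot. *)
Definition foot (x : 'rV[R]_3) (t0 : R) : Prop :=
  (forall t, enorm (x - g t0) <= enorm (x - g t)) /\
  dot (x - g t0) (derive1 g t0) = 0.

Lemma cross_taylor (n v e f : 'rV[R]_3) (s : R) :
  cross (n - s *: v - e) (v + f) - cross n v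
  = cross n f - s *: cross v f - cross e v - cross e f.
Proof.
apply/rowP; apply: ord3P; rewrite !mxE !inordK//= ?mxE ?inordK//=; ring.
Qed.

(** The loop is compared with its tangent line at the foot of [x]: [r0] is the
    distance from [x] to the point of the tangent line with parameter [s]. By
    orthogonality at the foot, the term of order [s * d] is absent from the
    squared distances; [cross (x - y) v] is constant for [y] on the tangent line.
    The chord-arc inequality makes both distances comparable to [d + |s|]. *)
Lemma local_expansion : exists C c : R, [/\ 0 < C, 0 < c & forall x t0 s,
  foot x t0 -> `|s| <= 1 / 2 ->
  let d := enorm (x - g t0) in let v0 := enorm (derive1 g t0) in
  let r := enorm (x - g (t0 + s)) in let r0 := Num.sqrt (d ^+ 2 + v0 ^+ 2 * s ^+ 2) in
  [/\ `|r ^+ 2 - r0 ^+ 2| <= C * (s ^+ 2 * (d + `|s|)),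
      c * (d + `|s|) <= r,
      c * (d + `|s|) <= r0,
      enorm (cross (x - g (t0 + s)) (derive1 g (t0 + s))
             - cross (x - g t0) (derive1 g t0)) <= C * (d + `|s|) ^+ 2 &
      `|enorm (derive1 g (t0 + s)) - v0| <= C * `|s|]].
Proof.
have [K K0 tayl] := curve_taylor H; have [m [M [m0 mM vM]]] := speed_bounds H.
have [c0 c00 chord] := chord_arc H.
pose C := K ^+ 2 + 2 * K + 2 * M * K + K.
have Mgt0 : 0 < M by lra.
have KK0 : 0 < K ^+ 2 by rewrite exprn_gt0.
have MK0 : 0 < M * K by rewrite mulr_gt0//; lra.
have C0 : 0 < C by rewrite /C; lra.
pose c := Num.min (1 / 2) (Num.min (c0 / 4) (m / 2)).
have cgt0 : 0 < c by rewrite !lt_min !divr_gt0.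
have c2 : c <= 1 / 2 by rewrite ge_min lexx.
have c4 : c <= c0 / 4 by rewrite !ge_min lexx orbT.
have cm : c <= m / 2 by rewrite !ge_min lexx !orbT.
exists C, c; split => // x t0 s [t0min t0dot] s2 d v0 r r0.
have [g'K gK] := tayl t0 s; have /andP[mv vM0] := vM t0.
have d0 : 0 <= d by exact: enorm_ge0.
have s0 := normr_ge0 s.
have ss : s ^+ 2 = `|s| ^+ 2 by rewrite real_normK ?num_real.
set e := g (t0 + s) - g t0 - _ in gK; set f := derive1 g (t0 + s) - _ in g'K.
have e0 := enorm_ge0 e; have f0 := enorm_ge0 f.
have xE : x - g (t0 + s) = x - g t0 - s *: derive1 g t0 - e.
  by rewrite /e; apply/rowP => i; rewrite !mxE; ring.
have g'E : derive1 g (t0 + s) = derive1 g t0 + f by rewrite /f [RHS]addrC subrK.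
have r02 : r0 ^+ 2 = d ^+ 2 + v0 ^+ 2 * s ^+ 2.
  by rewrite sqr_sqrtr//; apply: addr_ge0; [|apply: mulr_ge0]; exact: sqr_ge0.
have dr : d <= r by exact: t0min.
have r0d : d <= r0.
  by rewrite -(@ler_pXn2r _ 2)// ?nnegrE ?sqrtr_ge0// r02 lerDl mulr_ge0 ?sqr_ge0.
have r0s : v0 * `|s| <= r0.
  rewrite -(@ler_pXn2r _ 2)// ?nnegrE ?sqrtr_ge0 ?mulr_ge0 ?enorm_ge0//.
  by rewrite r02 exprMn -ss lerDr sqr_ge0.
have Ms : m * `|s| <= v0 * `|s| by exact: ler_wpM2r.
have rs : c0 * `|s| <= 2 * r.
  have := chord t0 s s2; have := enormD3 (g (t0 + s)) x (g t0).
  by rewrite (enormB (g _) x) -/r -/d; lra.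
have cs (k : R) : c <= k -> c * `|s| <= k * `|s| by move=> ck; exact: ler_wpM2r.
have cd : c * d <= 1 / 2 * d by exact: ler_wpM2r.
split.
- have -> : r ^+ 2 - r0 ^+ 2 = dot e e - 2 * dot (x - g t0) e + 2 * s * dot (derive1 g t0) e.
    by rewrite r02 {1}/r xE enorm_sqr dot_sub3 t0dot -!enorm_sqr -/d -/v0; ring.
  have B2 : dot e e <= K ^+ 2 * (s ^+ 2 * `|s|).
    rewrite -enorm_sqr; apply: (@le_trans _ _ ((K * s ^+ 2) ^+ 2)).
      by rewrite ler_pXn2r ?nnegrE// ?(sqr_ge0, mulr_ge0)// ltW.
    rewrite exprMn; apply: ler_wpM2l; first exact: ltW.
    rewrite expr2; apply: ler_wpM2l; first exact: sqr_ge0.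
    by rewrite ss expr2 ler_piMl//; lra.
  have B3 : `|dot (x - g t0) e| <= d * (K * s ^+ 2).
    by apply: (le_trans (Cauchy_Schwarz _ _)); exact: ler_wpM2l.
  have B4 : `|s * dot (derive1 g t0) e| <= `|s| * (M * (K * s ^+ 2)).
    rewrite normrM; apply: ler_wpM2l => //; apply: (le_trans (Cauchy_Schwarz _ _)).
    by apply: ler_pM => //; exact: enorm_ge0.
  have E0 := dot_ge0 e.
  have P1 : 0 <= s ^+ 2 * d * K ^+ 2 by rewrite ?(sqr_ge0, mulr_ge0).
  have P2 : 0 <= s ^+ 2 * d * (M * K) by rewrite ?(sqr_ge0, mulr_ge0)// ltW.
  have P3 : 0 <= s ^+ 2 * d * K by rewrite ?(sqr_ge0, mulr_ge0)// ltW.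
  have P4 : 0 <= s ^+ 2 * `|s| * K by rewrite ?(sqr_ge0, mulr_ge0)// ltW.
  rewrite /C; move: B3 B4; rewrite !ler_norml => /andP[? ?] /andP[? ?].
  by apply/andP; split; lra.
- have := cs _ c4; lra.
- have := cs _ cm; lra.
- rewrite xE g'E cross_taylor.
  set n := x - g t0; set v := derive1 g t0.
  have T1 : enorm (cross n f) <= d * (K * `|s|).
    by apply: (le_trans (enorm_cross _ _)); exact: ler_wpM2l.
  have T2 : enorm (s *: cross v f) <= `|s| * (M * (K * `|s|)).
    rewrite enormZ; apply: ler_wpM2l => //; apply: (le_trans (enorm_cross _ _)).
    by apply: ler_pM => //; exact: enorm_ge0.
  have T3 : enorm (cross e v) <= K * s ^+ 2 * M.
    apply: (le_trans (enorm_cross _ _)).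
    by apply: ler_pM => //; exact: enorm_ge0.
  have T4 : enorm (cross e f) <= K * s ^+ 2 * K.
    apply: (le_trans (enorm_cross _ _)); apply: ler_pM => //.
    apply: (le_trans g'K); rewrite ler_piMr//; [exact: ltW|lra].
  have D1 := enormD (cross n f - s *: cross v f - cross e v) (- cross e f).
  have D2 := enormD (cross n f - s *: cross v f) (- cross e v).
  have D3 := enormD (cross n f) (- (s *: cross v f)).
  move: D1 D2 D3; rewrite !enormN => D1 D2 D3.
  apply: (@le_trans _ _ (d * (K * `|s|) + `|s| * (M * (K * `|s|)) + K * s ^+ 2 * M
     + K * s ^+ 2 * K)); first lra.
  rewrite ss /C.
  have P1 : 0 <= d ^+ 2 * K by rewrite ?(sqr_ge0, mulr_ge0)// ltW.
  have P2 : 0 <= `|s| ^+ 2 * K by rewrite ?(sqr_ge0, mulr_ge0)// ltW.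
  have P3 : 0 <= d * `|s| * K by rewrite ?(sqr_ge0, mulr_ge0)// ltW.
  have P4 : 0 <= d * `|s| * (M * K) by rewrite ?(sqr_ge0, mulr_ge0)// ltW.
  have P5 : 0 <= d * `|s| * K ^+ 2 by rewrite ?(sqr_ge0, mulr_ge0)// ltW.
  have P6 : 0 <= d ^+ 2 * (M * K) by rewrite ?(sqr_ge0, mulr_ge0)// ltW.
  have P7 : 0 <= d ^+ 2 * K ^+ 2 by rewrite ?(sqr_ge0, mulr_ge0)// ltW.
  by lra.
- apply: (le_trans (enorm_lip _ _)); apply: (le_trans g'K); rewrite ler_wpM2r//.
  by rewrite /C; lra.
Qed.

End expansion.

Section bump.
Context {R : realType}.
Local Notation leb := (@lebesgue_measure R).

Lemma continuous_shift_sqr (t0 : R) : continuous (fun t : R => (t - t0) ^+ 2).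
Proof.
apply: continuousX; apply: continuousB; first by move=> t; exact: cvg_id.
exact: continuous_const.
Qed.

(** A smooth substitute for the indicator of an interval of length [2 * l] around
    [t0]; its primitive is an arc tangent. *)
Definition bump (l t0 t : R) := l ^+ 2 / (l ^+ 2 + (t - t0) ^+ 2).

Lemma continuous_bump l t0 : 0 < l -> continuous (bump l t0).
Proof.
move=> l0; apply: continuousM; first exact: continuous_const.
apply: continuous_inv => [t|].
  by rewrite gt_eqF// ltr_pwDl ?exprn_gt0// sqr_ge0.
by apply: continuousD; [exact: continuous_const|exact: continuous_shift_sqr].
Qed.

Lemma bump_integral (l t0 : R) : 0 < l ->
  \int[leb]_(t in `[t0 - 1 / 2, t0 + 1 / 2[) bump l t0 t <= pi * l.
Proof.
move=> l0.
have dF (t : R) : is_derive t 1 (fun t => l * atan ((t - t0) * l^-1)) (bump l t0 t).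
  have dh : is_derive t 1 (fun t : R => (t - t0) * l^-1) l^-1.
    by apply: is_derive_eq; rewrite /GRing.scale/=; ring.
  have da := @is_derive1_comp _ (@atan R) (fun t : R => (t - t0) * l^-1) t _ _ (is_derive1_atan _) dh.
  have -> : bump l t0 t = l * ((1 + ((t - t0) * l^-1) ^+ 2)^-1 * l^-1).
    have h1 : l != 0 by rewrite gt_eqF.
    have h2 : l ^+ 2 + (t - t0) ^+ 2 != 0.
      by rewrite gt_eqF// ltr_pwDl ?exprn_gt0// sqr_ge0.
    by rewrite /bump; field; rewrite h1 h2.
  have := is_deriveZ l da; rewrite /GRing.scale/=; exact.
have le12 : t0 - 1 / 2 < t0 + 1 / 2 by lra.
rewrite (Rintegral_FTC le12 (continuous_bump l0) (fun t _ => dF t)).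
rewrite -mulrBr mulrC ler_wpM2r ?(ltW l0)//.
have := atan_ltpi2 ((t0 + 1 / 2 - t0) / l); have := atan_gtNpi2 ((t0 - 1 / 2 - t0) / l).
lra.
Qed.

(** The Biot-Savart integral of a straight segment, seen from distance [d]. *)
Lemma line_integral (d v t0 : R) : 0 < d -> 0 < v ->
  \int[leb]_(t in `[t0 - 1 / 2, t0 + 1 / 2[) (Num.sqrt (d ^+ 2 + v ^+ 2 * (t - t0) ^+ 2) ^+ 3)^-1
  = (d ^+ 2 * Num.sqrt (d ^+ 2 + v ^+ 2 / 4))^-1.
Proof.
move=> d0 v0.
pose Q t := d ^+ 2 + v ^+ 2 * (t - t0) ^+ 2.
have Q0 t : 0 < Q t.
  by rewrite ltr_pwDl ?exprn_gt0// mulr_ge0 ?sqr_ge0.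
have S0 t : 0 < Num.sqrt (Q t) by rewrite sqrtr_gt0.
have dF (t : R) : is_derive t 1 (fun t => (t - t0) * (d ^+ 2)^-1 * (Num.sqrt (Q t))^-1)
   (Num.sqrt (Q t) ^+ 3)^-1.
  have dQ : is_derive t 1 Q (2 * v ^+ 2 * (t - t0)).
    by apply: is_derive_eq; rewrite /GRing.scale/=; ring.
  have dS := @is_derive1_comp _ (@Num.sqrt R) Q t _ _ (is_derive1_sqrt (Q0 t)) dQ.
  have SQ : Num.sqrt (Q t) != 0 by rewrite gt_eqF.
  have dV := @is_deriveV _ (fun t => Num.sqrt (Q t)) t _ _ SQ dS.
  have dh : is_derive t 1 (fun t : R => (t - t0) * (d ^+ 2)^-1) (d ^+ 2)^-1.
    by apply: is_derive_eq; rewrite /GRing.scale/=; ring.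
  apply: (is_derive_eq (is_deriveM dh dV)).
  rewrite /GRing.scale/=.
  have QE : Num.sqrt (Q t) ^+ 2 = Q t by rewrite sqr_sqrtr// ltW.
  have dd : d != 0 by rewrite gt_eqF.
  move: QE SQ; rewrite {2}/Q; set S := Num.sqrt _ => QE SQ.
  have v2E : v ^+ 2 * (t - t0) ^+ 2 = S ^+ 2 - d ^+ 2 by rewrite QE; ring.
  apply: (@mulfI _ (S ^+ 3 * d ^+ 2)); first by rewrite mulf_neq0// expf_neq0.
  transitivity (S ^+ 2 - v ^+ 2 * (t - t0) ^+ 2); first by field; rewrite dd SQ.
  by rewrite v2E; field.
have cf : continuous (fun t => (Num.sqrt (Q t) ^+ 3)^-1).
  apply: continuous_inv => [t|]; first by rewrite gt_eqF// exprn_gt0.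
  apply: continuousX; apply: continuous_sqrt; apply: continuousD.
    exact: continuous_const.
  by apply: continuousM; [exact: continuous_const|exact: continuous_shift_sqr].
have le12 : t0 - 1 / 2 < t0 + 1 / 2 by lra.
rewrite (Rintegral_FTC le12 cf (fun t _ => dF t)).
have -> : Q (t0 + 1 / 2) = d ^+ 2 + v ^+ 2 / 4 by rewrite /Q; field.
have -> : Q (t0 - 1 / 2) = d ^+ 2 + v ^+ 2 / 4 by rewrite /Q; field.
have h1 : d != 0 by rewrite gt_eqF.
have h2 : Num.sqrt (d ^+ 2 + v ^+ 2 / 4) != 0.
  by rewrite gt_eqF// sqrtr_gt0 ltr_pwDl ?exprn_gt0// divr_ge0 ?sqr_ge0.
by field; rewrite h1 h2.
Qed.

End bump.

(** * The Biot-Savart field near the loop *)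

Section biot_savart_field.
Context {R : realType} (g : R -> 'rV[R]_3).
Hypothesis H : regular_loop g.
Local Notation leb := (@lebesgue_measure R).

Lemma inv_cube_lip (l A B : R) : 0 < l -> l <= A -> l <= B ->
  `|(A ^+ 3)^-1 - (B ^+ 3)^-1| <= 2 * `|A ^+ 2 - B ^+ 2| / l ^+ 5.
Proof.
move=> l0 lA lB; have A0 := lt_le_trans l0 lA; have B0 := lt_le_trans l0 lB.
have [An Bn] : A != 0 /\ B != 0 by rewrite !gt_eqF.
have ABn : A + B != 0 by rewrite gt_eqF// addr_gt0.
have -> : (A ^+ 3)^-1 - (B ^+ 3)^-1 = - (A ^+ 2 - B ^+ 2) *
    ((A ^+ 2 + A * B + B ^+ 2) / (A + B) / (A ^+ 3 * B ^+ 3)).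
  by field; rewrite An Bn ABn.
rewrite normrM normrN (mulrC 2) -[leRHS]mulrA; apply: ler_wpM2l => //.
have A3 : 0 < A ^+ 3 * B ^+ 3 by rewrite mulr_gt0// exprn_gt0.
rewrite ger0_norm; last first.
  rewrite !divr_ge0 ?(ltW A3)//; last by rewrite addr_ge0// ltW.
  by rewrite !addr_ge0 ?sqr_ge0// mulr_ge0// ltW.
apply: (@le_trans _ _ ((A + B) / (A ^+ 3 * B ^+ 3))).
  apply: ler_wpM2r; first by rewrite invr_ge0 ltW.
  rewrite ler_pdivrMr ?addr_gt0//; have := mulr_gt0 A0 B0; nra.
have -> : (A + B) / (A ^+ 3 * B ^+ 3) = (A ^+ 2 * B ^+ 3)^-1 + (A ^+ 3 * B ^+ 2)^-1.
  by field; rewrite An Bn.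
have h (p q : nat) : (p + q = 5)%N -> (A ^+ p * B ^+ q)^-1 <= (l ^+ 5)^-1.
  move=> pq; rewrite lef_pV2 ?posrE ?mulr_gt0 ?exprn_gt0//.
  rewrite -pq exprD; apply: ler_pM; rewrite ?exprn_ge0 ?(ltW l0)//;
    by apply: lerXn2r; rewrite ?nnegrE ?(ltW l0) ?(ltW A0) ?(ltW B0).
have := h 2%N 3%N erefl; have := h 3%N 2%N erefl; lra.
Qed.

(** The integral of [(d + |s|)^-1] is of order [|ln d|]; the cruder bound
    [d^(-1/2)] is enough and follows from explicit integrals. *)
Lemma inv_dist_bump (d t0 t : R) : 0 < d ->
  (d + `|t - t0|)^-1 <= 2 / d * bump (Num.sqrt d) t0 t + (Num.sqrt d)^-1.
Proof.
move=> d0; rewrite /bump sqr_sqrtr; last exact: ltW.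
have q0 : 0 < Num.sqrt d by rewrite sqrtr_gt0.
have q2 : Num.sqrt d ^+ 2 = d by rewrite sqr_sqrtr// ltW.
set s := t - t0; have s0 := normr_ge0 s.
have ds0 : 0 < d + s ^+ 2 by rewrite ltr_pwDl// sqr_ge0.
have -> : 2 / d * (d / (d + s ^+ 2)) = 2 / (d + s ^+ 2).
  by field; rewrite !gt_eqF.
have [sq|qs] := leP (s ^+ 2) d.
  apply: (@le_trans _ _ d^-1).
    by rewrite lef_pV2 ?posrE//; [rewrite lerDl|rewrite ltr_pwDl].
  apply: (@le_trans _ _ (2 / (d + s ^+ 2))); last by rewrite lerDl invr_ge0 ltW.
  by rewrite -[leLHS]mul1r ler_pdivlMr// mulrAC ler_pdivrMr//; lra.
apply: (@le_trans _ _ (Num.sqrt d)^-1); last by rewrite lerDr divr_ge0// ltW.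
rewrite lef_pV2 ?posrE//; last by rewrite ltr_pwDl.
apply: (@le_trans _ _ `|s|); last by rewrite lerDr ltW.
rewrite -(@ler_pXn2r _ 2)// ?nnegrE ?ltW// q2 real_normK ?num_real//.
Qed.

Lemma continuous_cross (a b : R -> 'rV[R]_3) j : continuous a -> continuous b ->
  continuous (fun t => cross (a t) (b t) 0 j).
Proof.
move=> ca cb.
have cai i : continuous (fun t => a t 0 i).
  by move=> t; apply: (@continuous_comp _ _ _ a (fun v : 'rV[R]_3 => v 0 i)); [exact: ca|exact: coord_continuous].
have cbi i : continuous (fun t => b t 0 i).
  by move=> t; apply: (@continuous_comp _ _ _ b (fun v : 'rV[R]_3 => v 0 i)); [exact: cb|exact: coord_continuous].
have cM i k : continuous (fun t => a t 0 i * b t 0 k) by apply: continuousM.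
move: j; apply: ord3P.
- rewrite (_ : (fun t => _) = (fun t => a t 0 (inord 1) * b t 0 (inord 2) - a t 0 (inord 2) * b t 0 (inord 1))).
    exact: continuousB.
  by apply/funext => t; case: (crossE (a t) (b t)).
- rewrite (_ : (fun t => _) = (fun t => a t 0 (inord 2) * b t 0 (inord 0) - a t 0 (inord 0) * b t 0 (inord 2))).
    exact: continuousB.
  by apply/funext => t; case: (crossE (a t) (b t)).
- rewrite (_ : (fun t => _) = (fun t => a t 0 (inord 0) * b t 0 (inord 1) - a t 0 (inord 1) * b t 0 (inord 0))).
    exact: continuousB.
  by apply/funext => t; case: (crossE (a t) (b t)).
Qed.

Lemma continuous_dist x : continuous (fun t => enorm (x - g t)).
Proof.
move=> t; apply: (@continuous_comp _ _ _ (fun t => x - g t) (@enorm R)).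
  by apply: cvgB; [exact: cvg_cst|exact: (loop_continuous H)].
exact: continuous_enorm.
Qed.

Definition biot_savart x j t := cross (x - g t) (derive1 g t) 0 j / enorm (x - g t) ^+ 3.

Lemma continuous_biot_savart x j : (forall t, 0 < enorm (x - g t)) ->
  continuous (biot_savart x j).
Proof.
move=> x0; apply: continuousM.
  apply: continuous_cross; last exact: (loop_continuous' H).
  by move=> t; apply: cvgB; [exact: cvg_cst|exact: (loop_continuous H)].
apply: continuous_inv; first by move=> t; rewrite gt_eqF// exprn_gt0.
by apply: continuousX; exact: continuous_dist.
Qed.

(** Replacing the loop by its tangent line at the foot changes the integrand by
    [O ((d + |s|)^-1)], hence the field by [O (d^(-1/2))], while the field itself
    is of order [1 / d]. *)
Lemma biot_savart_asymptotics (D : R) : 0 < D -> exists2 C : R, 0 < C &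
  forall x t0, foot g x t0 -> 0 < enorm (x - g t0) -> enorm (x - g t0) <= D ->
  forall j, `|\int[leb]_(t in `[t0 - 1 / 2, t0 + 1 / 2[) biot_savart x j t
     - 2 / (enorm (derive1 g t0) * enorm (x - g t0) ^+ 2)
        * cross (x - g t0) (derive1 g t0) 0 j|
  <= C / Num.sqrt (enorm (x - g t0)).
Proof.
move=> D0; have [C [c [C0 c0 expn]]] := local_expansion H.
have [m [M [m0 mM vM]]] := speed_bounds H.
pose C1 := C / c ^+ 3 + 2 * M * C / c ^+ 5.
have M0 : 0 < M by lra.
have C10 : 0 < C1.
  by rewrite addr_gt0// divr_gt0 ?exprn_gt0// ?mulr_gt0.
pose C2 := C1 * (2 * pi + 1) + D * M * (4 / m ^+ 3) * Num.sqrt D.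
have C20 : 0 < C2.
  rewrite ltr_pwDl//; first by rewrite mulr_gt0// addr_gt0// mulr_gt0// pi_gt0.
  by rewrite ?(sqrtr_ge0, mulr_ge0)// ltW ?invr_gt0 ?exprn_gt0.
exists C2 => // x t0 fx; set d := enorm (x - g t0); set v0 := enorm (derive1 g t0) => d0 dD j.
set n := cross _ _ 0 j.
have v00 : 0 < v0 by have /andP[mv _] := vM t0; exact: lt_le_trans mv.
have nd : `|n| <= d * M.
  apply: (le_trans (enorm_coord _ _)); apply: (le_trans (enorm_cross _ _)).
  by apply: ler_wpM2l; [exact: enorm_ge0|have /andP[] := vM t0].
pose S t := Num.sqrt (d ^+ 2 + v0 ^+ 2 * (t - t0) ^+ 2).
(* The integrand of the tangent line. *)
pose G t := n * (S t ^+ 3)^-1.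
have S0 t : 0 < S t by rewrite sqrtr_gt0 ltr_pwDl ?exprn_gt0// mulr_ge0 ?sqr_ge0.
have cS : continuous (fun t => (S t ^+ 3)^-1).
  apply: continuous_inv => [t|]; first by rewrite gt_eqF// exprn_gt0.
  apply: continuousX; apply: continuous_sqrt; apply: continuousD.
    exact: continuous_const.
  by apply: continuousM; [exact: continuous_const|exact: continuous_shift_sqr].
have cG : continuous G by apply: continuousM => //; exact: continuous_const.
have cF : continuous (biot_savart x j).
  by apply: continuous_biot_savart => t; apply: (lt_le_trans d0); case: fx.
have q0 : 0 < Num.sqrt d by rewrite sqrtr_gt0.
pose B t := C1 * (2 / d * bump (Num.sqrt d) t0 t + (Num.sqrt d)^-1).
have cb : continuous (fun t => 2 / d * bump (Num.sqrt d) t0 t).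
  by apply: continuousM; [exact: continuous_const|exact: continuous_bump].
have cB : continuous B.
  apply: continuousM; first exact: continuous_const.
  by apply: continuousD => //; exact: continuous_const.
have FG : `|\int[leb]_(t in `[t0 - 1 / 2, t0 + 1 / 2[) biot_savart x j t
    - \int[leb]_(t in `[t0 - 1 / 2, t0 + 1 / 2[) G t|
    <= \int[leb]_(t in `[t0 - 1 / 2, t0 + 1 / 2[) B t.
  apply: normB_Rintegral_co => // t /andP[t1 t2].
  have s2 : `|t - t0| <= 1 / 2 by rewrite ler_norml; apply/andP; split; lra.
  have := expn x t0 (t - t0) fx s2; rewrite -/d -/v0 (addrC t0) subrK /=.
  rewrite -[Num.sqrt _]/(S t); set s := t - t0; set r := enorm (x - g t).
  have ds0 : 0 < d + `|s| by rewrite ltr_pwDl.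
  have cds0 : 0 < c * (d + `|s|) by rewrite mulr_gt0.
  move=> [rS cr cS' crossE' _].
  have r0 : 0 < r by exact: lt_le_trans cr.
  apply: (@le_trans _ _ (C1 * (d + `|s|)^-1)); last first.
    by rewrite ler_pM2l//; exact: inv_dist_bump.
  rewrite /biot_savart /G -/r; set k := cross _ _ 0 j.
  have -> : k / r ^+ 3 - n / S t ^+ 3 = (k - n) / r ^+ 3 + n * ((r ^+ 3)^-1 - (S t ^+ 3)^-1).
    by ring.
  have kn : `|k - n| <= C * (d + `|s|) ^+ 2.
    apply: le_trans crossE'.
    rewrite (_ : k - n = (cross (x - g t) (derive1 g t) - cross (x - g t0) (derive1 g t0)) 0 j).
      exact: enorm_coord.
    by rewrite [RHS]mxE; congr (_ + _); rewrite [RHS]mxE.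
  have E1 : `|(k - n) / r ^+ 3| <= C / c ^+ 3 * (d + `|s|)^-1.
    rewrite normrM [X in _ * X]ger0_norm ?invr_ge0 ?exprn_ge0 ?(ltW r0)//.
    apply: (@le_trans _ _ (C * (d + `|s|) ^+ 2 / (c * (d + `|s|)) ^+ 3)).
      apply: ler_pM => //; first by rewrite invr_ge0 exprn_ge0 ?(ltW r0).
      rewrite lef_pV2 ?posrE ?exprn_gt0//.
      by apply: lerXn2r; rewrite ?nnegrE ?(ltW cds0) ?(ltW r0).
    rewrite le_eqVlt; apply/orP; left; apply/eqP.
    by field; rewrite !gt_eqF.
  have E2 : `|n * ((r ^+ 3)^-1 - (S t ^+ 3)^-1)| <= 2 * M * C / c ^+ 5 * (d + `|s|)^-1.
    rewrite normrM.
    apply: (@le_trans _ _ (d * M * (2 * (C * (s ^+ 2 * (d + `|s|))) / (c * (d + `|s|)) ^+ 5))).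
      apply: ler_pM => //; apply: (le_trans (inv_cube_lip cds0 cr cS')).
      apply: ler_wpM2r; first by rewrite invr_ge0 exprn_ge0// ltW.
      by rewrite ler_pM2l.
    have -> : d * M * (2 * (C * (s ^+ 2 * (d + `|s|))) / (c * (d + `|s|)) ^+ 5) =
        2 * M * C / c ^+ 5 * (d + `|s|)^-1 * (d * s ^+ 2 / (d + `|s|) ^+ 3).
      by field; rewrite !gt_eqF.
    rewrite ler_piMr//.
      by rewrite ?(invr_ge0, divr_ge0, mulr_ge0, exprn_ge0)// ltW.
    rewrite ler_pdivrMr ?exprn_gt0// mul1r.
    have -> : s ^+ 2 = `|s| ^+ 2 by rewrite real_normK ?num_real.
    have sn := normr_ge0 s.
    have P1 : 0 <= d ^+ 3 by rewrite exprn_ge0// ltW.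
    have P2 : 0 <= `|s| ^+ 3 by rewrite exprn_ge0.
    have P3 : 0 <= d ^+ 2 * `|s| by rewrite mulr_ge0 ?sqr_ge0.
    have P4 : 0 <= d * `|s| ^+ 2 by rewrite mulr_ge0 ?sqr_ge0// ltW.
    lra.
  apply: (le_trans (ler_normD _ _)); rewrite /C1 [leRHS]mulrDl; exact: lerD.
have IB : \int[leb]_(t in `[t0 - 1 / 2, t0 + 1 / 2[) B t <= C1 * (2 * pi + 1) / Num.sqrt d.
  have le12 : t0 - 1 / 2 <= t0 + 1 / 2 by lra.
  rewrite /B RintegralZl//; last first.
    by apply: continuous_integrable; apply: continuousD => //; exact: continuous_const.
  have i1 := continuous_integrable (t0 - 1 / 2) (t0 + 1 / 2) cb.
  have i2 := continuous_integrable (t0 - 1 / 2) (t0 + 1 / 2)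
    (@continuous_const R R (Num.sqrt d)^-1).
  rewrite -mulrA ler_pM2l// (RintegralD _ i1 i2)//.
  rewrite RintegralZl//; last by apply: continuous_integrable; exact: continuous_bump.
  rewrite Rintegral_co_cst//.
  have -> : t0 + 1 / 2 - (t0 - 1 / 2) = 1 by lra.
  rewrite mulr1 [leRHS]mulrDl [X in _ <= _ + X]mul1r lerD2r.
  apply: (@le_trans _ _ (2 / d * (pi * Num.sqrt d))).
    by rewrite ler_pM2l ?divr_gt0//; exact: bump_integral.
  have := @sqr_sqrtr _ d (ltW d0); set q := Num.sqrt d => <-.
  rewrite le_eqVlt; apply/orP; left; apply/eqP; field.
  by rewrite gt_eqF.
have IG : `|\int[leb]_(t in `[t0 - 1 / 2, t0 + 1 / 2[) G t - 2 / (v0 * d ^+ 2) * n|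
    <= D * M * (4 / m ^+ 3) * Num.sqrt D / Num.sqrt d.
  rewrite /G RintegralZl//; last exact: continuous_integrable.
  rewrite (line_integral t0 d0 v00); set b := Num.sqrt (d ^+ 2 + v0 ^+ 2 / 4).
  have b2 : b ^+ 2 = d ^+ 2 + v0 ^+ 2 / 4.
    by rewrite sqr_sqrtr// addr_ge0 ?sqr_ge0// divr_ge0 ?sqr_ge0.
  have bv : v0 / 2 <= b.
    rewrite -(@ler_pXn2r _ 2)// ?nnegrE ?sqrtr_ge0 ?divr_ge0 ?(ltW v00)// b2.
    have -> : (v0 / 2) ^+ 2 = v0 ^+ 2 / 4 by field.
    by rewrite lerDr sqr_ge0.
  have b0 : 0 < b by apply: lt_le_trans bv; rewrite divr_gt0.
  have -> : n / (d ^+ 2 * b) - 2 / (v0 * d ^+ 2) * n = - n * (4 / ((v0 + 2 * b) * b * v0)).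
    have -> : 4 = 4 * (b ^+ 2 - v0 ^+ 2 / 4) / d ^+ 2.
      by rewrite b2; field; rewrite gt_eqF.
    by field; rewrite !gt_eqF// addr_gt0// mulr_gt0.
  rewrite normrM normrN.
  have qD : 1 <= Num.sqrt D / Num.sqrt d by rewrite ler_pdivlMr// mul1r ler_sqrt// ltW.
  rewrite -[leRHS]mulrA; apply: (@le_trans _ _ (D * M * (4 / m ^+ 3) * 1)); last first.
    apply: ler_wpM2l => //.
    by rewrite ?(sqrtr_ge0, mulr_ge0)// ltW ?invr_gt0 ?exprn_gt0.
  rewrite mulr1; apply: ler_pM => //.
    by apply: (le_trans nd); apply: ler_wpM2r => //; exact: ltW.
  have /andP[mv _] := vM t0; rewrite -/v0 in mv.
  have p0 : 0 < (v0 + 2 * b) * b * v0 by rewrite !mulr_gt0// addr_gt0// mulr_gt0.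
  rewrite ger0_norm; last by rewrite divr_ge0// ltW.
  rewrite ler_pM2l// lef_pV2 ?posrE ?exprn_gt0//.
  have -> : m ^+ 3 = m * m * m by ring.
  apply: ler_pM; rewrite ?mulr_ge0 ?(ltW m0)//.
  have mb : m / 2 <= b by apply: le_trans bv; rewrite ler_pM2r ?invr_gt0.
  have -> : m * m = (m + m) * (m / 2) by field.
  apply: ler_pM => //; rewrite ?addr_ge0 ?divr_ge0 ?(ltW m0)//.
  by apply: lerD => //; rewrite mulrC -ler_pdivrMr.
rewrite /C2 [leRHS]mulrDl.
apply: (le_trans (ler_distD (\int[leb]_(t in `[t0 - 1 / 2, t0 + 1 / 2[) G t) _ _)).
by apply: lerD; [exact: le_trans FG IB|exact: IG].
Qed.

End biot_savart_field.

Section kernels.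
Context {R : realType} (g : R -> 'rV[R]_3).
Hypothesis H : regular_loop g.
Local Notation leb := (@lebesgue_measure R).

Lemma sqr_near (p e k l : R) : `|p - e| <= k -> `|e| <= l ->
  `|p ^+ 2 - e ^+ 2| <= k * (k + 2 * l).
Proof.
move=> pe el; have -> : p ^+ 2 - e ^+ 2 = (p - e) * ((p - e) + 2 * e) by ring.
rewrite normrM; apply: ler_pM => //; apply: (le_trans (ler_normD _ _)).
by apply: lerD => //; rewrite normrM ger0_norm// ler_pM2l.
Qed.

(** The squared field is that of a straight line, up to a perturbation that is
    integrable over tubes around the curve. *)
Lemma field_sqr_asymptotics (D : R) : 0 < D -> exists2 C : R, 0 < C &
  forall x t0, foot g x t0 -> 0 < enorm (x - g t0) -> enorm (x - g t0) <= D ->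
  `|\sum_j (\int[leb]_(t in `[t0 - 1 / 2, t0 + 1 / 2[) biot_savart g x j t) ^+ 2
     - 4 / enorm (x - g t0) ^+ 2|
  <= C / (enorm (x - g t0) * Num.sqrt (enorm (x - g t0))).
Proof.
move=> D0; have [C C0 HC] := biot_savart_asymptotics H D0.
exists (3 * C * (C * Num.sqrt D + 4)).
  by rewrite !mulr_gt0// ltr_pwDr// mulr_ge0 ?sqrtr_ge0// ltW.
move=> x t0 fx; set d := enorm (x - g t0) => d0 dD.
have v00 : 0 < enorm (derive1 g t0) by rewrite enorm_gt0 (loop_regular H).
set n := cross (x - g t0) (derive1 g t0).
set a := 2 / (enorm (derive1 g t0) * d ^+ 2).
have HCx := HC x t0 fx d0 dD; rewrite -/d -/n -/a in HCx.
have nE : enorm n = d * enorm (derive1 g t0).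
  apply/eqP; rewrite -(@eqrXn2 _ 2) ?enorm_ge0 ?mulr_ge0 ?enorm_ge0//.
  by rewrite enorm_cross_sqr (proj2 fx) expr0n subr0.
have a0 : 0 < a by rewrite divr_gt0// mulr_gt0// exprn_gt0.
have anE : a * enorm n = 2 / d.
  by rewrite nE /a; field; rewrite !gt_eqF.
have an2 : \sum_j (a * n 0 j) ^+ 2 = 4 / d ^+ 2.
  rewrite (eq_bigr (fun j => a ^+ 2 * (n 0 j * n 0 j))); last by move=> j _; ring.
  by rewrite -mulr_sumr -[\sum_i _]/(dot n n) -enorm_sqr -exprMn anE; field; rewrite gt_eqF.
have an j : `|a * n 0 j| <= 2 / d.
  by rewrite -anE normrM (gtr0_norm a0) ler_pM2l// enorm_coord.
have q0 : 0 < Num.sqrt d by rewrite sqrtr_gt0.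
have q2 : Num.sqrt d ^+ 2 = d by rewrite sqr_sqrtr// ltW.
pose w j := \int[leb]_(t in `[t0 - 1 / 2, t0 + 1 / 2[) biot_savart g x j t.
have {}HCx j : `|w j - a * n 0 j| <= C / Num.sqrt d by exact: HCx.
rewrite -[\sum_j _]/(\sum_j w j ^+ 2).
have est j : `|w j ^+ 2 - (a * n 0 j) ^+ 2| <= C * (C * Num.sqrt D + 4) / (d * Num.sqrt d).
  apply: (le_trans (sqr_near (HCx j) (an j))).
  have qD : Num.sqrt d <= Num.sqrt D by rewrite ler_sqrt// ltW.
  have -> : C / Num.sqrt d * (C / Num.sqrt d + 2 * (2 / d)) =
      C * (C * Num.sqrt d + 4) / (d * Num.sqrt d).
    have -> : C / Num.sqrt d * (C / Num.sqrt d + 2 * (2 / d)) =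
       C * (C * Num.sqrt d * d + 4 * Num.sqrt d ^+ 2) / (d * Num.sqrt d ^+ 3).
      by field; rewrite !gt_eqF.
    by rewrite q2; move: q2; set q := Num.sqrt d => <-; field; rewrite gt_eqF.
  rewrite ler_pM2r ?invr_gt0 ?mulr_gt0// ler_pM2l// lerD2r.
  by rewrite ler_pM2l.
rewrite -an2 -sumrB; apply: (le_trans (ler_norm_sum _ _ _)).
apply: (le_trans (ler_sum _ (fun j _ => est j))).
by rewrite sumr_const card_ord le_eqVlt; apply/orP; left; apply/eqP; ring.
Qed.

Lemma sqrt_holder (p q : R) : `|Num.sqrt p - Num.sqrt q| <= Num.sqrt `|p - q|.
Proof.
wlog qp : p q / q <= p.
  move=> Hw; case/orP: (le_total q p) => [|pq]; first exact: Hw.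
  by rewrite distrC (distrC p); exact: Hw.
have sqp : Num.sqrt q <= Num.sqrt p by exact: ler_wsqrtr.
rewrite !ger0_norm ?subr_ge0//.
have [q0|q0] := leP q 0.
  rewrite (ler0_sqrtr q0) subr0; apply: ler_wsqrtr; lra.
rewrite lerBlDl -(@ler_pXn2r _ 2)// ?nnegrE ?addr_ge0 ?sqrtr_ge0//.
rewrite sqrrD !sqr_sqrtr ?subr_ge0//; [|exact: ltW|lra].
have : 0 <= Num.sqrt q * Num.sqrt (p - q) by rewrite mulr_ge0 ?sqrtr_ge0.
lra.
Qed.

Lemma sqrt_integral_line (A a : R) : A <= 1 / 4 ->
  \int[leb]_(t in `[a - 1 / 2, a + 1 / 2[) Num.sqrt (A - (t - a) ^+ 2) =
  Num.sqrt A ^+ 2 * cosint 2.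
Proof.
move=> A4; have := integral_sqrt_power A a 0; rewrite /Rintegral => E.
rewrite (_ : (\int[leb]_(t in _) _ = \int[leb]_s (Num.sqrt (A - (s - a) ^+ 2) ^+ 1)%:E)%E).
  by rewrite E.
rewrite [LHS]integral_mkcond; apply: eq_integral => s _.
rewrite patchE expr1; case: ifPn => // /negP sI; congr EFin.
rewrite ler0_sqrtr// subr_le0; apply: (le_trans A4).
have -> : 1 / 4 = (1 / 2) ^+ 2 :> R by field.
rewrite -(real_normK (num_real (s - a))) ler_pXn2r ?nnegrE ?divr_ge0//.
rewrite leNgt; apply/negP; rewrite ltr_norml => sr; apply: sI.
by rewrite inE /= in_itv/=; apply/andP; split; lra.
Qed.

(** The half-sphere of radius [r] over the point [g t], weighted by arc length. *)
Definition tube_kernel (r : R) x t :=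
  Num.sqrt (r ^+ 2 - enorm (x - g t) ^+ 2) * enorm (derive1 g t).

Lemma continuous_tube_kernel r x : continuous (tube_kernel r x).
Proof.
apply: continuousM; last exact: (continuous_speed (loop_continuous' H)).
apply: continuous_sqrt; apply: continuousB; first exact: continuous_const.
by apply: continuousX; exact: (continuous_dist H).
Qed.

(** For a straight line the integral is the area of a half-disc of radius
    [sqrt (r^2 - d^2)]. Squared distances to the loop and to its tangent line
    differ by [O (r^3)] where the kernel is not zero; as the square root is only
    Holder continuous of exponent 1/2, the kernels differ by [O (r^(3/2))], on a
    parameter interval of length [O (r)]. *)
Lemma tube_kernel_asymptotics : exists C r1 : R, [/\ 0 < C, 0 < r1 & forall r x t0,
  foot g x t0 -> enorm (x - g t0) < r -> r <= r1 ->
  `|\int[leb]_(t in `[t0 - 1 / 2, t0 + 1 / 2[) tube_kernel r x t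
     - cosint 2 * (r ^+ 2 - enorm (x - g t0) ^+ 2)| <= C * (r ^+ 2 * Num.sqrt r)].
Proof.
have [C [c [C0 c0 expn]]] := local_expansion H.
have [m [M [m0 mM vM]]] := speed_bounds H.
have M0 : 0 < M by lra.
pose r1 := Num.min 1 (m / 2).
have r10 : 0 < r1 by rewrite lt_min ltr01 divr_gt0.
(* Both kernels vanish for [|s| > L * r]. *)
pose L := c^-1; have L0 : 0 < L by rewrite invr_gt0.
pose C1 := M * Num.sqrt (C * (L ^+ 2 * (1 + L))) + C * L.
have C10 : 0 < C1.
  by rewrite ltr_pwDr ?mulr_gt0// mulr_ge0 ?sqrtr_ge0// ltW.
exists (2 * pi * L * C1), r1; split => //.
  by rewrite ?(pi_gt0, mulr_gt0).
move=> r x t0 fx; set d := enorm (x - g t0) => dr rr1.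
have d0 : 0 <= d by exact: enorm_ge0.
have r0 : 0 < r by exact: le_lt_trans dr.
have r_le1 : r <= 1 by apply: (le_trans rr1); rewrite ge_min lexx.
have r_m : r <= m / 2 by apply: (le_trans rr1); rewrite ge_min lexx orbT.
set v0 := enorm (derive1 g t0).
have /andP[mv vM0] := vM t0; rewrite -/v0 in mv vM0.
have v00 : 0 < v0 by exact: lt_le_trans mv.
pose A := (r ^+ 2 - d ^+ 2) / v0 ^+ 2.
have dr2 : 0 <= r ^+ 2 - d ^+ 2 by rewrite subr_ge0 ler_pXn2r ?nnegrE// ltW.
have A0 : 0 <= A by rewrite divr_ge0// sqr_ge0.
have A4 : A <= 1 / 4.
  rewrite ler_pdivrMr ?exprn_gt0//.
  have : r ^+ 2 <= (v0 / 2) ^+ 2.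
    rewrite ler_pXn2r ?nnegrE ?divr_ge0 ?(ltW r0) ?(ltW v00)//.
    by apply: (le_trans r_m); rewrite ler_pM2r ?invr_gt0.
  have -> : (v0 / 2) ^+ 2 = 1 / 4 * v0 ^+ 2 by field.
  by have := sqr_ge0 d; lra.
(* The kernel of the tangent line, with the speed taken out of the square root. *)
pose G t := v0 ^+ 2 * Num.sqrt (A - (t - t0) ^+ 2).
have cGs : continuous (fun t => Num.sqrt (A - (t - t0) ^+ 2)).
  apply: continuous_sqrt; apply: continuousB; first exact: continuous_const.
  exact: continuous_shift_sqr.
have cG : continuous G by apply: continuousM => //; exact: continuous_const.
have <- : \int[leb]_(t in `[t0 - 1 / 2, t0 + 1 / 2[) G t = cosint 2 * (r ^+ 2 - d ^+ 2).
  rewrite RintegralZl//; last exact: continuous_integrable.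
  rewrite sqrt_integral_line// sqr_sqrtr// /A; field; exact: lt0r_neq0.
have Lr0 : 0 < L * r by rewrite mulr_gt0.
pose K := C1 * (r * Num.sqrt r).
have q0 : 0 < Num.sqrt r by rewrite sqrtr_gt0.
have K0 : 0 < K by rewrite !mulr_gt0.
pose B t := 2 * K * bump (L * r) t0 t.
have cb : continuous (bump (L * r) t0) by exact: continuous_bump.
have cB : continuous B by apply: continuousM => //; exact: continuous_const.
apply: (@le_trans _ _ (\int[leb]_(t in `[t0 - 1 / 2, t0 + 1 / 2[) B t)); last first.
  rewrite RintegralZl//; last exact: continuous_integrable.
  apply: (@le_trans _ _ (2 * K * (pi * (L * r)))).
    by rewrite ler_pM2l ?mulr_gt0//; exact: bump_integral.
  by rewrite le_eqVlt; apply/orP; left; apply/eqP; rewrite /K; ring.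
apply: normB_Rintegral_co => //; first exact: continuous_tube_kernel.
move=> t /andP[t1 t2].
have s2 : `|t - t0| <= 1 / 2 by rewrite ler_norml; apply/andP; split; lra.
have := expn x t0 (t - t0) fx s2; rewrite -/d -/v0 (addrC t0) subrK /=.
set s := t - t0; set rr := enorm (x - g t); set S := Num.sqrt (d ^+ 2 + v0 ^+ 2 * s ^+ 2).
move=> [rS cr cS _ vv].
have s0 := normr_ge0 s.
have GE : G t = v0 * Num.sqrt (r ^+ 2 - S ^+ 2).
  have S2 : S ^+ 2 = d ^+ 2 + v0 ^+ 2 * s ^+ 2.
    by apply: sqr_sqrtr; apply: addr_ge0; [|apply: mulr_ge0]; exact: sqr_ge0.
  rewrite /G /A -/s S2.
  have -> : r ^+ 2 - (d ^+ 2 + v0 ^+ 2 * s ^+ 2)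
      = v0 ^+ 2 * ((r ^+ 2 - d ^+ 2) / v0 ^+ 2 - s ^+ 2).
    by field; exact: lt0r_neq0.
  by rewrite sqrtrM ?sqr_ge0// sqrtr_sqr gtr0_norm// mulrA -expr2.
rewrite GE /tube_kernel -/rr; set v := enorm (derive1 g t) in vv *.
have [sL|Ls] := leP `|s| (L * r); last first.
  have far (a : R) : c * (d + `|s|) <= a -> Num.sqrt (r ^+ 2 - a ^+ 2) = 0.
    move=> ca; rewrite ler0_sqrtr// subr_le0.
    have ra : r <= a.
      apply: le_trans ca; rewrite -ler_pdivrMl// -/L.
      by apply: (le_trans (ltW Ls)); rewrite lerDr.
    by rewrite ler_pXn2r ?nnegrE ?(ltW r0)// (le_trans (ltW r0)).
  rewrite !far// mul0r mulr0 subrr normr0 /B /bump.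
  apply: mulr_ge0; first by rewrite mulr_ge0 ?(ltW K0).
  by apply: divr_ge0; [|apply: addr_ge0]; exact: sqr_ge0.
have KB : K <= B t.
  rewrite /B mulrAC -[leLHS]mul1r ler_pM2r//.
  rewrite /bump mulrA ler_pdivlMr; last first.
    by rewrite ltr_pwDl ?exprn_gt0// sqr_ge0.
  have : s ^+ 2 <= (L * r) ^+ 2.
    by rewrite -real_normK ?num_real// ler_pXn2r ?nnegrE ?(ltW Lr0).
  by rewrite -/s; lra.
apply: le_trans KB.
have -> : Num.sqrt (r ^+ 2 - rr ^+ 2) * v - v0 * Num.sqrt (r ^+ 2 - S ^+ 2) =
   (Num.sqrt (r ^+ 2 - rr ^+ 2) - Num.sqrt (r ^+ 2 - S ^+ 2)) * v +
   Num.sqrt (r ^+ 2 - S ^+ 2) * (v - v0) by ring.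
have E1 : `|(Num.sqrt (r ^+ 2 - rr ^+ 2) - Num.sqrt (r ^+ 2 - S ^+ 2)) * v| <=
    M * Num.sqrt (C * (L ^+ 2 * (1 + L))) * (r * Num.sqrt r).
  have v_ge0 : 0 <= v by exact: enorm_ge0.
  have vM' : v <= M by have /andP[] := vM t.
  rewrite normrM [X in _ * X]ger0_norm//.
  have -> : M * Num.sqrt (C * (L ^+ 2 * (1 + L))) * (r * Num.sqrt r) =
    Num.sqrt (C * (L ^+ 2 * (1 + L))) * (r * Num.sqrt r) * M by ring.
  apply: ler_pM => //.
  apply: (le_trans (sqrt_holder _ _)).
  have -> : r * Num.sqrt r = Num.sqrt (r ^+ 3).
    by rewrite exprSr (sqrtrM _ (sqr_ge0 r)) sqrtr_sqr gtr0_norm.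
  rewrite -sqrtrM; last by rewrite ?(sqr_ge0, mulr_ge0, addr_ge0)// ltW.
  apply: ler_wsqrtr.
  have -> : r ^+ 2 - rr ^+ 2 - (r ^+ 2 - S ^+ 2) = - (rr ^+ 2 - S ^+ 2) by ring.
  rewrite normrN; apply: (le_trans rS).
  have -> : C * (L ^+ 2 * (1 + L)) * r ^+ 3 = C * ((L * r) ^+ 2 * (r + L * r)) by ring.
  rewrite ler_pM2l//; apply: ler_pM; rewrite ?sqr_ge0 ?addr_ge0//.
    by rewrite -real_normK ?num_real// ler_pXn2r ?nnegrE ?(ltW Lr0).
  by apply: lerD => //; exact: ltW.
have E2 : `|Num.sqrt (r ^+ 2 - S ^+ 2) * (v - v0)| <= C * L * (r * Num.sqrt r).
  rewrite normrM ger0_norm ?sqrtr_ge0//.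
  have r_q : r <= Num.sqrt r.
    rewrite -(@ler_pXn2r _ 2)// ?nnegrE ?(ltW r0) ?(ltW q0)//.
    by rewrite sqr_sqrtr ?(ltW r0)// expr2 ler_piMl// ltW.
  apply: (@le_trans _ _ (r * (C * (L * r)))); last first.
    have -> : r * (C * (L * r)) = C * L * (r * r) by ring.
    by rewrite ler_pM2l ?mulr_gt0// ler_pM2l.
  apply: ler_pM => //; rewrite ?sqrtr_ge0//.
    apply: (@le_trans _ _ (Num.sqrt (r ^+ 2))); last by rewrite sqrtr_sqr gtr0_norm.
    by apply: ler_wsqrtr; rewrite lerBlDr lerDl sqr_ge0.
  by apply: (le_trans vv); rewrite ler_pM2l.
by apply: (le_trans (ler_normD _ _)); rewrite /K /C1 [leRHS]mulrDl; exact: lerD.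
Qed.

Lemma tube_kernel_far r x t : r <= enorm (x - g t) -> 0 <= r -> tube_kernel r x t = 0.
Proof.
move=> rx r0; rewrite /tube_kernel ler0_sqrtr ?mul0r// subr_le0.
by rewrite ler_pXn2r ?nnegrE// enorm_ge0.
Qed.

End kernels.

(** * Volume of thin tubes *)

Section tauberian.
Context d (T : measurableType d) {R : realType} (mu : {measure set T -> \bar R}).
Variable D : T -> R.
Hypothesis mD : measurable_fun setT D.
Hypothesis D_ge0 : forall p, 0 <= D p.

Definition tubular (r : R) : set T := [set p | D p < r].

Lemma measurable_tubular r : measurable (tubular r).
Proof.
have := mD measurableT (measurable_itv `]-oo, r[); rewrite setTI; congr measurable.
Qed.

Lemma indic_tubular s p : \1_(tubular s) p = (D p < s)%R%:R :> R.
Proof. by rewrite indicE; congr (_%:R); congr nat_of_bool; apply/idP/idP; rewrite inE. Qed.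

Lemma integral_cst_indic (k : R) (A : set T) : 0 <= k -> measurable A ->
  (\int[mu]_p (k * \1_A p)%:E = k%:E * mu A)%E.
Proof.
move=> k0 mA; under eq_integral do rewrite EFinM.
rewrite ge0_integralZl//; first by rewrite integral_indic// setIT.
by apply/measurable_EFinP; exact: measurable_indic.
Qed.

Variables (K : R -> T -> R) (c M C r1 : R).
Hypotheses (c0 : 0 < c) (M0 : 0 < M) (C0 : 0 < C) (r10 : 0 < r1).
Hypothesis mK : forall r, measurable_fun setT (K r).
Hypothesis K_ge0 : forall r p, 0 <= K r p.
Hypothesis K_far : forall r p, 0 < r -> r <= D p -> K r p = 0.
Hypothesis K_near : forall r p, D p < r -> r <= r1 ->
  `|K r p - c * (r ^+ 2 - D p ^+ 2)| <= C * (r ^+ 2 * Num.sqrt r).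
Hypothesis K_int : forall r, 0 < r -> (\int[mu]_p (K r p)%:E = (M * r ^+ 4)%:E)%E.

Let V r := fine (mu (tubular r)).

(** Crude bound: on the tube of radius [r], the kernel of radius [2 * r] is at
    least of order [r ^+ 2]. *)
Lemma tubular_crude : exists2 r2 : R, 0 < r2 & 2 * r2 <= r1 /\ forall r, 0 < r -> r <= r2 ->
  (mu (tubular r) <= (16 * M / c * r ^+ 2)%:E)%E.
Proof.
(* For [r <= s] the error of the kernel of radius [2 * r] is at most [c * r ^ 2]. *)
pose s := Num.min (r1 / 2) ((c / (4 * C)) ^+ 2 / 2).
have s0 : 0 < s by rewrite lt_min !divr_gt0// exprn_gt0// divr_gt0// mulr_gt0.
exists s => //; split; first by rewrite mulrC -ler_pdivlMr// ge_min lexx.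
move=> r r0 rs.
have r21 : 2 * r <= r1.
  by rewrite mulrC -ler_pdivlMr//; apply: (le_trans rs); rewrite ge_min lexx.
have rC : Num.sqrt (2 * r) <= c / (4 * C).
  have cC : 0 <= c / (4 * C) by rewrite divr_ge0 ?mulr_ge0// ltW.
  rewrite -(ger0_norm cC) -sqrtr_sqr; apply: ler_wsqrtr.
  rewrite mulrC -ler_pdivlMr//; apply: (le_trans rs).
  by rewrite ge_min lexx orbT.
have low p : c * r ^+ 2 * \1_(tubular r) p <= K (2 * r) p.
  rewrite indic_tubular; case: ltP => rp; last by rewrite mulr0.
  rewrite mulr1.
  have D2 : D p < 2 * r by lra.
  have := K_near D2 r21.
  have p2 : D p ^+ 2 <= r ^+ 2 by rewrite ler_pXn2r ?nnegrE// ltW.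
  have : c * D p ^+ 2 <= c * r ^+ 2 by rewrite ler_pM2l.
  have : C * ((2 * r) ^+ 2 * Num.sqrt (2 * r)) <= C * ((2 * r) ^+ 2 * (c / (4 * C))).
    by rewrite ler_pM2l// ler_pM2l// exprn_gt0// mulr_gt0.
  have -> : C * ((2 * r) ^+ 2 * (c / (4 * C))) = c * r ^+ 2.
    by field; rewrite gt_eqF.
  have : 0 <= c * r ^+ 2 by rewrite mulr_ge0 ?sqr_ge0// ltW.
  rewrite ler_norml => ? ? ? /andP[+ _]; lra.
have cr0 : 0 < c * r ^+ 2 by rewrite mulr_gt0// exprn_gt0.
have : ((c * r ^+ 2)%:E * mu (tubular r) <= (M * (2 * r) ^+ 4)%:E)%E.
  rewrite -(integral_cst_indic (ltW cr0) (measurable_tubular r)) -K_int ?mulr_gt0//.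
  apply: ge0_le_integral => //.
  - by move=> p _; rewrite lee_fin mulr_ge0// ltW.
  - apply/measurable_EFinP; apply: measurable_funM => //; apply: measurable_indic.
    exact: measurable_tubular.
  - exact/measurable_EFinP.
  - by move=> p _; rewrite lee_fin.
rewrite muleC -lee_pdivlMr// -EFinM => /le_trans; apply; rewrite lee_fin.
by rewrite le_eqVlt; apply/orP; left; apply/eqP; field; rewrite !gt_eqF.
Qed.

(** The difference [K (l * r) - K r] is close to [c * (l ^ 2 - 1) * r ^ 2] on the
    tube of radius [r], at most that between the two tubes, and [0] outside the
    larger one. Its integral is known, so it bounds one volume from above and the
    other from below. *)
Lemma tubular_quotients : exists r2 N : R, [/\ 0 < r2, 0 < N & forall r l, 0 < r ->
  1 < l -> l <= 2 -> l * r <= r2 ->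
  [/\ mu (tubular (l * r)) \is a fin_num, mu (tubular r) \is a fin_num,
      c * (l ^+ 2 - 1) * r ^+ 2 * V r
        <= M * (l ^+ 4 - 1) * r ^+ 4 + N * (r ^+ 4 * Num.sqrt r) &
      M * (l ^+ 4 - 1) * r ^+ 4
        <= c * (l ^+ 2 - 1) * r ^+ 2 * V (l * r) + N * (r ^+ 4 * Num.sqrt r)]].
Proof.
have [r2 r20 [r21 crude]] := tubular_crude.
pose N := 2 * (C * 8) * (16 * M / c * 4).
exists r2, N; split => //.
  by rewrite /N !(mulr_gt0, divr_gt0)// invr_gt0.
move=> r l r0 l1 l2 lr2.
have l0 : 0 < l by lra.
have lr0 : 0 < l * r by rewrite mulr_gt0.
have rlr : r <= l * r by rewrite ler_peMl ?ltW.
have rr2 : r <= r2 by exact: le_trans lr2.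
have lr1 : l * r <= r1 by lra.
have rr1 : r <= r1 by lra.
have fin_ s : 0 < s -> s <= r2 -> mu (tubular s) \is a fin_num.
  move=> s0 sr; rewrite ge0_fin_numE ?measure_ge0//.
  by apply: (le_lt_trans (crude s s0 sr)); rewrite ltry.
have fr := fin_ r r0 rr2; have flr := fin_ _ lr0 lr2.
set E := C * ((l * r) ^+ 2 * Num.sqrt (l * r)).
have E0 : 0 <= E by rewrite mulr_ge0 ?mulr_ge0 ?sqr_ge0 ?sqrtr_ge0// ltW.
have Er : C * (r ^+ 2 * Num.sqrt r) <= E.
  rewrite ler_pM2l//; apply: ler_pM; rewrite ?sqr_ge0 ?sqrtr_ge0//.
    by rewrite ler_pXn2r ?nnegrE// ltW.
  exact: ler_wsqrtr.
have l21 : 0 < l ^+ 2 - 1.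
  by rewrite subr_gt0 -[X in X < _](expr1n _ 2) ltr_pXn2r ?nnegrE// ltW.
have k0 : 0 <= c * (l ^+ 2 - 1) * r ^+ 2.
  by rewrite !mulr_ge0 ?sqr_ge0// ltW.
have EN : 2 * E * V (l * r) <= N * (r ^+ 4 * Num.sqrt r).
  have V_le : V (l * r) <= 16 * M / c * 4 * r ^+ 2.
    have : V (l * r) <= 16 * M / c * (l * r) ^+ 2.
      by rewrite -lee_fin fineK//; exact: crude.
    move/le_trans; apply; rewrite -[leRHS]mulrA ler_pM2l; last first.
      by rewrite divr_gt0// mulr_gt0.
    have -> : 4 * r ^+ 2 = (2 * r) ^+ 2 by ring.
    by rewrite ler_pXn2r ?nnegrE ?mulr_ge0 ?(ltW l0) ?(ltW r0)// ler_pM2r.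
  have E_le : E <= C * 8 * (r ^+ 2 * Num.sqrt r).
    rewrite /E -[leRHS]mulrA ler_pM2l//.
    have -> : 8 * (r ^+ 2 * Num.sqrt r) = (2 * r) ^+ 2 * (2 * Num.sqrt r) by ring.
    apply: ler_pM; rewrite ?sqr_ge0 ?sqrtr_ge0//.
      by rewrite ler_pXn2r ?nnegrE ?mulr_ge0 ?(ltW l0) ?(ltW r0)// ler_pM2r.
    rewrite sqrtrM ?(ltW l0)//; apply: ler_wpM2r; first exact: sqrtr_ge0.
    rewrite -(@ler_pXn2r _ 2)// ?nnegrE ?sqrtr_ge0// sqr_sqrtr ?(ltW l0)//; lra.
  have -> : N * (r ^+ 4 * Num.sqrt r) =
      2 * (C * 8 * (r ^+ 2 * Num.sqrt r)) * (16 * M / c * 4 * r ^+ 2) by rewrite /N; ring.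
  by apply: ler_pM; [rewrite mulr_ge0|apply: fine_ge0; exact: measure_ge0|rewrite ler_pM2l|].
have mI (k s : R) : measurable_fun setT (fun p => k * \1_(tubular s) p : R).
  by apply: measurable_funM => //; apply: measurable_indic; exact: measurable_tubular.
have cmp (k k' s s' q q' : R) : 0 <= k -> 0 <= k' -> 0 < s -> 0 < s' -> 
    mu (tubular q) \is a fin_num -> mu (tubular q') \is a fin_num ->
    (forall p, k * \1_(tubular q) p + K s p <= k' * \1_(tubular q') p + K s' p) ->
    k * V q + M * s ^+ 4 <= k' * V q' + M * s' ^+ 4.
  move=> k_ge0 k'0 s0 s'0 fq fq' le_p.
  have tot (k1 s1 q1 : R) : 0 <= k1 -> 0 < s1 -> mu (tubular q1) \is a fin_num ->
      (\int[mu]_p (k1 * \1_(tubular q1) p + K s1 p)%:E = (k1 * V q1 + M * s1 ^+ 4)%:E)%E.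
    move=> k10 s10 fq1; under eq_integral do rewrite EFinD.
    rewrite ge0_integralD//; last 4 first.
    - by move=> p _; rewrite lee_fin mulr_ge0.
    - exact/measurable_EFinP.
    - by move=> p _; rewrite lee_fin.
    - exact/measurable_EFinP.
    rewrite integral_cst_indic//; last exact: measurable_tubular.
    by rewrite -[mu _](fineK fq1) -EFinM K_int.
  rewrite -lee_fin -!tot//; apply: ge0_le_integral => //.
  - by move=> p _; rewrite lee_fin addr_ge0// mulr_ge0.
  - by apply/measurable_EFinP; exact: measurable_funD.
  - by apply/measurable_EFinP; exact: measurable_funD.
  - by move=> p _; rewrite lee_fin.
split => //.
- have := cmp (c * (l ^+ 2 - 1) * r ^+ 2) (2 * E) r (l * r) r (l * r) k0.
  rewrite (mulr_ge0 _ E0)// => /(_ isT r0 lr0 fr flr) => H.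
  have : c * (l ^+ 2 - 1) * r ^+ 2 * V r + M * r ^+ 4 <= 2 * E * V (l * r) + M * (l * r) ^+ 4.
    apply: H => p; rewrite !indic_tubular; case: (ltP (D p) r) => Dr.
      rewrite (lt_le_trans Dr rlr) !mulr1.
      have := K_near Dr rr1; have := K_near (lt_le_trans Dr rlr) lr1.
      rewrite -/E !ler_norml => /andP[+ _] /andP[_ +]; lra.
    rewrite mulr0 add0r (K_far r0 Dr).
    by apply: addr_ge0 => //; apply: mulr_ge0; [exact: mulr_ge0|exact: ler0n].
  have -> : (l * r) ^+ 4 = l ^+ 4 * r ^+ 4 by rewrite exprMn.
  lra.
- have := cmp 0 (c * (l ^+ 2 - 1) * r ^+ 2 + 2 * E) (l * r) r (l * r) (l * r) (lexx _).
  rewrite addr_ge0 ?(mulr_ge0 _ E0)// => /(_ isT lr0 r0 flr flr) => H.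
  have : 0 * V (l * r) + M * (l * r) ^+ 4 <=
      (c * (l ^+ 2 - 1) * r ^+ 2 + 2 * E) * V (l * r) + M * r ^+ 4.
    apply: H => p; rewrite !indic_tubular mul0r add0r; case: (ltP (D p) (l * r)) => Dlr; last first.
      by rewrite mulr0 add0r K_far.
    rewrite mulr1; have := K_near Dlr lr1; rewrite -/E ler_norml => /andP[_].
    have [Dr|rD] := ltP (D p) r.
      have := K_near Dr rr1; rewrite ler_norml => /andP[+ _]; lra.
    rewrite (K_far r0 rD) addr0.
    have : r ^+ 2 <= D p ^+ 2 by rewrite ler_pXn2r ?nnegrE// ltW.
    by rewrite -(ler_pM2l c0); lra.
  have -> : (l * r) ^+ 4 = l ^+ 4 * r ^+ 4 by rewrite exprMn.
  lra.
Qed.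

(** The measure of thin tubes. As in Tauberian theorems, the monotonicity of the
    measure allows one to differentiate the known integral; the step
    [l - 1 = r ^ (1/4)] balances the two errors. *)
Lemma tubular_measure : exists r2 N : R, [/\ 0 < r2, 0 < N & forall r, 0 < r -> r <= r2 ->
  mu (tubular r) \is a fin_num /\
  `|V r - 2 * M / c * r ^+ 2| <= N * (r ^+ 2 * Num.sqrt (Num.sqrt r))].
Proof.
have [r2 [N [r20 N0 quot]]] := tubular_quotients.
pose s := Num.min 1 (r2 / 2).
have s0 : 0 < s by rewrite lt_min ltr01 divr_gt0.
exists s, (3 * M / c + 16 * N / c); split => //.
  by rewrite addr_gt0// divr_gt0// mulr_gt0.
move=> r r0 rs; set q := Num.sqrt (Num.sqrt r).
have r_le1 : r <= 1 by apply: (le_trans rs); rewrite ge_min lexx.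
have rr2 : r <= r2 / 2 by apply: (le_trans rs); rewrite ge_min lexx orbT.
have q0 : 0 < q by rewrite !sqrtr_gt0.
have sq1 : Num.sqrt r <= 1 by rewrite -[leRHS]sqrtr1; exact: ler_wsqrtr.
have q1 : q <= 1 by rewrite -[leRHS]sqrtr1; exact: ler_wsqrtr.
have q2 : q ^+ 2 = Num.sqrt r by rewrite sqr_sqrtr ?sqrtr_ge0.
pose l := 1 + q.
have l1 : 1 < l by rewrite /l; lra.
have l2 : l <= 2 by rewrite /l; lra.
have l0 : 0 < l by lra.
have lr2 : l * r <= r2.
  by apply: (@le_trans _ _ (2 * r)); [rewrite ler_pM2r|lra].
have [flr fr up _] := quot r l r0 l1 l2 lr2.
split => //.
have lE : l ^+ 2 - 1 = q * (2 + q) by rewrite /l; ring.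
have rp0 : 0 < r ^+ 2 by rewrite exprn_gt0.
have upper : V r <= 2 * M / c * r ^+ 2 + (3 * M / c + 16 * N / c) * (r ^+ 2 * q).
  have k0 : 0 < c * (l ^+ 2 - 1) * r ^+ 2.
    by rewrite lE !mulr_gt0// addr_gt0.
  rewrite -(ler_pM2l k0); apply: (le_trans up).
  rewrite lE -q2.
  have -> : l ^+ 4 - 1 = q * (2 + q) * (l ^+ 2 + 1) by rewrite /l; ring.
  have -> : c * (q * (2 + q)) * r ^+ 2 * (2 * M / c * r ^+ 2 + (3 * M / c + 16 * N / c) * (r ^+ 2 * q))
    = M * (q * (2 + q)) * r ^+ 4 * (2 + 3 * q) + 16 * N * (q ^+ 2 * (2 + q) * r ^+ 4).
    by field; rewrite gt_eqF.
  apply: lerD.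
    have -> : M * (q * (2 + q) * (l ^+ 2 + 1)) * r ^+ 4 = M * (q * (2 + q)) * r ^+ 4 * (l ^+ 2 + 1) by ring.
    apply: ler_wpM2l.
      by rewrite !mulr_ge0 ?exprn_ge0 ?addr_ge0 ?(ltW M0) ?(ltW q0) ?(ltW r0).
    have : q ^+ 2 <= q by rewrite expr2 ler_piMl// ltW.
    rewrite /l; lra.
  have P0 : 0 <= N * (q ^+ 2 * r ^+ 4).
    by rewrite !mulr_ge0 ?exprn_ge0 ?(ltW N0) ?(ltW r0) ?(ltW q0).
  have P1 : 0 <= N * (q ^+ 2 * r ^+ 4) * q by rewrite mulr_ge0// ltW.
  by lra.
have lower : 2 * M / c * r ^+ 2 - (3 * M / c + 16 * N / c) * (r ^+ 2 * q) <= V r.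
  pose r' := r / l.
  have r'0 : 0 < r' by rewrite divr_gt0.
  have lr' : l * r' = r by rewrite /r' mulrC divfK// gt_eqF.
  clearbody r'.
  have [] := quot r' l r'0 l1 l2; first by rewrite lr'; lra.
  rewrite lr' => _ _ _ low.
  have r'r : r' <= r by rewrite -lr' ler_peMl ?ltW.
  have sr' : Num.sqrt r' <= q ^+ 2 by rewrite q2; exact: ler_wsqrtr.
  have r'p : 0 < r' ^+ 2 by rewrite exprn_gt0.
  have k0 : 0 < c * (l ^+ 2 - 1) * r' ^+ 2.
    by rewrite lE mulr_gt0// mulr_gt0// mulr_gt0// addr_gt0.
  rewrite -(ler_pM2l k0).
  have low2 : M * (l ^+ 4 - 1) * r' ^+ 4 - N * (r' ^+ 4 * q ^+ 2) <=
      c * (l ^+ 2 - 1) * r' ^+ 2 * V r.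
    have : N * (r' ^+ 4 * Num.sqrt r') <= N * (r' ^+ 4 * q ^+ 2).
      by rewrite ler_pM2l// ler_pM2l// exprn_gt0.
    lra.
  apply: le_trans low2.
  rewrite lE.
  have -> : l ^+ 4 - 1 = q * (2 + q) * (l ^+ 2 + 1) by rewrite /l; ring.
  have -> : r ^+ 2 = l ^+ 2 * r' ^+ 2 by rewrite -lr' exprMn.
  have -> : c * (q * (2 + q)) * r' ^+ 2 * (2 * M / c * (l ^+ 2 * r' ^+ 2) -
      (3 * M / c + 16 * N / c) * (l ^+ 2 * r' ^+ 2 * q)) =
    q * (2 + q) * r' ^+ 4 * (M * (l ^+ 2 * (2 - 3 * q))) - 16 * N * (q ^+ 2 * (2 + q) * l ^+ 2 * r' ^+ 4).
    by field; rewrite gt_eqF.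
  apply: lerB.
    have -> : M * (q * (2 + q) * (l ^+ 2 + 1)) * r' ^+ 4 = q * (2 + q) * r' ^+ 4 * (M * (l ^+ 2 + 1)) by ring.
    apply: ler_wpM2l.
      by rewrite !mulr_ge0 ?exprn_ge0 ?addr_ge0 ?(ltW q0) ?(ltW r'0).
    rewrite ler_pM2l// /l.
    have : 0 <= q ^+ 2 by exact: sqr_ge0.
    have : 0 <= q ^+ 3 by rewrite exprn_ge0// ltW.
    by lra.
  have -> : 16 * N * (q ^+ 2 * (2 + q) * l ^+ 2 * r' ^+ 4) =
    N * (r' ^+ 4 * q ^+ 2) * (16 * (2 + q) * l ^+ 2) by ring.
  apply: ler_peMr; first by rewrite !mulr_ge0 ?exprn_ge0 ?(ltW N0) ?(ltW r'0) ?(ltW q0).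
  have : 1 <= l ^+ 2 by rewrite -subr_ge0 lE mulr_ge0 ?addr_ge0// ltW.
  nra.
by rewrite ler_norml; apply/andP; split; lra.
Qed.

End tauberian.

(** * The inverse square of the distance on shells *)

Section measurable_inverse.
Context {R : realType}.

Lemma measurable_inv_real : measurable_fun setT (fun x : R => x^-1).
Proof.
have inv_on (A : set R) : open A -> ~ A 0 -> measurable_fun A (fun x : R => x^-1).
  move=> oA A0; apply: open_continuous_measurable_fun => // x /set_mem Ax.
  by apply: inv_continuous; apply/eqP => x0; apply: A0; rewrite -x0.
have -> : [set: R] = `]-oo, 0[%classic `|` ([set 0] `|` `]0, +oo[%classic).
  apply/seteqP; split => // x _ /=; rewrite !in_itv/= andbT.
  by have [x0|x0|->] := ltgtP x 0; [left|right; right|right; left].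
apply/measurable_funU => //; first by apply: measurableU => //; exact: measurable_itv.
split; first by apply: inv_on; [exact: interval_open|rewrite /= in_itv/= ltxx].
apply/measurable_funU => //; split; first exact: measurable_fun_set1.
by apply: inv_on; [exact: interval_open|rewrite /= in_itv/= ltxx].
Qed.

Lemma measurable_inv d (T : measurableType d) (f : T -> R) :
  measurable_fun setT f -> measurable_fun setT (fun x => (f x)^-1).
Proof. by move=> mf; exact: (measurableT_comp measurable_inv_real mf). Qed.

End measurable_inverse.

Section shell.
Context d (T : measurableType d) {R : realType} (mu : {sigma_finite_measure set T -> \bar R}).
Variable D : T -> R.
Hypothesis mD : measurable_fun setT D.
Hypothesis D_ge0 : forall p, 0 <= D p.
Local Notation leb := (@lebesgue_measure R).
Local Notation tubular := (tubular D).

Definition shell (e e' : R) : set T := [set p | e <= D p < e'].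

Lemma measurable_shell e e' : measurable (shell e e').
Proof.
have := mD measurableT (measurable_itv `[e, e'[); rewrite setTI; congr measurable.
Qed.

Lemma measurable_subgraph : measurable [set z : T * measurableTypeR R | D z.1 < z.2].
Proof.
have := measurable_fun_ltr (measurableT_comp mD (@measurable_fst _ _ T (measurableTypeR R)))
  (@measurable_snd _ _ T (measurableTypeR R)).
by move=> /(_ measurableT [set true]); rewrite setTI; exact.
Qed.

Lemma indic_subgraph (p : T) (r : R) :
  \1_[set z : T * R | D z.1 < z.2] (p, r) = (D p < r)%R%:R :> R.
Proof. by rewrite indicE; congr (_%:R); congr nat_of_bool; apply/idP/idP; rewrite inE. Qed.

(** The inverse square of the distance, truncated at radius [e] and shifted so as
    to vanish at radius [e']; this makes it an integral of [2 / r ^ 3]. *)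
Let h e e' (p : T) : R := if D p < e' then (Num.max (D p) e ^+ 2)^-1 - (e' ^+ 2)^-1 else 0.

Lemma inverse_square_primitive (m e' : R) : 0 < m -> m < e' ->
  (\int[leb]_(r in `]m, e'[) (2 / r ^+ 3)%:E = ((m ^+ 2)^-1 - (e' ^+ 2)^-1)%:E)%E.
Proof.
move=> m0 me'.
have inv3 : measurable_fun setT (fun r : R => (2 / r ^+ 3)%:E).
  apply/measurable_EFinP; apply: measurable_funM => //.
  by apply: measurable_inv; exact: exprn_measurable.
rewrite integral_itv_obnd_cbnd; last exact: measurable_funTS.
rewrite integral_itv_bndo_bndc; last exact: measurable_funTS.
have dF (x : R) : m <= x -> is_derive x 1 (fun x : R => - (x ^+ 2)^-1) (2 / x ^+ 3).
  move=> mx; have x0 : x != 0 by rewrite gt_eqF// (lt_le_trans m0).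
  have dX : is_derive x 1 (fun x : R => x ^+ 2) (2 * x).
    by apply: is_derive_eq; rewrite /GRing.scale/=; ring.
  have x2 : x ^+ 2 != 0 by rewrite expf_neq0.
  have dV := @is_deriveV _ (fun x : R => x ^+ 2) x _ _ x2 dX.
  apply: (is_derive_eq (is_deriveN dV)).
  by rewrite /GRing.scale/=; field.
have cF x : m <= x -> continuous_at x (fun x : R => - (x ^+ 2)^-1).
  by move=> mx; apply: differentiable_continuous; apply/derivable1_diffP; have [] := dF x mx.
rewrite (@continuous_FTC2 _ _ (fun x : R => - (x ^+ 2)^-1) m e')//.
- by rewrite -EFinB; congr EFin; ring.
- apply: continuous_in_subspaceT => x /set_mem; rewrite /= in_itv/= => /andP[mx _].
  apply: cvgM; first exact: cvg_cst.
  apply: cvgV; first by rewrite expf_neq0// gt_eqF// (lt_le_trans m0).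
  exact: exprn_continuous.
- split.
  + by move=> x; rewrite in_itv/= => /andP[mx _]; have [] := dF x (ltW mx).
  + by apply: cvg_at_right_filter; exact: cF.
  + by apply: cvg_at_left_filter; apply: cF; exact: ltW.
- move=> x; rewrite in_itv/= => /andP[mx _].
  by rewrite derive1E; have := dF x (ltW mx) => dFx; rewrite derive_val.
Qed.

(** Layer cake: [h e e' p] is the integral of [2 / r ^ 3] over the radii between
    [e] and [e'] whose tube contains [p]. *)
Lemma layer_cake (e e' : R) : 0 < e -> e < e' ->
  (\int[mu]_p (h e e' p)%:E =
   \int[leb]_(r in `]e, e'[) ((2 / r ^+ 3)%:E * mu (tubular r)))%E.
Proof.
move=> e0 ee'.
pose H (z : T * measurableTypeR R) : \bar R :=
  (2 / z.2 ^+ 3 * \1_(`]e, e'[%classic : set R) z.2 * \1_[set z : T * R | D z.1 < z.2] z)%:E.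
have mA := measurable_subgraph.
have mH : measurable_fun setT H.
  apply/measurable_EFinP; apply: measurable_funM; last exact: measurable_indic.
  apply: measurable_funM.
    have m3 : measurable_fun setT (fun r : R => 2 / r ^+ 3).
      by apply: measurable_funM => //; apply: measurable_inv; exact: exprn_measurable.
    exact: (measurableT_comp m3 (@measurable_snd _ _ T (measurableTypeR R))).
  have mI : measurable_fun setT (\1_(`]e, e'[%classic : set R) : R -> R).
    by apply: measurable_indic; exact: measurable_itv.
  exact: (measurableT_comp mI (@measurable_snd _ _ T (measurableTypeR R))).
have H0 z : (0 <= H z)%E.
  rewrite lee_fin mulr_ge0//; case: z => p r /=.
  rewrite indicE; case: (boolP (r \in _)) => [/set_mem|_]; last by rewrite mulr0.
  rewrite /= in_itv/= => /andP[er _]; rewrite mulr1 divr_ge0// exprn_ge0//.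
  exact: (le_trans (ltW e0) (ltW er)).
transitivity (\int[mu]_p \int[leb]_r H (p, r))%E.
  apply: eq_integral => p _; rewrite /h /H /=.
  case: ltP => De'; last first.
    rewrite integral0_eq// => r _; rewrite !indicE.
    case: (boolP (r \in _)) => [/set_mem|_]; last by rewrite mulr0 mul0r.
    rewrite /= in_itv/= => /andP[_ re']; rewrite memNset ?mulr0//=.
    by apply/negP; rewrite -leNgt (le_trans (ltW re')).
  have m0 : 0 < Num.max (D p) e by rewrite lt_max e0 orbT.
  have me' : Num.max (D p) e < e' by rewrite gt_max De'.
  rewrite -(inverse_square_primitive m0 me') integral_mkcond.
  apply: eq_integral => r _; rewrite patchE !indicE.
  case: ifPn => [/set_mem|/negP rI].
    rewrite /= in_itv/= gt_max => /andP[/andP[Dr er] re'].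
    by rewrite !mem_set ?mulr1//= in_itv/= er.
  case: (boolP (r \in _)) => [/set_mem|_]; last by rewrite mulr0 mul0r.
  rewrite /= in_itv/= => /andP[er re']; rewrite memNset ?mulr0//=.
  by move=> Dr; apply: rI; rewrite inE/= in_itv/= gt_max Dr er.
rewrite (fubini_tonelli H)// [RHS]integral_mkcond.
apply: eq_integral => r _; rewrite patchE /H /=.
have mr := measurable_tubular mD r.
transitivity (\int[mu]_p ((2 / r ^+ 3 * \1_(`]e, e'[%classic : set R) r) * \1_(tubular r) p)%:E)%E.
  apply: eq_integral => p _; by rewrite indic_tubular indic_subgraph.
rewrite indicE; case: ifPn => [/set_mem rI|_].
  rewrite mulr1 integral_cst_indic//.
  by move: rI; rewrite /= in_itv/= => /andP[er _]; rewrite divr_ge0// exprn_ge0// ltW// (lt_trans e0).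
by rewrite mulr0 integral0_eq// => p _; rewrite mul0r.
Qed.

Variables (A N r2 : R).
Hypotheses (A0 : 0 < A) (N0 : 0 < N) (r20 : 0 < r2).
Hypothesis V_asym : forall r, 0 < r -> r <= r2 ->
  mu (tubular r) \is a fin_num /\
  `|fine (mu (tubular r)) - A * r ^+ 2| <= N * (r ^+ 2 * Num.sqrt (Num.sqrt r)).

Let V r := fine (mu (tubular r)).
Let q (r : R) := Num.sqrt (Num.sqrt r).

Let q_le r s : r <= s -> q r <= q s.
Proof. by move=> rs; do 2 apply: ler_wsqrtr. Qed.

(** With volume [A * r ^ 2], the layer-cake integral is that of [2 * A / r]. The
    truncation and the shift of [h] add the terms [V e / e ^ 2] and
    [V e' / e' ^ 2], which are both close to [A] and come with opposite signs. *)
Lemma inverse_square_shell : exists r3 N' : R, [/\ 0 < r3, r3 <= r2, 0 < N' & forall e e',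
  0 < e -> e < e' -> e' <= 2 * e -> e' <= r3 ->
  mu.-integrable (shell e e') (EFin \o (fun p => (D p ^+ 2)^-1)) /\
  `|\int[mu]_(p in shell e e') (D p ^+ 2)^-1 - 2 * A * ln (e' / e)| <= N' * q e'].
Proof.
(* The bound by [(A / N) ^+ 4] makes the lower bound of the volume nonnegative. *)
pose r3 := Num.min r2 ((A / N) ^+ 4).
exists r3, (4 * N); split.
- by rewrite lt_min r20 exprn_gt0// divr_gt0.
- by rewrite ge_min lexx.
- by rewrite mulr_gt0.
move=> e e' e0 ee' e'2 e'r3.
have e'0 : 0 < e' by exact: lt_trans ee'.
have e'r2 : e' <= r2 by apply: (le_trans e'r3); rewrite ge_min lexx.
have er2 : e <= r2 by exact: le_trans (ltW ee') _.
have q0 : 0 <= q e' by exact: sqrtr_ge0.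
pose dl := N * q e'.
have dA : dl <= A.
  rewrite /dl mulrC -ler_pdivlMr//.
  have AN : 0 <= A / N by rewrite divr_ge0// ltW.
  have -> : A / N = q ((A / N) ^+ 4).
    rewrite /q (_ : (A / N) ^+ 4 = ((A / N) ^+ 2) ^+ 2); last by rewrite -exprM.
    by rewrite sqrtr_sqr ger0_norm ?sqr_ge0// sqrtr_sqr ger0_norm.
  by apply: q_le; apply: (le_trans e'r3); rewrite ge_min lexx orbT.
have dl0 : 0 <= dl by rewrite mulr_ge0// ltW.
have Vr r : 0 < r -> r <= e' -> (A - dl) * r ^+ 2 <= V r <= (A + dl) * r ^+ 2.
  move=> r0 re'; have [_] := V_asym r0 (le_trans re' e'r2); rewrite -/(V r) -/(q r).
  have : N * (r ^+ 2 * q r) <= dl * r ^+ 2.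
    rewrite /dl -[leRHS]mulrA ler_pM2l// (mulrC (q e')); apply: ler_wpM2l; first exact: sqr_ge0.
    exact: q_le.
  rewrite ler_norml => ? /andP[? ?]; apply/andP; split; lra.
have fV r : 0 < r -> r <= e' -> mu (tubular r) \is a fin_num.
  by move=> r0 re'; have [] := V_asym r0 (le_trans re' e'r2).
set lam := ln (e' / e).
have mpoly k : measurable_fun setT (fun r : R => (2 / r ^+ 3 * (k * r ^+ 2))%:E).
  apply/measurable_EFinP; apply: measurable_funM.
    by apply: measurable_funM => //; apply: measurable_inv; exact: exprn_measurable.
  by apply: measurable_funM => //; exact: exprn_measurable.
have lamI k : 0 <= k -> (\int[leb]_(r in `]e, e'[) ((2 / r ^+ 3) * (k * r ^+ 2))%:E = (2 * k * lam)%:E)%E.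
  move=> k0.
  have lnD (x : R) : e <= x -> is_derive x 1 (fun x : R => 2 * k * ln x) (2 / x ^+ 3 * (k * x ^+ 2)).
    move=> ex; have x0 : 0 < x by exact: lt_le_trans ex.
    have dln := is_derive1_ln x0.
    apply: (is_derive_eq (is_deriveZ (2 * k) dln)).
    by rewrite /GRing.scale/=; field; rewrite gt_eqF.
  have cln x : e <= x -> continuous_at x (fun x : R => 2 * k * ln x).
    by move=> ex; apply: differentiable_continuous; apply/derivable1_diffP; have [] := lnD x ex.
  rewrite integral_itv_obnd_cbnd; last exact: measurable_funTS (mpoly k).
  rewrite integral_itv_bndo_bndc; last exact: measurable_funTS (mpoly k).
  rewrite (@continuous_FTC2 _ _ (fun x : R => 2 * k * ln x) e e')//.
  - by rewrite -EFinB -mulrBr /lam ln_div ?posrE.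
  - apply: continuous_in_subspaceT => x /set_mem; rewrite /= in_itv/= => /andP[ex _].
    have x0 : x != 0 by rewrite gt_eqF// (lt_le_trans e0).
    apply: cvgM.
      by apply: cvgM; [exact: cvg_cst|apply: cvgV; [rewrite expf_neq0|exact: exprn_continuous]].
    by apply: cvgM; [exact: cvg_cst|exact: exprn_continuous].
  - split.
    + by move=> x; rewrite in_itv/= => /andP[ex _]; have [] := lnD x (ltW ex).
    + by apply: cvg_at_right_filter; exact: cln.
    + by apply: cvg_at_left_filter; apply: cln; exact: ltW.
  - move=> x; rewrite in_itv/= => /andP[ex _].
    by rewrite derive1E; have := lnD x (ltW ex) => dFx; rewrite derive_val.
have mphi : measurable_fun setT (fun r : R => (2 / r ^+ 3)%:E).
  apply/measurable_EFinP; apply: measurable_funM => //.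
  by apply: measurable_inv; exact: exprn_measurable.
have mmu : measurable_fun `]e, e'[ (fun r : R => ((2 / r ^+ 3)%:E * mu (tubular r))%E).
  apply: measurable_funTS; apply: emeasurable_funM => //.
  have mA := measurable_subgraph.
  have -> : (fun r : R => mu (tubular r)) =
      fubini_G mu (fun z : T * measurableTypeR R => (\1_[set z : T * R | D z.1 < z.2] z)%:E).
    apply/funext => r; rewrite /fubini_G.
    transitivity (\int[mu]_p (\1_(tubular r) p)%:E)%E.
      by rewrite integral_indic ?setIT//; exact: measurable_tubular.
    apply: eq_integral => p _; by rewrite indic_tubular indic_subgraph.
  apply: measurable_fun_fubini_tonelli_G => [|z]; last by rewrite lee_fin.
  by apply/measurable_EFinP; exact: measurable_indic.
have X_bounds : ((2 * (A - dl) * lam)%:E <= \int[mu]_p (h e e' p)%:E <= (2 * (A + dl) * lam)%:E)%E.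
  rewrite layer_cake// -!lamI ?subr_ge0 ?addr_ge0// ?(ltW A0)//.
  have mpolyS k : measurable_fun `]e, e'[ (fun r : R => (2 / r ^+ 3 * (k * r ^+ 2))%:E).
    exact: measurable_funTS (mpoly k).
  have phi0 (r : R) : e < r -> 0 <= 2 / r ^+ 3.
    by move=> er; rewrite divr_ge0// exprn_ge0// ltW// (lt_trans e0).
  apply/andP; split; apply: ge0_le_integral => //.
  - move=> r; rewrite /= in_itv/= => /andP[er _]; rewrite lee_fin mulr_ge0 ?phi0// mulr_ge0 ?sqr_ge0//.
    by rewrite subr_ge0.
  - exact: mpolyS.
  - move=> r; rewrite /= in_itv/= => /andP[er re']; have r0 := lt_trans e0 er.
    rewrite EFinM; apply: lee_wpmul2l; first by rewrite lee_fin phi0.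
    rewrite -(fineK (fV r r0 (ltW re'))) lee_fin.
    by have /andP[] := Vr r r0 (ltW re').
  - by move=> r; rewrite /= in_itv/= => /andP[er _]; rewrite mule_ge0// lee_fin phi0.
  - exact: mpolyS.
  - move=> r; rewrite /= in_itv/= => /andP[er re']; have r0 := lt_trans e0 er.
    rewrite [leRHS]EFinM; apply: lee_wpmul2l; first by rewrite lee_fin phi0.
    rewrite -(fineK (fV r r0 (ltW re'))) lee_fin.
    by have /andP[] := Vr r r0 (ltW re').
have mD2 : measurable_fun setT (fun p => (D p ^+ 2)^-1).
  by apply: measurable_inv; exact: measurable_funX.
have mtub r := measurable_tubular mD r.
have msh := measurable_shell e e'.
have mh : measurable_fun setT (h e e').
  apply: measurable_fun_ifT.
  - exact: measurable_fun_ltr.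
  - apply: measurable_funB => //; apply: measurable_inv; apply: measurable_funX.
    exact: measurable_maxr.
  - exact: measurable_cst.
have h0 p : 0 <= h e e' p.
  rewrite /h; case: (ltP (D p) e') => // De'.
  rewrite subr_ge0 lef_pV2 ?posrE ?exprn_gt0// ?lt_max ?e0 ?orbT//.
  by rewrite ler_pXn2r ?nnegrE ?le_max ?D_ge0 ?(ltW e'0)// ge_max !ltW.
have inv0 (r : R) : 0 < r -> 0 <= (r ^+ 2)^-1 by move=> r0; rewrite invr_ge0 exprn_ge0// ltW.
set s : \bar R := (\int[mu]_(p in shell e e') ((D p ^+ 2)^-1)%:E)%E.
have balance : ((\int[mu]_p (h e e' p)%:E) + ((e' ^+ 2)^-1)%:E * mu (tubular e') =
    s + ((e ^+ 2)^-1)%:E * mu (tubular e))%E.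
  have msD : measurable_fun setT (((fun p => ((D p ^+ 2)^-1)%:E) \_ (shell e e')) : T -> \bar R).
    apply/(measurable_restrictT _ _).1 => //; apply: measurable_funTS.
    exact/measurable_EFinP.
  rewrite /s [in RHS]integral_mkcond -!integral_cst_indic ?inv0//.
  have mI r k : measurable_fun setT (fun p => (k * \1_(tubular r) p : R)%:E).
    by apply/measurable_EFinP; apply: measurable_funM => //; exact: measurable_indic.
  rewrite -!ge0_integralD//; last 5 first.
  - move=> p _; rewrite patchE; case: ifP => // _.
    by rewrite lee_fin invr_ge0 sqr_ge0.
  - by move=> p _; rewrite lee_fin mulr_ge0 ?inv0.
  - by move=> p _; rewrite lee_fin.
  - exact/measurable_EFinP.
  - by move=> p _; rewrite lee_fin mulr_ge0 ?inv0.
  apply: eq_integral => p _; rewrite patchE !indic_tubular /h -EFinD.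
  have [De'|e'D] := ltP (D p) e'; last first.
    rewrite memNset ?ltNge ?(ltW (lt_le_trans ee' e'D)) ?mulr0 ?add0e ?addr0//.
    by rewrite /shell/= => /andP[_]; rewrite ltNge e'D.
  have [De|eD] := ltP (D p) e.
    rewrite memNset; last by rewrite /shell/= => /andP[]; rewrite leNgt De.
    by rewrite add0e !mulr1 subrK.
  rewrite mem_set; last by rewrite /shell/= eD.
  by rewrite -EFinD mulr1 mulr0 addr0 subrK.
have s0 : (0 <= s)%E by apply: integral_ge0 => p _; rewrite lee_fin invr_ge0 sqr_ge0.
have fX : (\int[mu]_p (h e e' p)%:E)%E \is a fin_num.
  rewrite ge0_fin_numE; last by apply: integral_ge0 => p _; rewrite lee_fin.
  by case/andP: X_bounds => _ /le_lt_trans; apply; rewrite ltry.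
have fs : s \is a fin_num.
  rewrite ge0_fin_numE//; apply: (@le_lt_trans _ _ (s + ((e ^+ 2)^-1)%:E * mu (tubular e))%E).
    by apply: leeDl; rewrite mule_ge0 ?lee_fin ?inv0.
  by rewrite -balance -(fineK fX) -(fineK (fV e' e'0 (lexx _))) -EFinM -EFinD ltry.
split.
  apply/integrableP; split; first by apply/measurable_EFinP; exact: measurable_funTS.
  under eq_integral do rewrite /= ger0_norm ?invr_ge0 ?sqr_ge0//.
  by rewrite -ge0_fin_numE.
rewrite /Rintegral -/s.
have sE : fine s = fine (\int[mu]_p (h e e' p)%:E) + (e' ^+ 2)^-1 * V e' - (e ^+ 2)^-1 * V e.
  move: balance; rewrite -(fineK fX) -(fineK fs) -(fineK (fV e' e'0 (lexx _))).
  rewrite -(fineK (fV e e0 (ltW ee'))) -!EFinM -!EFinD => -[]; rewrite -/(V e') -/(V e); lra.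
have ratio r : 0 < r -> r <= e' -> A - dl <= (r ^+ 2)^-1 * V r <= A + dl.
  move=> r0 re'; have /andP[lo up] := Vr r r0 re'.
  have r20' : 0 < r ^+ 2 by rewrite exprn_gt0.
  by rewrite mulrC ler_pdivlMr// ler_pdivrMr// lo.
have /andP[lo1 up1] := ratio e' e'0 (lexx _).
have /andP[lo2 up2] := ratio e e0 (ltW ee').
have lam0 : 0 <= lam by rewrite ln_ge0// ler_pdivlMr// mul1r ltW.
have lam1 : lam <= 1.
  apply: (@le_trans _ _ (ln (1 + 1))); last by apply: le_ln1Dx; lra.
  by rewrite ler_ln ?posrE ?divr_gt0// ler_pdivrMr.
have dlam : dl * lam <= dl by rewrite ler_piMr.
move: X_bounds; rewrite -(fineK fX) !lee_fin => /andP[lo up].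
rewrite sE (_ : 4 * N * q e' = 4 * dl); last by rewrite /dl mulrA.
clearbody dl lam; rewrite ler_norml; apply/andP; split; lra.
Qed.

End shell.

(** * Logarithmic divergence *)

Section dyadic.
Context {R : realType}.
Let q (r : R) := Num.sqrt (Num.sqrt r).

Lemma sqrt_sqrt_exp4 (x : R) : 0 <= x -> q (x ^+ 4) = x.
Proof.
move=> x0; rewrite /q (_ : x ^+ 4 = (x ^+ 2) ^+ 2); last by rewrite -exprM.
by rewrite sqrtr_sqr ger0_norm ?sqr_ge0// sqrtr_sqr ger0_norm.
Qed.

(** The fourth root decreases by the factor [k] when the radius is halved, so the
    errors between any two radii sum to at most [N / (1 - k)] times the fourth root
    of the larger one. *)
Lemma dyadic_cvg (T : R -> R) (N r0 : R) : 0 < N -> 0 < r0 ->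
  (forall e e', 0 < e -> e < e' -> e' <= 2 * e -> e' <= r0 ->
    `|T e - T e'| <= N * Num.sqrt (Num.sqrt e')) ->
  exists E : R, T e @[e --> 0^'+] --> E.
Proof.
move=> N0 r00; rewrite -/q => step.
pose k := q (2^-1).
have k0 : 0 < k by rewrite !sqrtr_gt0 invr_gt0.
have k1 : k < 1.
  have q1 : q 1 = 1 by rewrite /q !sqrtr1.
  by rewrite -[ltRHS]q1 /k /q !ltr_sqrt ?sqrtr_gt0// invf_lt1// ltr1n.
have qk r : 0 < r -> q (r / 2) = k * q r.
  by move=> r_gt0; rewrite /k /q -!sqrtrM ?invr_ge0 ?sqrtr_ge0// mulrC.
pose M := N / (1 - k).
have M0 : 0 < M by rewrite divr_gt0// subr_gt0.
have MN : M * k + N = M by rewrite /M; field; lra.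
have chain n : forall e e', 0 < e -> e <= e' -> e' <= r0 -> e' <= 2 ^+ n * e -> 
    `|T e - T e'| <= M * q e'.
  elim: n => [|n IH] e e' e0 ee' e'r.
    rewrite expr0 mul1r => e'e; have -> : e = e' by apply/eqP; rewrite eq_le ee'.
    by rewrite subrr normr0 mulr_ge0 ?sqrtr_ge0// ltW.
  have e'0 : 0 < e' by exact: lt_le_trans ee'.
  rewrite exprS -mulrA => e'n.
  have NM : N * q e' <= M * q e'.
    by apply: ler_wpM2r; [exact: sqrtr_ge0|rewrite -MN lerDr mulr_ge0// ltW].
  have [->|ne] := eqVneq e e'.
    by rewrite subrr normr0 mulr_ge0 ?sqrtr_ge0// ltW.
  have lee : e < e' by rewrite lt_neqAle ne.
  have [le2|gt2] := leP e' (2 * e); first by apply: le_trans NM; exact: step.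
  have h1 : `|T e - T (e' / 2)| <= M * q (e' / 2).
    by apply: IH => //; lra.
  have h2 : `|T (e' / 2) - T e'| <= N * q e' by apply: step; lra.
  apply: (le_trans (ler_distD (T (e' / 2)) _ _)); apply: (le_trans (lerD h1 h2)).
  by rewrite qk// mulrA -mulrDl MN.
have /cvg_ex[E TE] : cvg (T e @[e --> 0^'+]); last by exists E.
apply/cauchy_cvgP; apply: cauchy_exP => eps eps0.
pose delta := eps / (2 * M).
have delta0 : 0 < delta by rewrite divr_gt0// mulr_gt0.
pose rho := Num.min r0 (delta ^+ 4).
have rho0 : 0 < rho by rewrite lt_min r00 exprn_gt0.
exists (T rho); change (\forall e \near 0^'+, ball (T rho) eps (T e)); near=> e.
have e0 : 0 < e by near: e; exact: nbhs_right_gt.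
have er : e < rho by near: e; exact: nbhs_right_lt.
have qr : q rho <= delta.
  rewrite -[leRHS]sqrt_sqrt_exp4 ?(ltW delta0)//.
  by do 2 apply: ler_wsqrtr; rewrite /rho ge_min lexx orbT.
have [n rn] : exists n, rho <= 2 ^+ n * e.
  exists (Num.truncn (rho / e)).+1; rewrite -ler_pdivrMr//.
  apply: (@le_trans _ _ (Num.truncn (rho / e)).+1%:R); first exact: ltW (Num.Theory.truncnS_gt _).
  by rewrite -natrX ler_nat ltnW// ltn_expl.
rewrite /ball/= distrC.
have rr : rho <= r0 by rewrite /rho ge_min lexx.
apply: (le_lt_trans (chain n e rho e0 (ltW er) rr rn)).
apply: (@le_lt_trans _ _ (M * delta)); first by rewrite ler_pM2l.
have -> : M * delta = eps / 2 by rewrite /delta; field; rewrite gt_eqF.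
by rewrite ltr_pdivrMr//; lra.
Unshelve. all: by end_near. Qed.

End dyadic.

Section energy_of_tubes.
Context d (T : measurableType d) {R : realType} (mu : {sigma_finite_measure set T -> \bar R}).
Variable D : T -> R.
Hypothesis mD : measurable_fun setT D.
Hypothesis D_ge0 : forall p, 0 <= D p.
Local Notation tubular := (tubular D).
Variables (A N r2 : R).
Hypotheses (A0 : 0 < A) (N0 : 0 < N) (r20 : 0 < r2).
Hypothesis V_asym : forall r, 0 < r -> r <= r2 ->
  mu (tubular r) \is a fin_num /\
  `|fine (mu (tubular r)) - A * r ^+ 2| <= N * (r ^+ 2 * Num.sqrt (Num.sqrt r)).

Variables (f : T -> R) (a C D0 : R).
Hypotheses (mf : measurable_fun setT f) (a0 : 0 <= a) (C0 : 0 < C) (D00 : 0 < D0).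
Hypothesis f_asym : forall p, 0 < D p -> D p <= D0 ->
  `|f p - a / D p ^+ 2| <= C / (D p * Num.sqrt (D p)).

(** On a shell, [f] is the inverse square of the distance up to an error whose
    integral is of lower order, the shell having volume of order [e ^+ 2]. *)
Lemma singular_shell : exists r4 N' : R, [/\ 0 < r4, r4 <= D0, 0 < N' & forall e e',
  0 < e -> e < e' -> e' <= 2 * e -> e' <= r4 ->
  mu.-integrable (shell D e e') (EFin \o f) /\
  `|\int[mu]_(p in shell D e e') f p - 2 * a * A * ln (e' / e)| <=
    N' * Num.sqrt (Num.sqrt e')].
Proof.
have [r3 [N' [r30 r32 N'0 sh]]] := inverse_square_shell mD D_ge0 A0 N0 r20 V_asym.
exists (Num.min (Num.min r3 D0) 1), (a * N' + 4 * C * (A + N)); split.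
- by rewrite !lt_min r30 D00 ltr01.
- by rewrite !ge_min lexx orbT.
- by rewrite ltr_wpDl ?mulr_ge0 ?(ltW N'0)// !mulr_gt0// addr_gt0.
move=> e e' e0 ee' e'2; rewrite !le_min => /andP[/andP[e'r3 e'D0] e'1].
have e'0 : 0 < e' by exact: lt_trans ee'.
have [iD bD] := sh e e' e0 ee' e'2 e'r3.
have msh : measurable (shell D e e') by exact: measurable_shell.
have e'r2 := le_trans e'r3 r32.
have [fV VA] := V_asym e'0 e'r2.
have sub : shell D e e' `<=` tubular e' by move=> p /andP[].
have mle : (mu (shell D e e') <= mu (tubular e'))%E.
  by apply: le_measure => //; rewrite inE//; exact: measurable_tubular.
have shfin : (mu (shell D e e') < +oo)%E.
  by apply: (le_lt_trans mle); rewrite ltey_eq fV.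
have Vle : fine (mu (shell D e e')) <= (A + N) * e' ^+ 2.
  have h1 : fine (mu (shell D e e')) <= fine (mu (tubular e')).
    by apply: fine_le => //; rewrite ge0_fin_numE.
  have h2 : N * (e' ^+ 2 * Num.sqrt (Num.sqrt e')) <= N * e' ^+ 2.
    rewrite ler_pM2l// ler_piMr ?sqr_ge0//.
    by rewrite -[leRHS]sqrtr1 ler_wsqrtr// -[leRHS]sqrtr1 ler_wsqrtr.
  by move: VA; rewrite ler_norml => /andP[_ h3]; lra.
pose g p := f p - a * (D p ^+ 2)^-1.
have mD2 : measurable_fun setT (fun p => (D p ^+ 2)^-1).
  by apply: measurable_inv; exact: measurable_funX.
have mg : measurable_fun (shell D e e') g.
  by apply: measurable_funTS; apply: measurable_funB => //; exact: measurable_funM.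
have es0 : 0 < e * Num.sqrt e by rewrite mulr_gt0// sqrtr_gt0.
have gb p : shell D e e' p -> `|g p| <= C / (e * Num.sqrt e).
  move=> /andP[eD De'].
  have Dp : 0 < D p by exact: lt_le_trans eD.
  apply: (le_trans (f_asym Dp (le_trans (ltW De') e'D0))).
  rewrite ler_pM2l// lef_pV2 ?posrE//; last by rewrite mulr_gt0// sqrtr_gt0.
  by apply: ler_pM; rewrite ?sqrtr_ge0 ?(ltW e0)// ler_wsqrtr.
have ig : mu.-integrable (shell D e e') (EFin \o g) by exact: bounded_integrable gb.
have iaD : mu.-integrable (shell D e e') (EFin \o (fun p => a * (D p ^+ 2)^-1)).
  by have := integrableZl msh a iD; apply: eq_integrable => // p _; rewrite /= EFinM.
have fE : f = (fun p => a * (D p ^+ 2)^-1 + g p) by apply/funext => p; rewrite /g; ring.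
split.
  have := integrableD msh iaD ig; apply: eq_integrable => // p _.
  by rewrite /= -EFinD /g; congr EFin; ring.
rewrite fE RintegralD// RintegralZl//.
have gI : `|\int[mu]_(p in shell D e e') g p| <= 4 * C * (A + N) * Num.sqrt (Num.sqrt e').
  apply: (le_trans (le_normr_Rintegral msh ig)).
  apply: (@le_trans _ _ (\int[mu]_(p in shell D e e') (C / (e * Num.sqrt e)))).
    apply: le_Rintegral => //.
      by have := integrable_abse ig; apply: eq_integrable.
    apply: (@bounded_integrable _ _ _ _ _ _ (C / (e * Num.sqrt e))) => // p _.
    by rewrite ger0_norm// divr_ge0// ltW.
  rewrite Rintegral_cst//.
  apply: (@le_trans _ _ (C / (e * Num.sqrt e) * ((A + N) * (4 * e ^+ 2)))).
    apply: ler_wpM2l; first by rewrite divr_ge0// ltW.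
    apply: (le_trans Vle); rewrite ler_pM2l ?addr_gt0//.
    have -> : 4 * e ^+ 2 = (2 * e) ^+ 2 by ring.
    by rewrite ler_pXn2r ?nnegrE ?mulr_ge0// ltW.
  have -> : C / (e * Num.sqrt e) * ((A + N) * (4 * e ^+ 2)) = 4 * C * (A + N) * Num.sqrt e.
    have se0 : Num.sqrt e != 0 by rewrite gt_eqF// sqrtr_gt0.
    rewrite -[in e ^+ 2](sqr_sqrtr (ltW e0)) -{1}(sqr_sqrtr (ltW e0)).
    by field.
  rewrite ler_pM2l; last by rewrite !mulr_gt0// addr_gt0.
  apply: ler_wsqrtr; apply: (le_trans (ltW ee')).
  rewrite -{1}(sqr_sqrtr (ltW e'0)) expr2 ler_piMr ?sqrtr_ge0//.
  by rewrite -[leRHS]sqrtr1 ler_wsqrtr.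
set I := (X in a * X); set J := (X in _ + X - _).
have -> : a * I + J - 2 * a * A * ln (e' / e) = a * (I - 2 * A * ln (e' / e)) + J by ring.
apply: (le_trans (ler_normD _ _)); rewrite [leRHS]mulrDl; apply: lerD => //.
by rewrite normrM (ger0_norm a0) -[leRHS]mulrA; apply: ler_wpM2l.
Qed.

Variables (B : set T) (R0 : R).
Hypotheses (mB : measurable B) (Bfin : (mu B < +oo)%E) (R00 : 0 < R0).
Hypotheses (B_tub : tubular R0 `<=` B) (B_D0 : forall p, B p -> D p <= D0).

Lemma singular_integrable (e : R) : 0 < e -> mu.-integrable (B `\` tubular e) (EFin \o f).
Proof.
move=> e0.
have mBe : measurable (B `\` tubular e) by apply: measurableD => //; exact: measurable_tubular.
have es0 : 0 < e * Num.sqrt e by rewrite mulr_gt0// sqrtr_gt0.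
apply: (@bounded_integrable _ _ _ _ _ _ (a / e ^+ 2 + C / (e * Num.sqrt e))) => //.
- apply: (le_lt_trans _ Bfin); apply: le_measure => //; rewrite ?inE//.
- exact: measurable_funTS.
move=> p [Bp /negP]; rewrite -leNgt => eD.
have Dp : 0 < D p by exact: lt_le_trans eD.
have := f_asym Dp (B_D0 Bp).
have : a / D p ^+ 2 <= a / e ^+ 2.
  apply: ler_wpM2l => //; rewrite lef_pV2 ?posrE ?exprn_gt0//.
  by rewrite ler_pXn2r ?nnegrE ?D_ge0 ?(ltW e0).
have : 0 <= a / D p ^+ 2 by rewrite divr_ge0 ?sqr_ge0.
have : C / (D p * Num.sqrt (D p)) <= C / (e * Num.sqrt e).
  rewrite ler_pM2l// lef_pV2 ?posrE//; last by rewrite mulr_gt0// sqrtr_gt0.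
  by apply: ler_pM; rewrite ?sqrtr_ge0 ?(ltW e0)// ler_wsqrtr.
by rewrite !ler_norml => h1 h2 h3 /andP[h4 h5]; apply/andP; split; lra.
Qed.

(** The logarithm cancels the main term of [singular_shell], and what is left
    satisfies the hypothesis of [dyadic_cvg]. *)
Lemma logarithmic_divergence : exists E : R,
  \int[mu]_(p in B `\` tubular e) f p - 2 * a * A * `|ln e| @[e --> 0^'+] --> E.
Proof.
have [r4 [N' [r40 r4D N'0 sh]]] := singular_shell.
pose r5 := Num.min (Num.min r4 R0) 1.
apply: (@dyadic_cvg _ (fun e => \int[mu]_(p in B `\` tubular e) f p - 2 * a * A * `|ln e|) N' r5) => //.
  by rewrite !lt_min r40 R00 ltr01.
move=> e e' e0 ee' e'2; rewrite !le_min => /andP[/andP[e'r4 e'R0] e'1].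
have e'0 : 0 < e' by exact: lt_trans ee'.
have [ish bsh] := sh e e' e0 ee' e'2 e'r4.
have mBe r : measurable (B `\` tubular r) by apply: measurableD => //; exact: measurable_tubular.
have BE : B `\` tubular e = (B `\` tubular e') `|` shell D e e'.
  apply/seteqP; split=> p.
    move=> [Bp De]; have [De'|e'D] := ltP (D p) e'.
      by right; rewrite /shell/= De' andbT leNgt; exact/negP.
    by left; split => //; apply/negP; rewrite -leNgt.
  case=> [[Bp /negP]|].
    by rewrite -leNgt => e'D; split => //; apply/negP; rewrite -leNgt (le_trans (ltW ee')).
  move=> /andP[eD De']; split; last by apply/negP; rewrite -leNgt.
  by apply: B_tub; exact: lt_le_trans De' _.
have lnE : ln (e' / e) = `|ln e| - `|ln e'|.
  have ln_neg (x : R) : 0 < x -> x <= 1 -> `|ln x| = - ln x.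
    by move=> x0 x1; rewrite ler0_norm// ln_le0.
  by rewrite !ln_neg ?(le_trans (ltW ee'))// ln_div ?posrE//; ring.
rewrite BE Rintegral_setU//; last 3 first.
- exact: measurable_shell.
- by rewrite -BE; exact: singular_integrable.
- apply/disj_setPS => p [[_ /negP]]; rewrite -leNgt => e'D /andP[_].
  by rewrite ltNge e'D.
move: bsh; rewrite lnE.
set I := (X in `|X - _| <= _ -> _); set J := Rintegral _ _ _ => bsh.
by rewrite (_ : J + I - _ - _ = I - 2 * a * A * (`|ln e| - `|ln e'|)) //; ring.
Qed.
End energy_of_tubes.

(** * Volume in coordinates *)

Section product_sigma_finite.
Context d1 d2 (T1 : measurableType d1) (T2 : measurableType d2) (R : realType).
Variables (m1 : {sigma_finite_measure set T1 -> \bar R}) (m2 : {sigma_finite_measure set T2 -> \bar R}).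
Local Open Scope ereal_scope.

Lemma sigma_finite_product : sigma_finite setT (m1 \x m2).
Proof.
have /sigma_finiteP[F [TF ndF Foo]] := sigma_finiteT m1.
have /sigma_finiteP[G [TG ndG Goo]] := sigma_finiteT m2.
exists (fun n => F n `*` G n) => [|k].
  apply/seteqP; split=> // -[x y] _.
  have [n _ Fnx] : (\bigcup_n F n) x by rewrite -TF.
  have [k _ Gky] : (\bigcup_n G n) y by rewrite -TG.
  exists (maxn n k) => //; split => /=.
    by move: x Fnx; exact/subsetPset/ndF/leq_maxl.
  by move: y Gky; exact/subsetPset/ndG/leq_maxr.
have [? ?] := Foo k; have [? ?] := Goo k.
split; first exact: measurableX.
by rewrite product_measure1E// lte_mul_pinfty// ge0_fin_numE.
Qed.

(** The product measure, bundled with its sigma-finiteness, so that products can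
    be iterated. *)
Definition sigma_finite_prod : {sigma_finite_measure set (T1 * T2)%type -> \bar R} :=
  HB.pack (m1 \x m2)%E (Measure_isSigmaFinite.Build _ _ _ (m1 \x m2)%E sigma_finite_product).

End product_sigma_finite.

Section space.
Context {R : realType}.
Local Notation leb := (@lebesgue_measure R).
Local Notation RR := (measurableTypeR R).

(** [lebesgue3], bundled as a sigma-finite measure. *)
Definition volume : {sigma_finite_measure set (RR * RR * RR)%type -> \bar R} :=
  sigma_finite_prod (sigma_finite_prod leb leb) leb.

Lemma tonelli3 (f : RR * RR * RR -> \bar R) :
  measurable_fun setT f -> (forall x, 0 <= f x)%E ->
  (\int[volume]_z f z = \int[leb]_x \int[leb]_y \int[leb]_z f ((x, y), z))%E.
Proof.
move=> mf f0; rewrite /volume (@fubini_tonelli1 _ _ _ _ _ (sigma_finite_prod leb leb) leb)//.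
rewrite fubini_tonelli1//; first exact: measurable_fun_fubini_tonelli_F.
by move=> x; apply: integral_ge0.
Qed.

Lemma row3E (p : RR * RR * RR) : [/\ row3 p 0 (inord 0) = p.1.1,
  row3 p 0 (inord 1) = p.1.2 & row3 p 0 (inord 2) = p.2].
Proof. by split; rewrite !mxE inordK. Qed.

Lemma measurable_sqrt d (T : measurableType d) (f : T -> R) :
  measurable_fun setT f -> measurable_fun setT (fun x => Num.sqrt (f x)).
Proof.
move=> mf; have ms : measurable_fun setT (@Num.sqrt R).
  by apply: continuous_measurable_fun; exact: sqrt_continuous.
exact: (measurableT_comp ms mf).
Qed.

(** Stated on coordinates, so that vectors need no sigma-algebra of their own. *)
Definition coord_measurable d (T : measurableType d) (F : T -> 'rV[R]_3) :=
  forall j, measurable_fun setT (fun x => F x 0 j).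

Lemma coord_measurable_row3 : coord_measurable (fun p : RR * RR * RR => row3 p).
Proof.
apply: ord3P.
- rewrite (_ : (fun p => _) = (fun p : RR * RR * RR => p.1.1)).
    exact: (measurableT_comp (@measurable_fst _ _ RR RR) (@measurable_fst _ _ (RR * RR)%type RR)).
  by apply/funext => p; have [] := row3E p.
- rewrite (_ : (fun p => _) = (fun p : RR * RR * RR => p.1.2)).
    exact: (measurableT_comp (@measurable_snd _ _ RR RR) (@measurable_fst _ _ (RR * RR)%type RR)).
  by apply/funext => p; have [] := row3E p.
- rewrite (_ : (fun p => _) = (fun p : RR * RR * RR => p.2)).
    exact: (@measurable_snd _ _ (RR * RR)%type RR).
  by apply/funext => p; have [] := row3E p.
Qed.

Lemma coord_measurable_comp d d' (T : measurableType d) (T' : measurableType d')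
    (F : T' -> 'rV[R]_3) (h : T -> T') :
  measurable_fun setT h -> coord_measurable F -> coord_measurable (F \o h).
Proof. by move=> mh mF j; exact: (measurableT_comp (mF j) mh). Qed.

Lemma coord_measurable_continuous (g : R -> 'rV[R]_3) : continuous g ->
  coord_measurable (g : RR -> 'rV[R]_3).
Proof.
move=> cg j; apply: continuous_measurable_fun => t.
exact: (continuous_comp (cg t) (@coord_continuous _ _ _ _ _ _)).
Qed.

Section algebra.
Context d (T : measurableType d).
Implicit Types F G : T -> 'rV[R]_3.

Lemma coord_measurableB F G : coord_measurable F -> coord_measurable G ->
  coord_measurable (fun x => F x - G x).
Proof.
move=> mF mG j; rewrite (_ : (fun x => _) = (fun x => F x 0 j - G x 0 j)).
  exact: measurable_funB.
by apply/funext => x; rewrite !mxE.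
Qed.

Lemma measurable_dot F G : coord_measurable F -> coord_measurable G ->
  measurable_fun setT (fun x => dot (F x) (G x)).
Proof. by move=> mF mG; apply: measurable_sum => i; exact: measurable_funM. Qed.

Lemma measurable_enorm F : coord_measurable F -> measurable_fun setT (fun x => enorm (F x)).
Proof. by move=> mF; apply: measurable_sqrt; exact: measurable_dot. Qed.

Lemma coord_measurable_cross F G : coord_measurable F -> coord_measurable G ->
  coord_measurable (fun x => cross (F x) (G x)).
Proof.
move=> mF mG; have mij i j : measurable_fun setT (fun x => F x 0 i * G x 0 j).
  exact: measurable_funM.
apply: ord3P.
- rewrite (_ : (fun x => _) = (fun x => F x 0 (inord 1) * G x 0 (inord 2)
    - F x 0 (inord 2) * G x 0 (inord 1))); first exact: measurable_funB.
  by apply/funext => x; have [] := crossE (F x) (G x).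
- rewrite (_ : (fun x => _) = (fun x => F x 0 (inord 2) * G x 0 (inord 0)
    - F x 0 (inord 0) * G x 0 (inord 2))); first exact: measurable_funB.
  by apply/funext => x; have [] := crossE (F x) (G x).
- rewrite (_ : (fun x => _) = (fun x => F x 0 (inord 0) * G x 0 (inord 1)
    - F x 0 (inord 1) * G x 0 (inord 0))); first exact: measurable_funB.
  by apply/funext => x; have [] := crossE (F x) (G x).
Qed.

End algebra.

(** The integral over space of the half-sphere profile centered at [y], slice by
    slice. *)
Lemma integral_half_ball (r : R) (y : 'rV[R]_3) : 0 < r ->
  (\int[volume]_p (Num.sqrt (r ^+ 2 - enorm (row3 p - y) ^+ 2))%:E =
   (cosint 2 * cosint 3 * cosint 4 * r ^+ 4)%:E)%E.
Proof.
move=> r0; rewrite tonelli3; last 2 first.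
- apply/measurable_EFinP; apply: measurable_sqrt; apply: measurable_funB => //.
  apply: measurable_funX; apply: measurable_enorm.
  apply: coord_measurableB; first exact: coord_measurable_row3.
  by move=> j; exact: measurable_cst.
- by move=> p; rewrite lee_fin sqrtr_ge0.
set a := y 0 (inord 0); set b := y 0 (inord 1); set c := y 0 (inord 2).
have distE x1 x2 x3 : r ^+ 2 - enorm (row3 ((x1, x2), x3) - y) ^+ 2 =
    (r ^+ 2 - (x1 - a) ^+ 2 - (x2 - b) ^+ 2) - (x3 - c) ^+ 2.
  rewrite enorm_sqr dotE; have [/= h0 h1 h2] := row3E ((x1, x2), x3).
  have hB i : (row3 (x1, x2, x3) - y) 0 i = row3 (x1, x2, x3) 0 i - y 0 i by rewrite !mxE.
  by rewrite !hB h0 h1 h2 /a /b /c; ring.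
have inner x1 x2 : (\int[leb]_x3 (Num.sqrt (r ^+ 2 - enorm (row3 ((x1, x2), x3) - y) ^+ 2))%:E =
    (cosint 2 * Num.sqrt (r ^+ 2 - (x1 - a) ^+ 2 - (x2 - b) ^+ 2) ^+ 2)%:E)%E.
  rewrite mulrC -(integral_sqrt_power _ c 0); apply: eq_integral => x3 _.
  by rewrite distE expr1.
have mpow k A e : measurable_fun [set: RR] (fun s : RR => (Num.sqrt (A - (s - e) ^+ 2) ^+ k : R)%:E).
  apply/measurable_EFinP; apply: measurable_funX; apply: measurable_sqrt.
  apply: measurable_funB => //; apply: measurable_funX.
  by apply: measurable_funB => //; exact: measurable_id.
have cst_power k e A (k0 : 0 <= e) f : (\int[leb]_s (e * Num.sqrt (A - (s - f) ^+ 2) ^+ k.+1)%:E =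
    (e * cosint k.+2 * Num.sqrt A ^+ k.+2)%:E)%E.
  under eq_integral do rewrite EFinM.
  rewrite ge0_integralZl//.
  by rewrite integral_sqrt_power -EFinM; congr EFin; ring.
have c20 : 0 <= cosint 2 :> R by rewrite cosint2 divr_ge0 ?pi_ge0.
have c30 : 0 <= cosint 3 :> R by rewrite cosint3 divr_ge0.
under eq_integral => x1 _.
  under eq_integral do rewrite inner.
  rewrite cst_power//; over.
rewrite /= cst_power ?mulr_ge0//; congr EFin.
by rewrite sqrtr_sqr ger0_norm// ltW.
Qed.

End space.

(** * Tubes around the loop *)

Section parametric.
Context {R : realType} d (T : measurableType d).
Local Notation leb := (@lebesgue_measure R).
Local Notation RR := (measurableTypeR R).

(** By Tonelli's theorem for the positive and the negative part of the integrand. *)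
Lemma measurable_parametric (F : T * RR -> R) (a b : R) : measurable_fun setT F ->
  measurable_fun setT (fun p => \int[leb]_(t in `[a, b[) F (p, t)).
Proof.
move=> mF; pose G (z : T * RR) : \bar R := (F z * \1_(`[a, b[%classic : set R) z.2)%:E.
have mG : measurable_fun setT G.
  apply/measurable_EFinP; apply: measurable_funM => //.
  have mI : measurable_fun setT (\1_(`[a, b[%classic : set R) : RR -> R).
    by apply: measurable_indic; exact: measurable_itv.
  exact: (measurableT_comp mI (@measurable_snd _ _ T RR)).
rewrite (_ : (fun p => _) = fine \o (fun p => \int[leb]_t G^\+%E (p, t) - \int[leb]_t G^\-%E (p, t))%E).
  apply: measurableT_comp; first exact: fine_measurable.
  apply: emeasurable_funB.
    exact: (@measurable_fun_fubini_tonelli_F _ _ _ _ _ leb _ (measurable_funepos mG) (funepos_ge0 G)).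
  exact: (@measurable_fun_fubini_tonelli_F _ _ _ _ _ leb _ (measurable_funeneg mG) (funeneg_ge0 G)).
apply/funext => p; rewrite /Rintegral integral_mkcond /=; congr fine.
rewrite (_ : _ \_ _ = (fun t => G (p, t))); first by rewrite [LHS]integralE; congr (_ - _)%E; apply: eq_integral => t _; rewrite ?funeposE ?funenegE.
apply/funext => t; rewrite patchE /G indicE; case: ifPn => /=.
  by rewrite mulr1.
by rewrite mulr0.
Qed.

End parametric.

Section loop_in_space.
Context {R : realType} (g : R -> 'rV[R]_3).
Hypothesis H : regular_loop g.
Local Notation leb := (@lebesgue_measure R).
Local Notation RR := (measurableTypeR R).
Local Notation R3 := (RR * RR * RR)%type.

Definition loop_dist (p : R3) : R := edist_set (row3 p) (range g).

Lemma loop_dist_ge0 p : 0 <= loop_dist p.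
Proof. by have [t0 [_ E _]] := nearest_point H (row3 p); rewrite /loop_dist E enorm_ge0. Qed.

Lemma foot_dist p : exists2 t0, foot g (row3 p) t0 & loop_dist p = enorm (row3 p - g t0).
Proof. by have [t0 [h E o]] := nearest_point H (row3 p); exists t0. Qed.

(** Rational parameters suffice to compute the distance. *)
Lemma measurable_loop_dist : measurable_fun setT loop_dist.
Proof.
apply: (measurability (@RGenInftyO.G R)) => [|/= _ [_ [r ->] <-]].
  exact: RGenInftyO.measurableE.
rewrite setTI.
have -> : loop_dist @^-1` `]-oo, r[ =
    \bigcup_(q : rat) [set p | enorm (row3 p - g (ratr q)) < r].
  apply/seteqP; split=> p; rewrite /= ?in_itv/=.
    have [t0 _ ->] := foot_dist p => lt_r.
    have cd : continuous (fun t => enorm (row3 p - g t)) by exact: (continuous_dist H).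
    have := cd t0; move/cvgrPdist_lt => /(_ (r - enorm (row3 p - g t0))).
    rewrite subr_gt0 => /(_ lt_r) /nbhs_ballP[e /= e0 be].
    have [q] := @rat_in_itvoo R t0 (t0 + e) (ltac:(by rewrite ltrDl)).
    rewrite in_itv/= => /andP[tq qe]; exists q => //=.
    have : `|enorm (row3 p - g t0) - enorm (row3 p - g (ratr q))| < r - enorm (row3 p - g t0).
      by apply: be; rewrite /ball/= ltr_norml; apply/andP; split; lra.
    by rewrite ltr_norml => /andP[? ?]; lra.
  move=> [q _ /=]; apply: le_lt_trans.
  by have [t0 [h _] ->] := foot_dist p.
apply: bigcupT_measurable_rat => q.
have m1 : measurable_fun [set: R3] (fun p : R3 => enorm (row3 p - g (ratr q))).
  apply: measurable_enorm; apply: coord_measurableB; first exact: coord_measurable_row3.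
  by move=> j; exact: measurable_cst.
have := m1 measurableT (`]-oo, r[%classic) (measurable_itv _); rewrite setTI.
congr measurable.
Qed.

Lemma coord_measurable_sub : coord_measurable (fun z : R3 * RR => row3 z.1 - g z.2).
Proof.
apply: coord_measurableB.
  exact: (coord_measurable_comp (@measurable_fst _ _ R3 RR) coord_measurable_row3).
apply: (coord_measurable_comp (@measurable_snd _ _ R3 RR)).
by apply: coord_measurable_continuous; exact: loop_continuous.
Qed.

Lemma coord_measurable_velocity : coord_measurable (fun z : R3 * RR => derive1 g z.2).
Proof.
apply: (coord_measurable_comp (@measurable_snd _ _ R3 RR)).
by apply: coord_measurable_continuous; exact: loop_continuous'.
Qed.

Lemma measurable_tube_kernel r : measurable_fun setT (fun z : R3 * RR => tube_kernel g r (row3 z.1) z.2).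
Proof.
apply: measurable_funM; last exact: measurable_enorm coord_measurable_velocity.
apply: measurable_sqrt; apply: measurable_funB => //; apply: measurable_funX.
exact: measurable_enorm coord_measurable_sub.
Qed.

Lemma measurable_biot_savart j :
  measurable_fun setT (fun z : R3 * RR => biot_savart g (row3 z.1) j z.2).
Proof.
apply: measurable_funM.
  exact: coord_measurable_cross coord_measurable_sub coord_measurable_velocity j.
apply: measurable_inv; apply: measurable_funX.
exact: measurable_enorm coord_measurable_sub.
Qed.

Definition tube_mass r (p : R3) : R := \int[leb]_(t in `[0, 1[) tube_kernel g r (row3 p) t.

Definition loop_length : R := \int[leb]_(t in `[0, 1[) enorm (derive1 g t).

Lemma hausdorff_loop : fine (hausdorff 1 (range g)) = loop_length.
Proof.
rewrite (range_fundamental H 0) add0r hausdorff_arcE//.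
- by move=> t; exact: loop_derivable.
- exact: loop_continuous'.
- by have := @injective_fundamental _ _ H 0; rewrite add0r.
Qed.

(** Integrals along the loop do not depend on the period over which they are
    computed: they are all integrals against the length measure. *)
Lemma period_shift (f : 'rV[R]_3 -> R) (a : R) : continuous (f \o g) ->
  area_integral 1 (range g) f = \int[leb]_(t in `[a, (a + 1)[) (f (g t) * enorm (derive1 g t)).
Proof.
move=> cf; rewrite (range_fundamental H a) arc_integralE//.
- by move=> t; exact: loop_derivable.
- exact: loop_continuous'.
- by rewrite lerDl.
- exact: injective_fundamental.
Qed.

Lemma tube_mass_shift r p a : tube_mass r p = \int[leb]_(t in `[a, (a + 1)[) tube_kernel g r (row3 p) t.
Proof.
have cf : continuous ((fun y => Num.sqrt (r ^+ 2 - enorm (row3 p - y) ^+ 2)) \o g).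
  apply: continuous_sqrt; apply: continuousB; first exact: continuous_const.
  by apply: continuousX; exact: (continuous_dist H).
have := period_shift 0 cf; rewrite add0r => E0.
by rewrite /tube_mass /tube_kernel -E0 (period_shift a cf).
Qed.

Lemma tube_mass_ge0 r p : 0 <= tube_mass r p.
Proof. by apply: Rintegral_ge0 => t _; rewrite mulr_ge0 ?sqrtr_ge0 ?enorm_ge0. Qed.

Lemma tube_mass_far r p : 0 < r -> r <= loop_dist p -> tube_mass r p = 0.
Proof.
move=> r0 rD; rewrite /tube_mass -[RHS](mul0r (1 - 0)) -(Rintegral_co_cst _ ler01); apply: eq_Rintegral => t _.
apply: tube_kernel_far; last exact: ltW.
by apply: (le_trans rD); have [t0 [h _] ->] := foot_dist p.
Qed.

Lemma tube_mass_near : exists C r1 : R, [/\ 0 < C, 0 < r1 & forall r p,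
  loop_dist p < r -> r <= r1 ->
  `|tube_mass r p - cosint 2 * (r ^+ 2 - loop_dist p ^+ 2)| <= C * (r ^+ 2 * Num.sqrt r)].
Proof.
have [C [r1 [C0 r10 near]]] := tube_kernel_asymptotics H.
exists C, r1; split => // r p; have [t0 ft ->] := foot_dist p => dr rr1.
have tE : t0 - 1 / 2 + 1 = t0 + 1 / 2 by lra.
by rewrite (tube_mass_shift r p (t0 - 1 / 2)) tE; exact: near r (row3 p) t0 ft dr rr1.
Qed.

Lemma loop_length_gt0 : 0 < loop_length.
Proof.
have [m [M [m0 _ mM]]] := speed_bounds H.
apply: (@lt_le_trans _ _ (\int[leb]_(t in `[0, 1[) m)).
  by rewrite (Rintegral_co_cst m ler01) subr0 mulr1.
apply: le_Rintegral_co; first exact: continuous_const.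
  by exact: (continuous_speed (loop_continuous' H)).
by move=> t _; have /andP[] := mM t.
Qed.

(** By Tonelli's theorem: every point of the loop contributes the same integral
    over space. *)
Lemma integral_tube_mass r : 0 < r ->
  (\int[volume]_p (tube_mass r p)%:E =
   (loop_length * cosint 2 * cosint 3 * cosint 4 * r ^+ 4)%:E)%E.
Proof.
move=> r0; pose G (z : R3 * RR) : \bar R :=
  (tube_kernel g r (row3 z.1) z.2 * \1_(`[0, 1[%classic : set R) z.2)%:E.
have mI : measurable_fun setT (\1_(`[0, 1[%classic : set R) : RR -> R).
  by apply: measurable_indic; exact: measurable_itv.
have mG : measurable_fun setT G.
  apply/measurable_EFinP; apply: measurable_funM; first exact: measurable_tube_kernel.
  exact: (measurableT_comp mI (@measurable_snd _ _ R3 RR)).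
have K0 x t : 0 <= tube_kernel g r x t by rewrite mulr_ge0 ?sqrtr_ge0 ?enorm_ge0.
have G0 z : (0 <= G z)%E by rewrite lee_fin mulr_ge0.
transitivity (\int[volume]_p \int[leb]_t G (p, t))%E.
  apply: eq_integral => p _; rewrite /tube_mass /Rintegral fineK; last first.
    apply: integrable_fin_num => //.
    by apply: continuous_integrable; exact: continuous_tube_kernel.
  rewrite integral_mkcond; apply: eq_integral => t _; rewrite patchE /G indicE /=.
  by case: ifPn => _; rewrite ?mulr1 ?mulr0.
rewrite (fubini_tonelli G)//.
have ball_ t : (\int[volume]_p (Num.sqrt (r ^+ 2 - enorm (row3 p - g t) ^+ 2))%:E =
   (cosint 2 * cosint 3 * cosint 4 * r ^+ 4)%:E)%E by exact: integral_half_ball.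
set k := cosint 2 * cosint 3 * cosint 4 * r ^+ 4 in ball_.
transitivity (\int[leb]_t (k * (enorm (derive1 g t) * \1_(`[0, 1[%classic : set R) t))%:E)%E.
  apply: eq_integral => t _; rewrite [in RHS]EFinM -(ball_ t) muleC -ge0_integralZl//.
  - by apply: eq_integral => p _; rewrite -EFinM /G /tube_kernel/=; congr EFin; ring.
  - apply/measurable_EFinP; apply: measurable_sqrt; apply: measurable_funB => //.
    apply: measurable_funX; apply: measurable_enorm.
    apply: coord_measurableB; first exact: coord_measurable_row3.
    by move=> j; exact: measurable_cst.
  - by rewrite lee_fin mulr_ge0 ?enorm_ge0.
have k0 : 0 <= k.
  by rewrite /k cosint2 cosint3 cosint4 !mulr_ge0 ?exprn_ge0 ?invr_ge0 ?pi_ge0// ltW.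
under eq_integral do rewrite EFinM.
have cs : continuous (fun t => enorm (derive1 g t)) := continuous_speed (loop_continuous' H).
rewrite ge0_integralZl//; last 2 first.
- apply/measurable_EFinP; apply: measurable_funM => //.
  exact: continuous_measurable_fun.
- by move=> t _; rewrite lee_fin mulr_ge0 ?enorm_ge0.
rewrite (_ : (\int[leb]_t _)%E = loop_length%:E); last first.
  rewrite /loop_length /Rintegral fineK; last first.
    by apply: integrable_fin_num => //; exact: continuous_integrable.
  rewrite [RHS]integral_mkcond; apply: eq_integral => t _; rewrite patchE indicE /=.
  by case: ifPn => _; rewrite ?mulr1 ?mulr0.
by rewrite -EFinM /k; congr EFin; ring.
Qed.

(** The leading term of Weyl's tube formula. *)
Lemma loop_tube_volume : exists r2 N : R, [/\ 0 < r2, 0 < N & forall r, 0 < r -> r <= r2 ->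
  volume (tubular loop_dist r) \is a fin_num /\
  `|fine (volume (tubular loop_dist r)) - pi * loop_length * r ^+ 2| <=
    N * (r ^+ 2 * Num.sqrt (Num.sqrt r))].
Proof.
have [C [r1 [C0 r10 near]]] := tube_mass_near.
have c2 : 0 < cosint 2 :> R by rewrite cosint2 divr_gt0 ?pi_gt0.
have M0 : 0 < loop_length * cosint 2 * cosint 3 * cosint 4.
  rewrite cosint3 cosint4; apply: mulr_gt0; last by rewrite divr_gt0// mulr_gt0 ?pi_gt0.
  by apply: mulr_gt0; [exact: mulr_gt0 loop_length_gt0 c2|rewrite divr_gt0].
have mK r : measurable_fun setT (tube_mass r).
  exact: (measurable_parametric _ _ (measurable_tube_kernel r)).
have [r2 [N [r20 N0 vol]]] := tubular_measure measurable_loop_dist loop_dist_ge0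
  c2 M0 C0 r10 mK tube_mass_ge0 tube_mass_far near integral_tube_mass.
exists r2, N; split => // r r_gt0 rr2; have [fv] := vol r r_gt0 rr2.
split => //; have <- : 2 * (loop_length * cosint 2 * cosint 3 * cosint 4) / cosint 2 = pi * loop_length.
  have pi0 : (pi : R) != 0 by rewrite gt_eqF ?pi_gt0.
  by rewrite cosint2 cosint3 cosint4; move: (pi : R) pi0 => P pi0; field.
by [].
Qed.

End loop_in_space.

(** * The squared strain *)

Section strain.
Context {R : realType} (g : R -> 'rV[R]_3).
Hypothesis H : regular_loop g.
Local Notation leb := (@lebesgue_measure R).
Local Notation RR := (measurableTypeR R).
Local Notation R3 := (RR * RR * RR)%type.

Lemma frob_sqr_tensor (b w : 'rV[R]_3) : frob_sqr (tensor b w) = enorm b ^+ 2 * \sum_j w 0 j ^+ 2.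
Proof.
rewrite enorm_sqr /frob_sqr /dot mulr_suml; apply: eq_bigr => i _.
rewrite mulr_sumr; apply: eq_bigr => j _.
by rewrite /tensor mxE big_ord1 mxE exprMn expr2.
Qed.

Lemma crossZZ (a c : R) (v w : 'rV[R]_3) j : cross (a *: v) (c *: w) 0 j = a * c * cross v w 0 j.
Proof.
move: j; have [e0 e1 e2] := crossE (a *: v) (c *: w); have [f0 f1 f2] := crossE v w.
by apply: ord3P; rewrite ?e0 ?e1 ?e2 ?f0 ?f1 ?f2 !mxE; ring.
Qed.

Lemma tangent_loop t : tangent g (g t) = (enorm (derive1 g t))^-1 *: derive1 g t.
Proof.
rewrite /tangent; set s := xget _ _.
have gs : g s = g t by exact: (@xgetI _ 0 [set s | g s = g t] t).
have [k ->] := injective_mod1 H gs.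
have dp := derive1_periodic (fun t => loop_periodic H t).
by rewrite (periodic_int k t dp).
Qed.

(** The speed in the area formula cancels the normalization of the tangent; the
    factor [- (4 * pi)^-1] of the kernel is all that distinguishes the strain from
    the Biot-Savart field. *)
Lemma strain_sqr (b x : 'rV[R]_3) (a : R) : (forall t, 0 < enorm (x - g t)) ->
  frob_sqr (singular_strain b g x) = enorm b ^+ 2 / (4 * pi) ^+ 2 *
    \sum_j (\int[leb]_(t in `[a, (a + 1)[) biot_savart g x j t) ^+ 2.
Proof.
move=> xg; rewrite frob_sqr_tensor -mulrA; congr (_ * _); rewrite mulr_sumr.
apply: eq_bigr => j _; rewrite mxE.
have cB := continuous_biot_savart H (j := j) xg.
have v0 t : enorm (derive1 g t) != 0 by rewrite enorm_eq0 loop_regular.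
have fE t : cross (strain_kernel (x - g t)) (tangent g (g t)) 0 j =
    - (4 * pi)^-1 * biot_savart g x j t * (enorm (derive1 g t))^-1.
  rewrite tangent_loop /strain_kernel crossZZ /biot_savart invfM; ring.
have cf : continuous ((fun y => cross (strain_kernel (x - y)) (tangent g y) 0 j) \o g).
  rewrite (_ : _ \o g = (fun t => - (4 * pi)^-1 * biot_savart g x j t * (enorm (derive1 g t))^-1)).
    apply: continuousM; first by apply: continuousM; [exact: continuous_const|].
    by apply: continuous_inv => //; exact: (continuous_speed (loop_continuous' H)).
  by apply/funext => t; rewrite /= fE.
rewrite (period_shift H a cf).
have -> : \int[leb]_(t in `[a, (a + 1)[) (cross (strain_kernel (x - g t)) (tangent g (g t)) 0 j * enorm (derive1 g t))
    = \int[leb]_(t in `[a, (a + 1)[) (- (4 * pi)^-1 * biot_savart g x j t).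
  by apply: eq_Rintegral => t _; rewrite fE divfK.
rewrite RintegralZl//; last exact: continuous_integrable.
by rewrite exprMn sqrrN exprVn.
Qed.

(** The squared strain off the loop, as a parametric integral over one fixed
    period: in this form it is measurable on the whole space. *)
Definition strain_density (b : 'rV[R]_3) (p : R3) : R := enorm b ^+ 2 / (4 * pi) ^+ 2 *
  \sum_j (\int[leb]_(t in `[0, 1[) biot_savart g (row3 p) j t) ^+ 2.

Lemma measurable_strain_density b : measurable_fun setT (strain_density b).
Proof.
apply: measurable_funM => //; apply: measurable_sum => j; apply: measurable_funX.
exact: (measurable_parametric _ _ (measurable_biot_savart H j)).
Qed.

Lemma off_loop p : 0 < loop_dist g p -> forall t, 0 < enorm (row3 p - g t).
Proof. by have [t0 [h _] ->] := foot_dist H p => /lt_le_trans + t; apply. Qed.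

Lemma strain_densityE b p : 0 < loop_dist g p ->
  frob_sqr (singular_strain b g (row3 p)) = strain_density b p.
Proof. by move=> /off_loop xg; rewrite (strain_sqr b 0 xg) add0r. Qed.

Lemma strain_density_asymptotics (b : 'rV[R]_3) (D : R) : b != 0 -> 0 < D ->
  exists2 C, 0 < C & forall p, 0 < loop_dist g p -> loop_dist g p <= D ->
  `|strain_density b p - enorm b ^+ 2 / (4 * pi ^+ 2) / loop_dist g p ^+ 2| <=
    C / (loop_dist g p * Num.sqrt (loop_dist g p)).
Proof.
move=> b0 D0; have [C C0 asym] := field_sqr_asymptotics H D0.
have pi0 : 0 < (pi : R) by exact: pi_gt0.
set k := enorm b ^+ 2 / (4 * pi) ^+ 2.
have k0 : 0 < k by rewrite divr_gt0// exprn_gt0 ?enorm_gt0 ?mulr_gt0.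
exists (k * C); first exact: mulr_gt0.
move=> p Dp0 DpD; rewrite -strain_densityE//.
have [t0 ft E] := foot_dist H p; rewrite (strain_sqr b (t0 - 1 / 2) (off_loop Dp0)).
have tE : t0 - 1 / 2 + 1 = t0 + 1 / 2 by lra.
rewrite tE -/k E in Dp0 DpD *.
have := asym (row3 p) t0 ft Dp0 DpD; set S := \sum_j _; set d := enorm _ => h.
have -> : k * S - enorm b ^+ 2 / (4 * pi ^+ 2) / d ^+ 2 = k * (S - 4 / d ^+ 2).
  have d0 : d != 0 by rewrite gt_eqF.
  rewrite /k; move: (pi : R) (lt0r_neq0 pi0) => P P0; field.
  by rewrite d0.
by rewrite normrM gtr0_norm// -[leRHS]mulrA; apply: ler_wpM2l; first exact: ltW.
Qed.

End strain.

(** * The domain *)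

Section domain.
Context {R : realType}.
Local Notation RR := (measurableTypeR R).
Local Notation R3 := (RR * RR * RR)%type.

(** Open sets are countable unions of rational boxes. *)
Lemma measurable_row3_open (U : set 'rV[R]_3) : open U -> measurable (row3 @^-1` U : set R3).
Proof.
move=> oU; pose box (q : rat * rat * rat * nat) : set R3 :=
  [set p | [/\ `|p.1.1 - ratr q.1.1.1| < q.2.+1%:R^-1, `|p.1.2 - ratr q.1.1.2| < q.2.+1%:R^-1
    & `|p.2 - ratr q.1.2| < q.2.+1%:R^-1]].
pose good (q : rat * rat * rat * nat) := box q `<=` row3 @^-1` U.
have -> : row3 @^-1` U = \bigcup_q [set p | box q p /\ good q].
  apply/seteqP; split=> [p Up|p [q _ [bp gq]]]; last exact: gq.
  have [e /= e0 be] : exists2 e : R, 0 < e & ball (row3 p) e `<=` U.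
    by have /nbhs_ballP[e] := open_nbhs_nbhs (conj oU Up); exists e.
  have [n ne] : exists n : nat, n.+1%:R^-1 < e / 2.
    have e20 : 0 < e / 2 by rewrite divr_gt0.
    exists (Num.truncn (e / 2)^-1).
    by rewrite invf_plt ?posrE// Num.Theory.truncnS_gt.
  have n0 : 0 < n.+1%:R^-1 :> R by rewrite invr_gt0.
  have near (x k : R) : 0 < k -> exists q : rat, `|x - ratr q| < k.
    move=> k0; have [q] := @rat_in_itvoo R x (x + k) (ltac:(by rewrite ltrDl)).
    rewrite in_itv/= => /andP[xq qx]; exists q.
    by rewrite ltr_norml; apply/andP; split; lra.
  have [q1 h1] := near p.1.1 _ n0; have [q2 h2] := near p.1.2 _ n0.
  have [q3 h3] := near p.2 _ n0.
  exists (((q1, q2), q3), n) => //; split => // p' [/= h1' h2' h3']; apply: be.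
  have tri (x y z : R) : `|x - z| < n.+1%:R^-1 -> `|y - z| < n.+1%:R^-1 -> ball x e y.
    move=> xz yz; rewrite /ball/= (le_lt_trans (ler_distD z x y))// (distrC z).
    by rewrite [ltRHS](splitr e); apply: ltrD; [exact: lt_trans xz ne|exact: lt_trans yz ne].
  split=> // i; rewrite (ord1 i); move=> {i}.
  have [E1 E2 E3] := row3E p; have [E1' E2' E3'] := row3E p'.
  apply: ord3P; rewrite ?E1 ?E2 ?E3 ?E1' ?E2' ?E3'.
  - exact: (tri _ _ (ratr q1)).
  - exact: (tri _ _ (ratr q2)).
  - exact: (tri _ _ (ratr q3)).
apply: countable_bigcupT_measurable => [|q]; first exact: countableP.
have [gq|ngq] := pselect (good q); last first.
  by rewrite (_ : [set _ | _] = set0)//; apply/seteqP; split => p [].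
rewrite (_ : [set _ | _] = box q); last by apply/seteqP; split => p // [].
have mI (f : R3 -> R) (c : rat) : measurable_fun setT f ->
    measurable [set p | `|f p - ratr c| < q.2.+1%:R^-1].
  move=> mf; have mn : measurable_fun setT (fun p => `|f p - ratr c|).
    by apply: measurableT_comp => //; exact: measurable_funB.
  have := mn measurableT (`]-oo, q.2.+1%:R^-1[%classic) (measurable_itv _).
  by rewrite setTI; congr measurable.
have m1 := mI _ q.1.1.1 (measurableT_comp (@measurable_fst _ _ RR RR) (@measurable_fst _ _ (RR * RR)%type RR)).
have m2 := mI _ q.1.1.2 (measurableT_comp (@measurable_snd _ _ RR RR) (@measurable_fst _ _ (RR * RR)%type RR)).
have m3 := mI _ q.1.2 (@measurable_snd _ _ (RR * RR)%type RR).
rewrite (_ : box q = [set p | `|p.1.1 - ratr q.1.1.1| < q.2.+1%:R^-1] `&`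
  [set p | `|p.1.2 - ratr q.1.1.2| < q.2.+1%:R^-1] `&` [set p | `|p.2 - ratr q.1.2| < q.2.+1%:R^-1]).
  by apply: measurableI => //; exact: measurableI.
by apply/seteqP; split => p; [case|case=> -[]].
Qed.

Lemma bounded_enorm (U : set 'rV[R]_3) : bounded_set U -> exists2 M : R, 0 < M & forall x, U x -> enorm x <= M.
Proof.
move=> [M [_ hM]]; exists (3 * (`|M| + 1)); first by rewrite mulr_gt0// ltr_wpDl.
move=> x Ux; apply: (le_trans (le_enorm_mx_norm x)); rewrite ler_pM2l//.
by apply: hM => //; rewrite (le_lt_trans (ler_norm M))// ltrDl.
Qed.

Lemma bounded_volume (U : set 'rV[R]_3) : open U -> bounded_set U ->
  (volume (row3 @^-1` U : set R3) < +oo)%E.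
Proof.
move=> oU /bounded_enorm[M M0 UM].
have mI : measurable (`[- M, M]%classic : set RR) by exact: measurable_itv.
have sub : row3 @^-1` U `<=` ((`[- M, M] `*` `[- M, M]) `*` `[- M, M] : set R3).
  move=> p /UM pM; have [E1 E2 E3] := row3E p.
  have c i : - M <= row3 p 0 i <= M by rewrite -ler_norml (le_trans (enorm_coord _ _)).
  by split; [split|]; rewrite /= in_itv/= -?E1 -?E2 -?E3.
apply: (@le_lt_trans _ _ (volume ((`[- M, M] `*` `[- M, M]) `*` `[- M, M] : set R3))).
  apply: le_measure => //; rewrite inE; first exact: measurable_row3_open.
  by apply: measurableX => //; exact: measurableX.
rewrite /volume /= product_measure1E//; last exact: measurableX.
rewrite /= product_measure1E//.
have fin_I : lebesgue_measure (`[- M, M]%classic : set R) \is a fin_num.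
  by rewrite lebesgue_measure_itv/=; case: ifP.
by rewrite ltey_eq !fin_numM.
Qed.

Lemma edist_set_lip (A : set 'rV[R]_3) x y : A !=set0 -> edist_set x A <= enorm (x - y) + edist_set y A.
Proof.
move=> A0; rewrite -lerBlDl; apply: lb_le_inf; first by case: A0 => z Az; exists (enorm (y - z)), z.
move=> _ [z Az <-]; rewrite lerBlDl; apply: (le_trans _ (enormD3 x y z)).
by apply: ge_inf; [exists 0 => _ [w _ <-]; exact: enorm_ge0|exists z].
Qed.

Lemma edist_set_le (A : set 'rV[R]_3) x y : A y -> edist_set x A <= enorm (x - y).
Proof. by move=> Ay; apply: ge_inf; [exists 0 => _ [w _ <-]; exact: enorm_ge0|exists y]. Qed.

Variable g : R -> 'rV[R]_3.
Hypothesis H : regular_loop g.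

(** The distance from [g t] to the complement of the domain is positive,
    continuous and periodic in [t], so it has a positive minimum. *)
Lemma tube_in_domain (U : set 'rV[R]_3) : open U -> range g `<=` U ->
  exists2 r : R, 0 < r & tubular (loop_dist g) r `<=` (row3 @^-1` U).
Proof.
move=> oU gU; have [[z Uz]|U0] := pselect (~` U !=set0); last first.
  exists 1 => // p _; apply: contrapT => nU; apply: U0; exact: (ex_intro _ (row3 p)).
have ne : ~` U !=set0 by exists z.
pose rho t := edist_set (g t) (~` U).
have cr : continuous rho.
  move=> t; apply/cvgrPdist_lt => e e0.
  have := @continuous_dist _ _ H (g t) t => /cvgrPdist_lt /(_ e e0).
  rewrite subrr enorm0; apply: filterS => s; rewrite sub0r normrN ger0_norm ?enorm_ge0//.
  apply: le_lt_trans; rewrite ler_norml.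
  have := edist_set_lip (g t) (g s) ne; have := edist_set_lip (g s) (g t) ne.
  by rewrite (enormB (g s)) -!/(rho _) => ? ?; apply/andP; split; lra.
have pr t : rho (t + 1) = rho t by rewrite /rho (loop_periodic H).
have [t0 rmin] := periodic_min cr pr.
exists (rho t0).
  have Ugt : U (g t0) by apply: gU; exists t0.
  have /nbhs_ballP[e /= e0 be] := open_nbhs_nbhs (conj oU Ugt).
  apply: (lt_le_trans e0); apply: lb_le_inf; first by exists (enorm (g t0 - z)), z.
  move=> _ [y nUy <-]; apply: (le_trans _ (mx_norm_le_enorm _)); rewrite leNgt.
  by apply/negP => lt_e; apply: nUy; apply: be; rewrite -ball_normE /ball_/=.
move=> p; rewrite /tubular/=; have [t1 _ ->] := foot_dist H p => lt_r.
apply: contrapT => nU.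
have := @edist_set_le (~` U) (g t1) (row3 p) nU; rewrite -/(rho t1) enormB leNgt => /negP; apply.
exact: lt_le_trans lt_r (rmin t1).
Qed.

Lemma loop_dist_bounded (U : set 'rV[R]_3) : bounded_set U ->
  exists2 M : R, 0 < M & forall p, (row3 @^-1` U) p -> loop_dist g p <= M.
Proof.
move=> /bounded_enorm[M M0 UM]; exists (M + enorm (g 0)); first by rewrite ltr_pwDl ?enorm_ge0.
move=> p /UM pM; have [t0 [h _] ->] := foot_dist H p.
apply: (le_trans (h 0)); apply: (le_trans (enormD _ _)).
by rewrite enormN lerD.
Qed.

End domain.

(** * The renormalized energy *)

Theorem theorem4p5 (R : realType) (Omega : set 'rV[R]_3)
    (gamma : R -> 'rV[R]_3) (b : 'rV[R]_3) (u : 'rV[R]_3 -> 'rV[R]_3)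
    (Omega_domain : domain Omega) (Omega_bounded : bounded_set Omega)
    (Omega_sc : simply_connected Omega) (Omega_Lip : Lipschitz_boundary Omega)
    (gamma_C2 : C2_curve gamma) (gamma_emb : embedded_closed_curve gamma)
    (gamma_Omega : range gamma `<=` Omega)
    (b_neq0 : b != 0)
    (u_min : zero_mean_minimizer Omega b gamma u) :
  exists E : R,
    effective_energy Omega b gamma u e
      - enorm b ^+ 2 * fine (hausdorff 1 (range gamma)) / (4 * pi) * `|ln e|
    @[e --> 0^'+] --> E.
Proof.
have H : regular_loop gamma by split.
have [_ Omega_open _] := Omega_domain.
have [D0 D0_gt0 Omega_D0] := loop_dist_bounded H Omega_bounded.
have [R0 R0_gt0 tube_Omega] := tube_in_domain H Omega_open gamma_Omega.
have [C C_gt0 asym] := strain_density_asymptotics H b_neq0 D0_gt0.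
have [r2 [N [r2_gt0 N_gt0 vol]]] := loop_tube_volume H.
have pi_pos : 0 < (pi : R) by exact: pi_gt0.
have A_gt0 : 0 < pi * loop_length gamma by rewrite mulr_gt0// loop_length_gt0.
have a_ge0 : 0 <= enorm b ^+ 2 / (4 * pi ^+ 2).
  by rewrite divr_ge0 ?sqr_ge0// mulr_ge0 ?sqr_ge0.
pose F e : R := \int[volume]_(p in row3 @^-1` Omega `\` tubular (loop_dist gamma) e)
    strain_density gamma b p
  - 2 * (enorm b ^+ 2 / (4 * pi ^+ 2)) * (pi * loop_length gamma) * `|ln e|.
have [E limF] : exists E : R, F e @[e --> 0^'+] --> E.
  exact: (logarithmic_divergence (measurable_loop_dist H) (loop_dist_ge0 H)
    A_gt0 N_gt0 r2_gt0 vol (measurable_strain_density H b) a_ge0 C_gt0 D0_gt0 asym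
    (measurable_row3_open Omega_open) (bounded_volume Omega_open Omega_bounded) R0_gt0
    tube_Omega Omega_D0).
pose J := elastic_functional Omega b gamma u.
exists (1 / 2 * E + J).
have limJ : (1 / 2 * F e + J) @[e --> 0^'+] --> 1 / 2 * E + J.
  by apply: cvgD; [apply: cvgM => //; exact: cvg_cst|exact: cvg_cst].
apply: cvg_trans limJ; apply: near_eq_cvg; near=> e.
have e_gt0 : 0 < e by near: e; exact: nbhs_right_gt.
rewrite /effective_energy hausdorff_loop//.
have -> : vol_integral (Omega `\` tube (range gamma) e)
      (fun x => frob_sqr (singular_strain b gamma x)) =
    \int[volume]_(p in row3 @^-1` Omega `\` tubular (loop_dist gamma) e) strain_density gamma b p.
  apply: eq_Rintegral => p /set_mem[_ /negP]; rewrite -leNgt => eD /=.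
  by apply: strain_densityE => //; exact: lt_le_trans eD.
rewrite /= /F -/J; set I := Rintegral _ _ _.
move: (pi : R) pi_pos => P P0; field.
by rewrite gt_eqF.
Unshelve. all: by end_near. Qed.
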